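(* Let $F(t,z)\not\equiv 0$ be an entire function on $\mathbb{C}^2$ satisfying the heat equation $\partial_tF=\partial_z^2F$, whose $z$-order $\rho_z$ satisfies $\rho_z<1$. Let $z_1(t),z_2(t),\ldots$ be the zeros of $F(t,\cdot)$, listed with multiplicity. Let $z_k(t)$ be a branch of the zeros, i.e. a holomorphic function on a domain $D\subset\mathbb{C}$ with $F(t,z_k(t))=0$ for all $t\in D$. Then $$z_k'(t)=-2\sum_{j\ne k}\frac{1}{z_k(t)-z_j(t)}$$ for all $t\in D$ except for a discrete subset of $D$, where for each $t$ the sum runs over all the other zeros $z_j(t)$ of $F(t,\cdot)$.
   Context: The $z$-order of $F$ is the order of the entire function $z\mapsto F(t,z)$, which does not depend on $t\in\mathbb{C}$. The order of an entire function $g$ is $\limsup_{r\to\infty}\frac{\ln\ln M(r)}{\ln r}$ with $M(r)=\max_{|z|=r}|g(z)|$. A discrete subset of $D$ means a subset without accumulation points in $D$. *)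

(* Defs.v *)
(* Classical reals with Coquelicot: [C] is Coquelicot's type of complex numbers. *)
From Stdlib Require Import Reals List.
From Coquelicot Require Import Coquelicot.

Local Open Scope C_scope.

Definition entire1 (g : C -> C) : Prop :=
  forall z : C, ex_derive (K := C_AbsRing) (V := C_NormedModule) g z.

(* Holomorphy in two variables is complex Fréchet differentiability: the
   differential provided by [ex_filterdiff] is [C]-linear. *)
Definition entire2 (F : C -> C -> C) : Prop :=
  forall p : C * C,
    ex_filterdiff (K := C_AbsRing)
      (U := prod_NormedModule C_AbsRing C_NormedModule C_NormedModule)
      (V := C_NormedModule)
      (fun q : C * C => F (fst q) (snd q)) (locally p).

(* [C_derive] is total, but for an entire [F] all the derivatives occurring
   here exist, so that it is the genuine complex derivative. *)
Definition heat_equation (F : C -> C -> C) : Prop :=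
  forall t z : C,
    C_derive (fun s => F s z) t = C_derive (C_derive (F t)) z.

(* For [r >= 0] and continuous [g] the supremum is attained, by compactness of
   the circle. *)
Definition max_modulus (g : C -> C) (r : R) : R :=
  real (Lub_Rbar (fun y => exists z : C, Cmod z = r /\ y = Cmod (g z))).

Definition LimSup_p_infty (f : R -> R) : Rbar :=
  Rbar_glb (fun s => exists a : R,
    s = Lub_Rbar (fun y => exists r : R, (a < r)%R /\ y = f r)).

(* Since [ln x = 0] for [x <= 0], constant functions get order 0, as is
   customary. *)
Definition entire_order (g : C -> C) : Rbar :=
  LimSup_p_infty (fun r => (ln (ln (max_modulus g r)) / ln r)%R).

(* [w] is a zero of [g] of multiplicity exactly [n] ([n = 0] when [g w <> 0]);
   no [n] qualifies if [g] is identically zero. *)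
Definition has_multiplicity (g : C -> C) (w : C) (n : nat) : Prop :=
  exists h : C -> C,
    entire1 h /\ h w <> 0 /\ forall z : C, g z = (z - w) ^ n * h z.

(* A finite or infinite list of complex numbers is encoded by a sequence in
   [option C], where an index holding [None] carries no entry. *)
Definition lists_zeros (g : C -> C) (zs : nat -> option C) : Prop :=
  forall w : C, exists l : list nat,
    NoDup l /\ (forall j, In j l <-> zs j = Some w) /\
    has_multiplicity g w (length l).

Definition other_zero_term (zs : nat -> option C) (k : nat) (w : C) (j : nat)
    : C :=
  if Nat.eq_dec j k then 0
  else match zs j with
       | Some v => 1 / (w - v)
       | None => 0
       end.

Definition connected_set (D : C -> Prop) : Prop :=
  forall U V : C -> Prop,
    open U -> open V ->
    (forall t, D t -> U t \/ V t) ->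
    (exists t, D t /\ U t) -> (exists t, D t /\ V t) ->
    exists t, D t /\ U t /\ V t.

Definition complex_domain (D : C -> Prop) : Prop :=
  (exists t, D t) /\ open D /\ connected_set D.

Definition holomorphic_on (D : C -> Prop) (f : C -> C) : Prop :=
  forall t : C, D t -> ex_derive (K := C_AbsRing) (V := C_NormedModule) f t.

Definition discrete_subset (E D : C -> Prop) : Prop :=
  (forall t, E t -> D t) /\
  (forall t, D t -> locally' t (fun s => ~ E s)).

(* Main.v *)
Require Import Defs.
From Stdlib Require Import Reals List.
From Stdlib Require Import Factorial Wf_nat Lra Lia Psatz.
From Stdlib Require Import Classical ClassicalEpsilon FunctionalExtensionality.
From Coquelicot Require Import Coquelicot.

Local Open Scope R_scope.
Local Open Scope C_scope.

(** Where [F (t, -)] has a simple zero at [w = zk t], differentiating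
    [F (t, zk t) = 0] and using the heat equation gives
    [zk' = - F_zz / F_z].  Writing [F (t, z) = (z - w) * h z], one has
    [F_z = h w] and [F_zz = 2 * h' w] at [w], hence [zk' = - 2 * (h' / h) w], and
    [h' / h] is the sum of the poles [1 / (w - v)] over the zeros [v] of [h],
    since [h] has order below one.  The exceptional set consists of
    the times at which [zk t] is a multiple zero.

    Exceptional times do not accumulate in [D]: they are the zeros of the
    holomorphic function [F_z (t, zk t)].  If this function vanished near some
    point, then differentiating [F = F_z = 0] along the curve, with the heat
    equation replacing time derivatives, would make all [z]-derivatives of [F]
    vanish on the curve ([heat_double_zero_curve]), and then [F = 0] by Taylor
    expansion in [z] and in [t] ([heat_flat_point]).

    The order hypothesis at the time [t0] gives a bound
    [exp ((1 + |z|) ^ c)] with [c < 1] ([order_growth]), which holds up to a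
    constant at every time: a [z]-derivative costs a constant factor, by
    Cauchy's estimate on discs of radius one, and the Taylor series in [t]
    converges like an exponential ([heat_growth]).

    The partial fraction expansion is [log_derivative_series].  By the maximum
    principle there are [O (r ^ c)] zeros within distance [r] of [w].  After
    dividing these out, [h] becomes zero-free on the disc of radius [r], has a
    logarithm with real part at most [O (r ^ c)] there, and the Borel-Caratheodory
    inequality bounds the logarithmic derivative at [w] by
    [O (r ^ (c - 1))].  The zeros at distance more than [r] contribute
    [O (r ^ (c - 1))] to the sum by the counting bound ([counting_tail]), so
    that the order of summation is irrelevant.

    All this rests on the theory of functions that are complex differentiable at
    each point, without continuity of the derivative.  Goursat's lemma is
    applied in the logarithmic coordinate [z = a + exp w], which turns circles
    into vertical segments and directly yields the mean value property
    ([mean_value_property]); the difference quotient at [a] satisfies it as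
    well, which is Cauchy's formula for the derivative at [a].  Everything
    else follows from this formula: Cauchy estimates, holomorphy of the
    derivative ([holo_derive]), quadratic Taylor bounds that are uniform in
    parameters ([quadratic_bound]), and Taylor series. *)

(** * Complex derivatives *)

Definition holo_at (f : C -> C) (z : C) : Prop :=
  @ex_derive C_AbsRing C_NormedModule f z.

Definition cderiv (f : C -> C) (z l : C) : Prop :=
  @is_derive C_AbsRing C_NormedModule f z l.

Ltac Rmin_bounds :=
  repeat match goal with
  | H : context [Rmin ?a ?b] |- _ =>
      lazymatch goal with
      | _ : (Rmin a b <= a) |- _ => fail
      | _ => let l := fresh "Rmin_le" in let r := fresh "Rmin_le" in
             assert (l := Rmin_l a b); assert (r := Rmin_r a b)
      end
  end.

Lemma Cmod_minus_sym (x y : C) : Cmod (x - y) = Cmod (y - x).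
Proof. rewrite <- Cmod_opp. f_equal. ring. Qed.

Lemma Cmod_minus_le (x y : C) : (Cmod x - Cmod y <= Cmod (x - y)).
Proof.
  assert (H := Cmod_triangle (x - y) y).
  replace (x - y + y) with x in H by ring. lra.
Qed.

Lemma Cmod_triangle_minus (x y : C) : (Cmod (x - y) <= Cmod x + Cmod y).
Proof. unfold Cminus. rewrite <- (Cmod_opp y). apply Cmod_triangle. Qed.

Lemma Cmod_dist_triangle (x y z : C) : (Cmod (x - z) <= Cmod (x - y) + Cmod (y - z)).
Proof. replace (x - z) with (x - y + (y - z)) by ring. apply Cmod_triangle. Qed.

Lemma Rmult_div_succ_le (K x eps : R) : (0 <= K) -> (0 <= x) -> (x <= eps / (K + 1)) ->
  (K * x <= eps).
Proof.
  intros HK Hx H. replace eps with ((K + 1) * (eps / (K + 1)))%R by (field; lra).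
  apply Rmult_le_compat; lra.
Qed.

Lemma Cmod_le_all_eps (x : C) (K : R) :
  (forall eps : R, (0 < eps) -> (Cmod x <= K * eps)) -> x = 0.
Proof.
  intros H. apply Cmod_eq_0. apply Rle_antisym; [|apply Cmod_ge_0].
  apply le_epsilon. intros e He.
  pose proof (Rabs_pos K). pose proof (Rle_abs K).
  assert (He' : (0 < e / (Rabs K + 1))) by (apply Rdiv_lt_0_compat; lra).
  specialize (H _ He').
  assert (Rabs K * (e / (Rabs K + 1)) <= e) by (apply Rmult_div_succ_le; lra).
  assert (K * (e / (Rabs K + 1)) <= Rabs K * (e / (Rabs K + 1)))
    by (apply Rmult_le_compat_r; lra).
  lra.
Qed.

Lemma Cplus_minus_cancel (z y : C) : z + (y - z) = y.
Proof. ring. Qed.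

Lemma cderiv_iff (f : C -> C) (z l : C) :
  cderiv f z l <->
  forall eps : R, (0 < eps) -> exists d : R, (0 < d) /\
    forall h : C, (Cmod h < d) ->
      (Cmod (f (z + h) - f z - h * l) <= eps * Cmod h).
Proof.
  split.
  - intros [_ H] eps He.
    specialize (H z (fun P HP => HP) (mkposreal eps He)).
    destruct H as [[d Hd] H]. exists d. split; [exact Hd|].
    intros h Hh. specialize (H (z + h)%C).
    assert (Ez : z + h - z = h) by ring.
    change ((Cmod (z + h - z) < d) ->
      (Cmod (f (z + h)%C - f z - (z + h - z) * l) <= eps * Cmod (z + h - z))) in H.
    rewrite Ez in H. exact (H Hh).
  - intros H. split; [apply is_linear_scal_l|].
    intros x Hx.
    assert (E : z = x).
    { apply (is_filter_lim_locally_unique (V := AbsRing_NormedModule C_AbsRing)). exact Hx. }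
    subst x. intros [eps He]. destruct (H eps He) as [d [Hd H']].
    exists (mkposreal d Hd). intros y Hy.
    change (Cmod (y - z) < d) in Hy.
    specialize (H' (y - z) Hy). rewrite Cplus_minus_cancel in H'.
    exact H'.
Qed.

Lemma holo_at_cderiv (f : C -> C) (z : C) : holo_at f z -> cderiv f z (C_derive f z).
Proof. intros H. exact (C_derive_correct f z z H). Qed.

Lemma cderiv_ex (f : C -> C) (z l : C) :
  cderiv f z l -> holo_at f z.
Proof. intros H. exists l. exact H. Qed.

Lemma cderiv_C_derive (f : C -> C) (z l : C) : cderiv f z l -> C_derive f z = l.
Proof. apply is_C_derive_unique. Qed.

Lemma cderiv_unique (f : C -> C) (z l1 l2 : C) :
  cderiv f z l1 -> cderiv f z l2 -> l1 = l2.
Proof.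
  intros H1 H2. rewrite <- (cderiv_C_derive _ _ _ H1). apply cderiv_C_derive, H2.
Qed.

Lemma cderiv_ext_near (f g : C -> C) (z l : C) (d : R) :
  (0 < d) -> (forall y, (Cmod (y - z) < d) -> f y = g y) ->
  cderiv f z l -> cderiv g z l.
Proof.
  intros Hd E H. apply cderiv_iff. intros eps He.
  destruct (proj1 (cderiv_iff f z l) H eps He) as [d' [Hd' H']].
  exists (Rmin d d'). split; [apply Rmin_glb_lt; assumption|].
  intros h Hh. Rmin_bounds.
  rewrite <- !E; [apply H'; lra| |].
  - replace (z - z) with (RtoC 0) by ring. rewrite Cmod_0. lra.
  - replace (z + h - z) with h by ring. lra.
Qed.

Lemma cderiv_ext (f g : C -> C) (z l : C) :
  (forall y, f y = g y) -> cderiv f z l -> cderiv g z l.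
Proof. intros E. apply (cderiv_ext_near f g z l 1); [lra|auto]. Qed.

Lemma cderiv_val (f : C -> C) (z l l' : C) : l = l' -> cderiv f z l -> cderiv f z l'.
Proof. intros ->. auto. Qed.

Lemma cderiv_lipschitz (f : C -> C) (z l : C) :
  cderiv f z l -> exists d : R, (0 < d) /\ forall h, (Cmod h < d) ->
    (Cmod (f (z + h) - f z) <= (1 + Cmod l) * Cmod h).
Proof.
  intros H. destruct (proj1 (cderiv_iff f z l) H 1%R Rlt_0_1) as [d [Hd H']].
  exists d. split; [exact Hd|]. intros h Hh. specialize (H' h Hh).
  replace (f (z + h) - f z) with ((f (z + h) - f z - h * l) + h * l) by ring.
  eapply Rle_trans; [apply Cmod_triangle|]. rewrite Cmod_mult. lra.
Qed.

Definition ccont (f : C -> C) (z : C) : Prop :=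
  forall eps : R, (0 < eps) -> exists d : R, (0 < d) /\
    forall y : C, (Cmod (y - z) < d) -> (Cmod (f y - f z) < eps).

Lemma cderiv_ccont (f : C -> C) (z l : C) : cderiv f z l -> ccont f z.
Proof.
  intros H eps He. destruct (cderiv_lipschitz f z l H) as [d [Hd H']].
  assert (Hl : (0 < 1 + Cmod l)) by (assert (h := Cmod_ge_0 l); lra).
  exists (Rmin d (eps / (1 + Cmod l))). split.
  { apply Rmin_glb_lt; [exact Hd|]. apply Rdiv_lt_0_compat; lra. }
  intros y Hy.
  Rmin_bounds.
  assert (Hyd : (Cmod (y - z) < d)) by lra.
  specialize (H' (y - z) Hyd). replace (z + (y - z)) with y in H' by ring.
  eapply Rle_lt_trans; [exact H'|].
  replace eps with ((1 + Cmod l) * (eps / (1 + Cmod l)))%R by (field; lra).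
  apply Rmult_lt_compat_l; lra.
Qed.

Lemma ccont_const (c z : C) : ccont (fun _ => c) z.
Proof.
  intros eps He. exists 1%R. split; [lra|]. intros y _.
  replace (c - c) with (RtoC 0) by ring. rewrite Cmod_0. exact He.
Qed.

Lemma ccont_plus (f g : C -> C) (z : C) :
  ccont f z -> ccont g z -> ccont (fun y => f y + g y) z.
Proof.
  intros Hf Hg eps He.
  destruct (Hf (eps / 2)%R) as [d1 [Hd1 H1]]; [lra|].
  destruct (Hg (eps / 2)%R) as [d2 [Hd2 H2]]; [lra|].
  exists (Rmin d1 d2). split; [apply Rmin_glb_lt; assumption|]. intros y Hy.
  Rmin_bounds.
  replace (f y + g y - (f z + g z)) with ((f y - f z) + (g y - g z)) by ring.
  eapply Rle_lt_trans; [apply Cmod_triangle|].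
  specialize (H1 y ltac:(lra)). specialize (H2 y ltac:(lra)). lra.
Qed.

Lemma ccont_comp (f g : C -> C) (z : C) :
  ccont f (g z) -> ccont g z -> ccont (fun y => f (g y)) z.
Proof.
  intros Hf Hg eps He. destruct (Hf eps He) as [d [Hd H]].
  destruct (Hg d Hd) as [d' [Hd' H']]. exists d'. split; [exact Hd'|].
  intros y Hy. apply H, H', Hy.
Qed.

Lemma ccont_mult (f g : C -> C) (z : C) :
  ccont f z -> ccont g z -> ccont (fun y => f y * g y) z.
Proof.
  intros Hf Hg eps He.
  assert (hf := Cmod_ge_0 (f z)). assert (hg := Cmod_ge_0 (g z)).
  destruct (Hf (eps / 2 / (1 + Cmod (g z)))%R) as [d1 [Hd1 H1]].
  { repeat apply Rdiv_lt_0_compat; lra. }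
  destruct (Hg 1%R) as [d2 [Hd2 H2]]; [lra|].
  destruct (Hg (eps / 2 / (1 + Cmod (f z)))%R) as [d3 [Hd3 H3]].
  { repeat apply Rdiv_lt_0_compat; lra. }
  exists (Rmin d1 (Rmin d2 d3)). split; [repeat apply Rmin_glb_lt; assumption|].
  intros y Hy. Rmin_bounds.
  specialize (H1 y ltac:(lra)). specialize (H2 y ltac:(lra)). specialize (H3 y ltac:(lra)).
  assert (T := Cmod_minus_le (g y) (g z)).
  replace (f y * g y - f z * g z) with ((f y - f z) * g y + f z * (g y - g z)) by ring.
  eapply Rle_lt_trans; [apply Cmod_triangle|]. rewrite !Cmod_mult.
  assert (A1 : (Cmod (f y - f z) * Cmod (g y)
     <= eps / 2 / (1 + Cmod (g z)) * (1 + Cmod (g z))))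
    by (apply Rmult_le_compat; try apply Cmod_ge_0; lra).
  assert (A2 : (Cmod (f z) * Cmod (g y - g z)
     < (1 + Cmod (f z)) * (eps / 2 / (1 + Cmod (f z))))).
  { apply Rle_lt_trans with ((1 + Cmod (f z)) * Cmod (g y - g z))%R.
    - apply Rmult_le_compat_r; [apply Cmod_ge_0|lra].
    - apply Rmult_lt_compat_l; lra. }
  replace (eps / 2 / (1 + Cmod (g z)) * (1 + Cmod (g z)))%R with (eps / 2)%R in A1 by (field; lra).
  replace ((1 + Cmod (f z)) * (eps / 2 / (1 + Cmod (f z))))%R with (eps / 2)%R in A2 by (field; lra).
  lra.
Qed.

Lemma ccont_minus (f g : C -> C) (z : C) :
  ccont f z -> ccont g z -> ccont (fun y => f y - g y) z.
Proof.
  intros Hf Hg eps He.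
  destruct (ccont_plus f _ z Hf (ccont_mult _ g z (ccont_const (- 1) z) Hg) eps He) as [d [Hd H]].
  exists d. split; [exact Hd|]. intros y Hy. specialize (H y Hy).
  replace (f y - g y - (f z - g z)) with (f y + - 1 * g y - (f z + - 1 * g z)) by ring. exact H.
Qed.

Lemma cderiv_const (a z : C) : cderiv (fun _ => a) z 0.
Proof. exact (is_derive_const (K := C_AbsRing) (V := C_NormedModule) a z). Qed.

Lemma cderiv_plus (f g : C -> C) (z a b : C) :
  cderiv f z a -> cderiv g z b -> cderiv (fun y => f y + g y) z (a + b).
Proof.
  intros Hf Hg. exact (is_derive_plus (V := C_NormedModule) f g z a b Hf Hg).
Qed.

(** The two structures on the values have the same norm but different uniform
    structures; the derivative only depends on the norm. *)
Lemma cderiv_AbsRing (f : C -> C) (z l : C) :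
  cderiv f z l <-> @is_derive C_AbsRing (AbsRing_NormedModule C_AbsRing) f z l.
Proof.
  split; intros [_ H]; (split; [apply is_linear_scal_l|exact H]).
Qed.

Lemma cderiv_id (z : C) : cderiv (fun y => y) z 1.
Proof. apply cderiv_AbsRing. exact (is_derive_id (K := C_AbsRing) z). Qed.

Lemma cderiv_mult (f g : C -> C) (z a b : C) :
  cderiv f z a -> cderiv g z b -> cderiv (fun y => f y * g y) z (a * g z + f z * b).
Proof.
  rewrite !cderiv_AbsRing. intros Hf Hg.
  exact (is_derive_mult (K := C_AbsRing) f g z a b Hf Hg Cmult_comm).
Qed.

Lemma cderiv_scal (f : C -> C) (z l c : C) :
  cderiv f z l -> cderiv (fun y => c * f y) z (c * l).
Proof.
  intros H. eapply cderiv_val; [|apply (cderiv_mult (fun _ => c) f z 0 l (cderiv_const c z) H)].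
  ring.
Qed.

Lemma cderiv_minus (f g : C -> C) (z a b : C) :
  cderiv f z a -> cderiv g z b -> cderiv (fun y => f y - g y) z (a - b).
Proof.
  intros Hf Hg. exact (is_derive_minus (V := C_NormedModule) f g z a b Hf Hg).
Qed.

Lemma cderiv_comp (f g : C -> C) (z a b : C) :
  cderiv f (g z) a -> cderiv g z b -> cderiv (fun y => f (g y)) z (b * a).
Proof.
  rewrite (cderiv_AbsRing g). intros Hf Hg.
  exact (is_derive_comp (K := C_AbsRing) (V := C_NormedModule) f g z a b Hf Hg).
Qed.

Lemma cderiv_sub_const (a z : C) : cderiv (fun y => y - a) z 1.
Proof.
  refine (cderiv_val _ _ _ _ _ (cderiv_minus _ _ z _ _ (cderiv_id z) (cderiv_const a z))). ring.
Qed.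

Lemma cderiv_inv_id (z : C) : z <> 0 -> cderiv Cinv z (- (/ z * / z)).
Proof.
  intros Hz. apply cderiv_iff. intros eps He.
  assert (Hm := proj1 (Cmod_gt_0 z) Hz).
  set (m := Cmod z) in *.
  set (d2 := (eps * m * m * m / 2)%R).
  assert (Hd2 : (0 < d2)) by (unfold d2; assert (0 < eps * m * m * m) by (repeat apply Rmult_lt_0_compat; lra); lra).
  exists (Rmin (m / 2) d2). split; [apply Rmin_glb_lt; lra|].
  intros h Hh. Rmin_bounds.
  assert (Hzh : (m / 2 < Cmod (z + h))).
  { assert (H := Cmod_minus_le z (- h)). rewrite Cmod_opp in H.
    replace (z - - h) with (z + h) in H by ring. fold m in H. lra. }
  assert (Hzh0 : z + h <> 0) by (apply Cmod_gt_0; lra).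
  replace (/ (z + h) - / z - h * - (/ z * / z)) with (h * (h * / (z + h) * / z * / z))
    by (field; auto).
  rewrite !Cmod_mult, !Cmod_inv; auto. fold m. rewrite (Rmult_comm eps).
  apply Rmult_le_compat_l; [apply Cmod_ge_0|].
  assert (hh := Cmod_ge_0 h).
  assert (Hi : (/ Cmod (z + h) <= 2 / m)).
  { replace (2 / m)%R with (/ (m / 2))%R by (field; lra).
    apply Rinv_le_contravar; lra. }
  assert (Him : (0 < / m)) by (apply Rinv_0_lt_compat; lra).
  apply Rle_trans with (d2 * (2 / m) * / m * / m)%R.
  - repeat (apply Rmult_le_compat_r; [lra|]). apply Rmult_le_compat; try lra.
    apply Rlt_le, Rinv_0_lt_compat; lra.
  - right. unfold d2. field. lra.
Qed.

Lemma cderiv_inv (f : C -> C) (z l : C) :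
  f z <> 0 -> cderiv f z l -> cderiv (fun y => / f y) z (- (l * (/ f z * / f z))).
Proof.
  intros Hz H. eapply cderiv_val; [|apply (cderiv_comp Cinv f z _ l (cderiv_inv_id _ Hz) H)].
  ring.
Qed.

Lemma cderiv_div (f g : C -> C) (z a b : C) :
  g z <> 0 -> cderiv f z a -> cderiv g z b ->
  cderiv (fun y => f y / g y) z ((a * g z - f z * b) / (g z * g z)).
Proof.
  intros Hz Hf Hg. eapply cderiv_val; [|apply (cderiv_mult f (fun y => / g y) z _ _ Hf (cderiv_inv g z b Hz Hg))].
  field. exact Hz.
Qed.

Lemma cderiv_shift (f : C -> C) (a z l : C) :
  cderiv f (a + z) l -> cderiv (fun y => f (a + y)) z l.
Proof.
  intros H. eapply cderiv_val.
  2: { apply (cderiv_comp f (fun y => a + y) z l (0 + 1) H).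
       apply cderiv_plus; [apply cderiv_const|apply cderiv_id]. }
  ring.
Qed.

Lemma Cmod_le_coord (z : C) : (Cmod z <= Rabs (fst z) + Rabs (snd z)).
Proof.
  assert (T := Cmod_triangle (RtoC (fst z)) (RtoC (snd z) * Ci)).
  rewrite Cmod_mult, Cmod_Ci, !Cmod_R in T.
  replace (RtoC (fst z) + RtoC (snd z) * Ci) with z in T; [lra|].
  destruct z as [x y]. unfold RtoC, Ci, Cplus, Cmult; simpl. f_equal; ring.
Qed.

Lemma Cmod_coord (x y u v e : R) :
  (Rabs (x - u) < e) -> (Rabs (y - v) < e) -> (Cmod ((x, y) - (u, v)) < 2 * e).
Proof.
  intros H1 H2. eapply Rle_lt_trans; [apply Cmod_le_coord|].
  change (Rabs (x - u) + Rabs (y - v) < 2 * e). lra.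
Qed.

(** * Curves and mean value inequalities *)

Definition rcont (f : R -> C) (s : R) : Prop :=
  forall eps : R, (0 < eps) -> exists d : R, (0 < d) /\
    forall y : R, (Rabs (y - s) < d) -> (Cmod (f y - f s) < eps).

Definition rderiv (f : R -> C) (s : R) (l : C) : Prop :=
  @is_derive R_AbsRing C_R_NormedModule f s l.

Lemma norm_C_R (x : C) : @norm R_AbsRing C_R_NormedModule x = Cmod x.
Proof.
  change (sqrt (Rabs (fst x) ^ 2 + Rabs (snd x) ^ 2) = sqrt (fst x ^ 2 + snd x ^ 2))%R.
  rewrite !pow2_abs. reflexivity.
Qed.

Lemma rderiv_iff (f : R -> C) (s : R) (l : C) :
  rderiv f s l <->
  forall eps : R, (0 < eps) -> exists d : R, (0 < d) /\
    forall h : R, (Rabs h < d) ->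
      (Cmod (f (s + h)%R - f s - RtoC h * l) <= eps * Rabs h).
Proof.
  assert (E : forall (h : R), @scal R_AbsRing C_R_NormedModule h l = RtoC h * l).
  { intros h. change ((h * fst l, h * snd l)%R = RtoC h * l).
    unfold RtoC, Cmult; simpl. f_equal; ring. }
  split.
  - intros [_ H] eps He.
    specialize (H s (fun P HP => HP) (mkposreal eps He)).
    destruct H as [[d Hd] H]. exists d. split; [exact Hd|].
    intros h Hh. specialize (H (s + h)%R).
    assert (Ez : (s + h - s)%R = h) by ring.
    change ((Rabs (s + h - s) < d) ->
      (@norm R_AbsRing C_R_NormedModule (f (s + h)%R - f s - @scal R_AbsRing C_R_NormedModule (s + h - s)%R l)%C
        <= eps * Rabs (s + h - s))) in H.
    rewrite Ez, E, norm_C_R in H. exact (H Hh).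
  - intros H. split; [apply is_linear_scal_l|].
    intros x Hx.
    assert (Ex : s = x).
    { apply (is_filter_lim_locally_unique (V := R_NormedModule)). exact Hx. }
    subst x. intros [eps He]. destruct (H eps He) as [d [Hd H']].
    exists (mkposreal d Hd). intros y Hy.
    change (Rabs (y - s) < d) in Hy.
    specialize (H' (y - s)%R Hy).
    change (@norm R_AbsRing C_R_NormedModule (f y - f s - @scal R_AbsRing C_R_NormedModule (y - s)%R l)%C
        <= eps * Rabs (y - s)).
    rewrite E, norm_C_R.
    rewrite Rplus_minus in H'. exact H'.
Qed.

Lemma rcont_iff (f : R -> C) (s : R) :
  rcont f s <-> @continuous R_UniformSpace C_UniformSpace f s.
Proof.
  split.
  - intros H P [eps HP]. destruct (H eps (cond_pos eps)) as [d [Hd H']].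
    exists (mkposreal d Hd). intros y Hy. apply HP.
    apply C_NormedModule_mixin_compat1. exact (H' y Hy).
  - intros H eps He.
    assert (He2 : (0 < eps / 2)) by lra.
    destruct (H (ball (f s) (mkposreal _ He2))) as [[d Hd] H'].
    { exists (mkposreal _ He2). auto. }
    exists d. split; [exact Hd|]. intros y Hy.
    destruct (H' y Hy) as [h1 h2].
    change (Rabs (fst (f y) - fst (f s)) < eps / 2) in h1.
    change (Rabs (snd (f y) - snd (f s)) < eps / 2) in h2.
    rewrite (surjective_pairing (f y)), (surjective_pairing (f s)).
    replace eps with (2 * (eps / 2))%R by field. apply Cmod_coord; assumption.
Qed.

Lemma cderiv_rderiv (f : C -> C) (g : R -> C) (s : R) (a b : C) :
  cderiv f (g s) a -> rderiv g s b -> rderiv (fun y => f (g y)) s (b * a).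
Proof.
  intros Hf Hg. apply rderiv_iff. intros eps He.
  assert (hb := Cmod_ge_0 b). assert (ha := Cmod_ge_0 a).
  set (K := (1 + Cmod b)%R).
  assert (HK : (1 <= K)) by (unfold K; lra).
  assert (He1 : (0 < eps / 2 / K)) by (repeat apply Rdiv_lt_0_compat; lra).
  assert (He2 : (0 < eps / 2 / (1 + Cmod a))) by (repeat apply Rdiv_lt_0_compat; lra).
  destruct (proj1 (rderiv_iff g s b) Hg 1%R Rlt_0_1) as [d0 [Hd0 H0]].
  destruct (proj1 (cderiv_iff f _ a) Hf _ He1) as [d1 [Hd1 H1]].
  destruct (proj1 (rderiv_iff g s b) Hg _ He2) as [d2 [Hd2 H2]].
  assert (Hq : (0 < d1 / K)) by (apply Rdiv_lt_0_compat; lra).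
  exists (Rmin d0 (Rmin d2 (d1 / K))). split.
  { repeat apply Rmin_glb_lt; assumption. }
  intros h Hh.
  Rmin_bounds.
  assert (hh := Rabs_pos h).
  specialize (H0 h ltac:(lra)). specialize (H2 h ltac:(lra)).
  assert (H3 : (Cmod (g (s + h)%R - g s) <= K * Rabs h)).
  { replace (g (s + h)%R - g s) with ((g (s + h)%R - g s - RtoC h * b) + RtoC h * b) by ring.
    eapply Rle_trans; [apply Cmod_triangle|]. rewrite Cmod_mult, Cmod_R. unfold K. lra. }
  assert (Hlt : (Cmod (g (s + h)%R - g s) < d1)).
  { eapply Rle_lt_trans; [exact H3|].
    replace d1 with (K * (d1 / K))%R by (field; lra).
    apply Rmult_lt_compat_l; lra. }
  specialize (H1 _ Hlt). replace (g s + (g (s + h)%R - g s)) with (g (s + h)%R) in H1 by ring.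
  replace (f (g (s + h)%R) - f (g s) - RtoC h * (b * a)) with
    ((f (g (s + h)%R) - f (g s) - (g (s + h)%R - g s) * a)
       + a * (g (s + h)%R - g s - RtoC h * b)) by ring.
  eapply Rle_trans; [apply Cmod_triangle|]. rewrite Cmod_mult.
  assert (eps / 2 / K * Cmod (g (s + h)%R - g s) <= eps / 2 / K * (K * Rabs h))
    by (apply Rmult_le_compat_l; lra).
  replace (eps / 2 / K * (K * Rabs h))%R with (eps / 2 * Rabs h)%R in H by (field; lra).
  assert (Cmod a * Cmod (g (s + h)%R - g s - RtoC h * b)
     <= (1 + Cmod a) * (eps / 2 / (1 + Cmod a) * Rabs h)).
  { apply Rmult_le_compat; try apply Cmod_ge_0; lra. }
  replace ((1 + Cmod a) * (eps / 2 / (1 + Cmod a) * Rabs h))%R with (eps / 2 * Rabs h)%R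
    in H4 by (field; lra).
  lra.
Qed.

Lemma rderiv_val (f : R -> C) (s : R) (l l' : C) : l = l' -> rderiv f s l -> rderiv f s l'.
Proof. intros ->. auto. Qed.

Lemma rderiv_affine (a h : C) (s : R) : rderiv (fun x => a + RtoC x * h) s h.
Proof.
  apply rderiv_iff. intros eps He. exists 1%R. split; [lra|]. intros x _.
  replace (a + RtoC (s + x)%R * h - (a + RtoC s * h) - RtoC x * h) with (RtoC 0).
  - rewrite Cmod_0. assert (h' := Rabs_pos x). nra.
  - rewrite RtoC_plus. ring.
Qed.

Lemma rderiv_RtoC (s : R) : rderiv RtoC s 1.
Proof.
  apply (is_derive_ext (V := C_R_NormedModule) (fun x => 0 + RtoC x * 1)); [|apply rderiv_affine].
  intros x. change (0 + RtoC x * 1 = RtoC x). ring.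
Qed.

Lemma rderiv_Re (f : R -> C) (s : R) (l w : C) :
  rderiv f s l -> is_derive (fun x => Re (w * f x)) s (Re (w * l)).
Proof.
  intros H. apply is_derive_Reals. intros eps He.
  assert (hw := Cmod_ge_0 w).
  assert (He1 : (0 < eps / 2 / (1 + Cmod w))) by (repeat apply Rdiv_lt_0_compat; lra).
  destruct (proj1 (rderiv_iff f s l) H _ He1) as [d [Hd H']].
  exists (mkposreal d Hd). intros h Hh0 Hh. simpl in Hh. specialize (H' h Hh).
  replace ((Re (w * f (s + h)%R)%C - Re (w * f s)) / h - Re (w * l))%R
    with (Re (w * (f (s + h)%R - f s - RtoC h * l))%C / h)%R.
  2: { destruct w, l, (f (s + h)%R), (f s). unfold RtoC, Re, Cmult, Cminus, Cplus, Copp; simpl.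
       field. exact Hh0. }
  unfold Rdiv. rewrite Rabs_mult, Rabs_inv.
  assert (hp : (0 < Rabs h)) by (apply Rabs_pos_lt; exact Hh0).
  apply Rmult_lt_reg_r with (Rabs h); [exact hp|].
  rewrite Rmult_assoc, Rinv_l, Rmult_1_r by lra.
  eapply Rle_lt_trans; [apply re_le_Cmod|]. rewrite Cmod_mult.
  apply Rle_lt_trans with ((1 + Cmod w) * (eps / 2 / (1 + Cmod w) * Rabs h))%R.
  { apply Rmult_le_compat; try apply Cmod_ge_0; lra. }
  replace ((1 + Cmod w) * (eps / 2 / (1 + Cmod w) * Rabs h))%R with (eps / 2 * Rabs h)%R
    by (field; lra).
  nra.
Qed.

Lemma unit_direction (d : C) : exists w : C, Cmod w = 1%R /\ w * d = RtoC (Cmod d).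
Proof.
  destruct (Req_dec (Cmod d) 0) as [E|E].
  - exists 1. split; [apply Cmod_1|]. rewrite E. apply Cmod_eq_0 in E. rewrite E. ring.
  - exists (Cconj d / RtoC (Cmod d)).
    assert (E' : RtoC (Cmod d) <> 0) by (intros K; apply E, RtoC_inj, K).
    split.
    + rewrite Cmod_div, Cmod_conj, Cmod_R, Rabs_pos_eq; auto using Cmod_ge_0.
      field. exact E.
    + replace (Cconj d / RtoC (Cmod d) * d) with (d * Cconj d / RtoC (Cmod d)) by (field; exact E').
      rewrite <- Cmod2_conj, RtoC_pow. simpl. field. exact E'.
Qed.

(** Both sides are compared along the direction of the increment of [f], which
    reduces the inequality to the real mean value theorem. *)
Lemma mean_value_ineq (f df : R -> C) (p dp : R -> R) :
  (forall s, (0 <= s <= 1) -> rderiv f s (df s)) ->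
  (forall s, (0 <= s <= 1) -> is_derive p s (dp s)) ->
  (forall s, (0 <= s <= 1) -> (Cmod (df s) <= dp s)) ->
  (Cmod (f 1%R - f 0%R) <= p 1 - p 0).
Proof.
  intros Hf Hp Hle.
  destruct (unit_direction (f 1%R - f 0%R)) as [w [Hw E]].
  set (g := fun s => (Re (w * f s) - p s)%R).
  assert (Hg : forall s, (0 <= s <= 1) -> is_derive g s (Re (w * df s) - dp s)%R).
  { intros s Hs. apply (is_derive_minus (V := R_NormedModule) (fun s => Re (w * f s)) p).
    - apply rderiv_Re, Hf, Hs.
    - apply Hp, Hs. }
  destruct (MVT_gen g 0 1 (fun s => (Re (w * df s) - dp s)%R)) as [c [Hc Ec]].
  - intros x Hx. rewrite Rmin_left, Rmax_right in Hx by lra. apply Hg. lra.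
  - intros x Hx. rewrite Rmin_left, Rmax_right in Hx by lra.
    apply derivable_continuous_pt. eexists. apply is_derive_Reals, Hg. lra.
  - rewrite Rmin_left, Rmax_right in Hc by lra.
    assert (H1 := re_le_Cmod (w * df c)). rewrite Cmod_mult, Hw in H1.
    assert (H2 := Rle_abs (Re (w * df c))). specialize (Hle c Hc).
    assert (E2 : Re (w * (f 1%R - f 0%R)) = Cmod (f 1%R - f 0%R)).
    { rewrite E. reflexivity. }
    assert (E3 : Re (w * (f 1%R - f 0%R)) = (Re (w * f 1%R) - Re (w * f 0%R))%R).
    { destruct w, (f 1%R), (f 0%R); simpl; ring. }
    unfold g in Ec. lra.
Qed.

(** A bound of order [m] on the derivative along a segment gives a bound of
    order [m + 1] for the increment, with the gain [1 / (m + 1)] that makes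
    Taylor remainders carry a factorial. *)
Lemma segment_bound_pow (f df : C -> C) (z h : C) (B : R) (m : nat) :
  (forall s, (0 <= s <= 1) -> cderiv f (z + RtoC s * h) (df (z + RtoC s * h))) ->
  (forall s, (0 <= s <= 1) ->
     (Cmod (df (z + RtoC s * h)%C) <= B * (s * Cmod h) ^ m)) ->
  (Cmod (f (z + h)%C - f z) <= B * Cmod h ^ S m / INR (S m)).
Proof.
  intros Hf Hb.
  assert (Hm : INR (S m) <> 0%R) by (apply not_0_INR; lia).
  pose (p := fun s => (B * Cmod h ^ S m / INR (S m) * s ^ S m)%R).
  assert (H := mean_value_ineq (fun s => f (z + RtoC s * h))
     (fun s => h * df (z + RtoC s * h)) p (fun s => Cmod h * (B * (s * Cmod h) ^ m))%R).
  replace (f (z + h)) with (f (z + RtoC 1 * h)) by (f_equal; ring).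
  replace (f z) with (f (z + RtoC 0 * h)) by (f_equal; ring).
  replace (B * Cmod h ^ S m / INR (S m))%R with (p 1 - p 0)%R.
  - apply H.
    + intros s Hs. apply cderiv_rderiv; [apply Hf, Hs|apply rderiv_affine].
    + intros s Hs. unfold p. auto_derive; [exact I|].
      replace (match m with O => 1%R | S _ => (INR m + 1)%R end) with (INR (S m)) by reflexivity.
      simpl pred. rewrite Rpow_mult_distr.
      change (Cmod h ^ S m)%R with (Cmod h * Cmod h ^ m)%R. field. exact Hm.
    + intros s Hs. rewrite Cmod_mult. apply Rmult_le_compat_l; [apply Cmod_ge_0|].
      apply Hb, Hs.
  - unfold p. rewrite pow1, pow_i by lia. ring.
Qed.

Lemma segment_bound (f df : C -> C) (z h : C) (B : R) :
  (forall s, (0 <= s <= 1) -> cderiv f (z + RtoC s * h) (df (z + RtoC s * h))) ->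
  (forall s, (0 <= s <= 1) -> (Cmod (df (z + RtoC s * h)%C) <= B)) ->
  (Cmod (f (z + h)%C - f z) <= B * Cmod h).
Proof.
  intros Hf Hb. assert (H := segment_bound_pow f df z h B 0 Hf).
  simpl in H. replace (B * (Cmod h * 1) / 1)%R with (B * Cmod h)%R in H by field.
  apply H. intros s Hs. rewrite Rmult_1_r. apply Hb, Hs.
Qed.

(** * Compactness of rectangles *)

Lemma nested_intervals (u v : nat -> R) :
  (forall n, (u n <= u (S n))) -> (forall n, (v (S n) <= v n)) ->
  (forall n, (u n <= v n)) -> exists l : R, forall n, (u n <= l <= v n).
Proof.
  intros Hu Hv Huv.
  assert (Mu := fun n m => growing_prop u n m Hu). assert (Mv := fun n m => decreasing_prop v m n Hv).
  assert (Huv' : forall n m, (u n <= v m)).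
  { intros n m. apply Rle_trans with (u (n + m)%nat); [apply Rge_le, Mu; lia|].
    apply Rle_trans with (v (n + m)%nat); [apply Huv|]. apply Mv. lia. }
  destruct (completeness (fun x => exists n, x = u n)) as [l [Hl1 Hl2]].
  - exists (v 0%nat). intros x [n ->]. apply Huv'.
  - exists (u 0%nat). exists 0%nat. reflexivity.
  - exists l. intros n. split.
    + apply Hl1. exists n. reflexivity.
    + apply Hl2. intros x [m ->]. apply Huv'.
Qed.

(** Compactness of a rectangle in the form of an induction principle: a
    property which passes from the four quarters of a rectangle to the
    rectangle, and which holds for all small rectangles around any given
    point, holds for the whole rectangle.  Otherwise, repeatedly choosing a bad
    quarter would produce a point contradicting the second condition. *)
Lemma rect_induction (P : R -> R -> R -> R -> Prop) (a b c d : R) :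
  (forall x1 x2 y1 y2, (a <= x1 <= x2) -> (x2 <= b) ->
     (c <= y1 <= y2) -> (y2 <= d) ->
     P x1 ((x1 + x2) / 2)%R y1 ((y1 + y2) / 2)%R ->
     P ((x1 + x2) / 2)%R x2 y1 ((y1 + y2) / 2)%R ->
     P x1 ((x1 + x2) / 2)%R ((y1 + y2) / 2)%R y2 ->
     P ((x1 + x2) / 2)%R x2 ((y1 + y2) / 2)%R y2 ->
     P x1 x2 y1 y2) ->
  (forall x y, (a <= x <= b) -> (c <= y <= d) ->
     exists e : R, (0 < e) /\
     forall x1 x2 y1 y2, (a <= x1 <= x) -> (x <= x2 <= b) ->
       (c <= y1 <= y) -> (y <= y2 <= d) ->
       (x2 - x1 < e) -> (y2 - y1 < e) -> P x1 x2 y1 y2) ->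
  (a <= b) -> (c <= d) -> P a b c d.
Proof.
  intros Hq Hloc Hab Hcd. apply NNPP. intros Hbad.
  pose (bad := fun r : (R * R) * (R * R) =>
    (a <= fst (fst r) <= snd (fst r)) /\ (snd (fst r) <= b) /\
    (c <= fst (snd r) <= snd (snd r)) /\ (snd (snd r) <= d) /\
    ~ P (fst (fst r)) (snd (fst r)) (fst (snd r)) (snd (snd r))).
  pose (half := fun I J : R * R => (fst I <= fst J) /\ (snd J <= snd I) /\
    (snd J - fst J = (snd I - fst I) / 2)%R).
  assert (step : forall r : {r | bad r}, exists r' : {r | bad r},
    half (fst (proj1_sig r)) (fst (proj1_sig r')) /\
    half (snd (proj1_sig r)) (snd (proj1_sig r'))).
  { intros [[[x1 x2] [y1 y2]] (H1 & H2 & H3 & H4 & H5)]; simpl in *.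
    assert (K : forall r', bad r' -> half (x1, x2) (fst r') -> half (y1, y2) (snd r') ->
      exists r' : {r | bad r}, half (x1, x2) (fst (proj1_sig r')) /\
                               half (y1, y2) (snd (proj1_sig r'))).
    { intros r' Hr h1 h2. exists (exist _ r' Hr). split; assumption. }
    apply NNPP. intros N. apply H5.
    apply Hq; try lra; apply NNPP; intros HP; apply N;
      [apply (K ((x1, (x1 + x2) / 2), (y1, (y1 + y2) / 2))%R)
      |apply (K (((x1 + x2) / 2, x2), (y1, (y1 + y2) / 2))%R)
      |apply (K ((x1, (x1 + x2) / 2), ((y1 + y2) / 2, y2))%R)
      |apply (K (((x1 + x2) / 2, x2), ((y1 + y2) / 2, y2))%R)];
      unfold bad, half; simpl; repeat split; try lra; exact HP. }
  pose (next := fun r => proj1_sig (constructive_indefinite_description _ (step r))).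
  assert (Hnext : forall r, half (fst (proj1_sig r)) (fst (proj1_sig (next r))) /\
    half (snd (proj1_sig r)) (snd (proj1_sig (next r)))).
  { intros r. unfold next. exact (proj2_sig (constructive_indefinite_description _ (step r))). }
  assert (Hb0 : bad ((a, b), (c, d))) by (unfold bad; simpl; repeat split; try lra; exact Hbad).
  pose (s := fix s n := match n with O => exist _ _ Hb0 | S m => next (s m) end).
  pose (I := fun n => fst (proj1_sig (s n))). pose (J := fun n => snd (proj1_sig (s n))).
  assert (HI : forall n, half (I n) (I (S n))) by (intros n; apply (Hnext (s n))).
  assert (HJ : forall n, half (J n) (J (S n))) by (intros n; apply (Hnext (s n))).
  assert (Hs : forall n, bad (I n, J n)).
  { intros n. unfold I, J. destruct (s n) as [[i j] H]. exact H. }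
  assert (width : forall (K : nat -> R * R), (forall n, half (K n) (K (S n))) ->
    forall n, (snd (K n) - fst (K n) = (snd (K 0%nat) - fst (K 0%nat)) * (/ 2) ^ n)%R).
  { intros K HK. induction n as [|n IH]; [simpl; ring|].
    destruct (HK n) as (_ & _ & E). rewrite E, IH. simpl. field. }
  destruct (nested_intervals (fun n => fst (I n)) (fun n => snd (I n))) as [x Hx].
  { intros n. apply (HI n). } { intros n. apply (HI n). }
  { intros n. destruct (Hs n) as (H & _). simpl in H. lra. }
  destruct (nested_intervals (fun n => fst (J n)) (fun n => snd (J n))) as [y Hy].
  { intros n. apply (HJ n). } { intros n. apply (HJ n). }
  { intros n. destruct (Hs n) as (_ & _ & H & _). simpl in H. lra. }
  destruct (Hloc x y) as [e [He Hsmall]].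
  { apply (Hx 0%nat). } { apply (Hy 0%nat). }
  assert (Hw : exists n, ((b - a + (d - c)) * (/ 2) ^ n < e)).
  { set (w := (b - a + (d - c))%R).
    destruct (pow_lt_1_zero (/ 2)) with (y := (e / (w + 1))%R) as [N HN].
    - rewrite Rabs_pos_eq; lra.
    - apply Rdiv_lt_0_compat; unfold w; lra.
    - exists N. specialize (HN N (Nat.le_refl N)).
      assert (hp : (0 < (/ 2) ^ N)) by (apply pow_lt; lra).
      rewrite Rabs_pos_eq in HN by lra.
      assert (hw : (0 <= w)) by (unfold w; lra).
      replace e with ((w + 1) * (e / (w + 1)))%R by (field; lra).
      apply Rle_lt_trans with ((w + 1) * (/ 2) ^ N)%R; [nra|].
      apply Rmult_lt_compat_l; lra. }
  destruct Hw as [n Hn].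
  destruct (Hs n) as (h1 & h2 & h3 & h4 & h5). simpl in *.
  apply h5.
  assert (wI := width I HI n). assert (wJ := width J HJ n).
  change (I 0%nat) with (a, b) in wI. change (J 0%nat) with (c, d) in wJ. simpl in wI, wJ.
  specialize (Hx n). specialize (Hy n).
  assert (hp : (0 < (/ 2) ^ n)) by (apply pow_lt; lra).
  apply Hsmall; try lra; nra.
Qed.

(** The set [Q] allows functions that are only controlled on a part of the
    plane, such as a closed disc. *)
Lemma locally_bounded_bounded (f : C -> C) (Q : C -> Prop) (a : C) (r : R) :
  (forall p, exists e M : R, (0 < e) /\
     forall q, Q q -> (Cmod (q - p) < e) -> (Cmod (f q) <= M)) ->
  exists M : R, (0 <= M) /\
    forall q, Q q -> (Cmod (q - a) <= r) -> (Cmod (f q) <= M).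
Proof.
  intros Hloc. destruct (Rle_or_lt 0 r) as [Hr|Hr].
  2: { exists 0%R. split; [lra|]. intros q _ Hq. assert (h := Cmod_ge_0 (q - a)). lra. }
  destruct a as [a1 a2].
  destruct (rect_induction (fun x1 x2 y1 y2 => exists M : R, (0 <= M) /\
    forall q : C, Q q -> (x1 <= fst q <= x2) -> (y1 <= snd q <= y2) ->
      (Cmod (f q) <= M)) (a1 - r) (a1 + r) (a2 - r) (a2 + r)) as [M [HM0 HM]].
  - intros x1 x2 y1 y2 _ _ _ _ (M1 & h1 & H1) (M2 & h2 & H2) (M3 & h3 & H3) (M4 & h4 & H4).
    exists (M1 + M2 + M3 + M4)%R. split; [lra|]. intros q Hq Hx Hy.
    destruct (Rle_or_lt (fst q) ((x1 + x2) / 2)); destruct (Rle_or_lt (snd q) ((y1 + y2) / 2)).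
    + specialize (H1 q Hq). lra.
    + specialize (H3 q Hq). lra.
    + specialize (H2 q Hq). lra.
    + specialize (H4 q Hq). lra.
  - intros x y _ _. destruct (Hloc (x, y)) as (e & M & He & HM).
    exists (e / 2)%R. split; [lra|]. intros x1 x2 y1 y2 hx1 hx2 hy1 hy2 hw hh.
    exists (Rabs M). split; [apply Rabs_pos|]. intros q Hq Hx Hy.
    eapply Rle_trans; [apply HM; [exact Hq|]|apply Rle_abs].
    destruct q as [q1 q2]; simpl in Hx, Hy.
    replace e with (2 * (e / 2))%R by field.
    apply Cmod_coord; apply Rabs_def1; lra.
  - lra.
  - lra.
  - exists M. split; [exact HM0|]. intros q Hq Hqa.
    assert (h := Rmax_Cmod (q - (a1, a2))).
    assert (h1 := Rmax_l (Rabs (fst (q - (a1, a2)))) (Rabs (snd (q - (a1, a2))))).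
    assert (h2 := Rmax_r (Rabs (fst (q - (a1, a2)))) (Rabs (snd (q - (a1, a2))))).
    change (fst (q - (a1, a2))) with (fst q - a1)%R in *.
    change (snd (q - (a1, a2))) with (snd q - a2)%R in *.
    assert (k1 := Rabs_le_between (fst q - a1) r). assert (k2 := Rabs_le_between (snd q - a2) r).
    apply HM; [exact Hq| |].
    + destruct k1 as [k1 _]. lra.
    + destruct k2 as [k2 _]. lra.
Qed.

Lemma ccont_loc_bounded (f : C -> C) (p : C) :
  ccont f p -> exists e M : R, (0 < e) /\
    forall q, (Cmod (q - p) < e) -> (Cmod (f q) <= M).
Proof.
  intros H. destruct (H 1%R Rlt_0_1) as [e [He H']].
  exists e, (1 + Cmod (f p))%R. split; [exact He|]. intros q Hq.
  specialize (H' q Hq). assert (h := Cmod_minus_le (f q) (f p)). lra.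
Qed.

(** A point outside the closed disc has a neighbourhood that does not meet the
    disc, where the required local bound is void. *)
Lemma ccont_disc_bounded (f : C -> C) (a : C) (r : R) :
  (forall z, (Cmod (z - a) <= r) -> ccont f z) ->
  exists M : R, (0 <= M) /\ forall z, (Cmod (z - a) <= r) -> (Cmod (f z) <= M).
Proof.
  intros Hc.
  destruct (locally_bounded_bounded f (fun z => (Cmod (z - a) <= r)) a r) as [M [h H]].
  - intros p. destruct (Rle_or_lt (Cmod (p - a)) r) as [Hp|Hp].
    + destruct (ccont_loc_bounded f p (Hc p Hp)) as (e & M & He & HM).
      exists e, M. auto.
    + exists (Cmod (p - a) - r)%R, 0%R. split; [lra|]. intros q Hq Hqp.
      exfalso. assert (h := Cmod_dist_triangle p q a).
      rewrite (Cmod_minus_sym p q) in h. lra.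
  - exists M. split; [exact h|]. intros z Hz. apply H; assumption.
Qed.

(** * Integrals of complex-valued functions *)

Definition CInt (f : R -> C) (a b : R) : C := @RInt C_R_CompleteNormedModule f a b.

Definition rcont_on (f : R -> C) (a b : R) : Prop :=
  forall s, (a <= s <= b) -> rcont f s.

Lemma CInt_ex (f : R -> C) (a b : R) : (a <= b) -> rcont_on f a b ->
  @ex_RInt C_R_NormedModule f a b.
Proof.
  intros Hab Hf. apply (@ex_RInt_continuous C_R_CompleteNormedModule).
  intros s. rewrite Rmin_left, Rmax_right by exact Hab. intros Hs.
  apply rcont_iff, Hf, Hs.
Qed.

Lemma CInt_is (f : R -> C) (a b : R) : (a <= b) -> rcont_on f a b ->
  @is_RInt C_R_NormedModule f a b (CInt f a b).
Proof.
  intros Hab Hf. apply (@RInt_correct C_R_CompleteNormedModule), CInt_ex; assumption.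
Qed.

Lemma CInt_unique (f : R -> C) (a b : R) (l : C) :
  @is_RInt C_R_NormedModule f a b l -> CInt f a b = l.
Proof. apply (@is_RInt_unique C_R_CompleteNormedModule). Qed.

Lemma CInt_ext (f g : R -> C) (a b : R) : (a <= b) ->
  (forall s, (a <= s <= b) -> f s = g s) -> CInt f a b = CInt g a b.
Proof.
  intros Hab H. apply (@RInt_ext C_R_CompleteNormedModule).
  rewrite Rmin_left, Rmax_right by exact Hab. intros s Hs. apply H. lra.
Qed.

Lemma CInt_plus (f g : R -> C) (a b : R) : (a <= b) -> rcont_on f a b -> rcont_on g a b ->
  CInt (fun s => f s + g s) a b = CInt f a b + CInt g a b.
Proof.
  intros Hab Hf Hg. apply CInt_unique.
  apply (@is_RInt_plus C_R_NormedModule); apply CInt_is; assumption.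
Qed.

Lemma CInt_minus (f g : R -> C) (a b : R) : (a <= b) -> rcont_on f a b -> rcont_on g a b ->
  CInt (fun s => f s - g s) a b = CInt f a b - CInt g a b.
Proof.
  intros Hab Hf Hg. apply CInt_unique.
  apply (@is_RInt_minus C_R_NormedModule); apply CInt_is; assumption.
Qed.

Lemma CInt_components (f : R -> C) (a b : R) (l : C) :
  @is_RInt C_R_NormedModule f a b l ->
  is_RInt (fun s => fst (f s)) a b (fst l) /\ is_RInt (fun s => snd (f s)) a b (snd l).
Proof.
  intros H. split.
  - exact (is_RInt_fct_extend_fst (U := R_NormedModule) (V := R_NormedModule) f a b l H).
  - exact (is_RInt_fct_extend_snd (U := R_NormedModule) (V := R_NormedModule) f a b l H).
Qed.

Lemma CInt_scal (c : C) (f : R -> C) (a b : R) : (a <= b) -> rcont_on f a b ->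
  CInt (fun s => c * f s) a b = c * CInt f a b.
Proof.
  intros Hab Hf. apply CInt_unique.
  destruct (CInt_components f a b _ (CInt_is f a b Hab Hf)) as [H1 H2].
  apply (is_RInt_fct_extend_pair (U := R_NormedModule) (V := R_NormedModule)).
  - apply (is_RInt_minus (V := R_NormedModule) (fun s => fst c * fst (f s))%R
             (fun s => snd c * snd (f s))%R a b).
    + apply (is_RInt_scal (V := R_NormedModule)), H1.
    + apply (is_RInt_scal (V := R_NormedModule)), H2.
  - apply (is_RInt_plus (V := R_NormedModule) (fun s => fst c * snd (f s))%R
             (fun s => snd c * fst (f s))%R a b).
    + apply (is_RInt_scal (V := R_NormedModule)), H2.
    + apply (is_RInt_scal (V := R_NormedModule)), H1.
Qed.

Lemma CInt_const (c : C) (a b : R) : CInt (fun _ => c) a b = RtoC (b - a) * c.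
Proof.
  apply CInt_unique.
  assert (H := @is_RInt_const C_R_NormedModule a b c).
  assert (E : @scal R_AbsRing C_R_NormedModule (b - a)%R c = RtoC (b - a) * c).
  { change (((b - a) * fst c, (b - a) * snd c)%R = RtoC (b - a) * c).
    unfold RtoC, Cmult; simpl. f_equal; ring. }
  rewrite <- E. exact H.
Qed.

Lemma CInt_Chasles (f : R -> C) (a b c : R) : (a <= b <= c) -> rcont_on f a c ->
  CInt f a b + CInt f b c = CInt f a c.
Proof.
  intros Habc Hf. apply (@RInt_Chasles C_R_CompleteNormedModule).
  - apply CInt_ex; [lra|]. intros s Hs. apply Hf. lra.
  - apply CInt_ex; [lra|]. intros s Hs. apply Hf. lra.
Qed.

Lemma CInt_bound (f : R -> C) (a b M : R) : (a <= b) -> rcont_on f a b ->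
  (forall s, (a <= s <= b) -> (Cmod (f s) <= M)) ->
  (Cmod (CInt f a b) <= M * (b - a)).
Proof.
  intros Hab Hf HM. rewrite <- norm_C_R.
  apply (@norm_RInt_le C_R_NormedModule f (fun _ => M) a b).
  - exact Hab.
  - intros s Hs. rewrite norm_C_R. apply HM, Hs.
  - apply CInt_is; assumption.
  - rewrite Rmult_comm. apply (@is_RInt_const R_NormedModule).
Qed.

Lemma CInt_FTC (f df : R -> C) (a b : R) : (a <= b) ->
  (forall s, (a <= s <= b) -> rderiv f s (df s)) -> rcont_on df a b ->
  CInt df a b = f b - f a.
Proof.
  intros Hab Hf Hdf. apply CInt_unique.
  apply (@is_RInt_derive C_R_CompleteNormedModule f df a b);
    rewrite Rmin_left, Rmax_right by exact Hab.
  - exact Hf.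
  - intros s Hs. apply rcont_iff, Hdf, Hs.
Qed.

Lemma ccont_rcont (f : C -> C) (g : R -> C) (s : R) :
  ccont f (g s) -> rcont g s -> rcont (fun x => f (g x)) s.
Proof.
  intros Hf Hg eps He. destruct (Hf eps He) as [d [Hd H]].
  destruct (Hg d Hd) as [d' [Hd' H']]. exists d'. split; [exact Hd'|].
  intros y Hy. apply H, H', Hy.
Qed.

Lemma rderiv_rcont (f : R -> C) (s : R) (l : C) : rderiv f s l -> rcont f s.
Proof.
  intros H. apply rcont_iff.
  apply (ex_derive_continuous (K := R_AbsRing) (V := C_R_NormedModule) f s).
  exists l. exact H.
Qed.

Lemma rcont_plus (f g : R -> C) (s : R) :
  rcont f s -> rcont g s -> rcont (fun x => f x + g x) s.
Proof.
  intros Hf Hg. apply rcont_iff.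
  apply (@continuous_plus R_UniformSpace R_AbsRing C_R_NormedModule); apply rcont_iff; assumption.
Qed.

Lemma rcont_minus (f g : R -> C) (s : R) :
  rcont f s -> rcont g s -> rcont (fun x => f x - g x) s.
Proof.
  intros Hf Hg. apply rcont_iff.
  apply (@continuous_minus R_UniformSpace R_AbsRing C_R_NormedModule); apply rcont_iff; assumption.
Qed.

(** * Goursat's lemma on rectangles *)

Lemma holo_at_ccont (f : C -> C) (z : C) : holo_at f z -> ccont f z.
Proof. intros [l H]. exact (cderiv_ccont f z l H). Qed.

Lemma rderiv_hor (x y : R) : rderiv (fun s => (s, y) : C) x 1.
Proof.
  apply (is_derive_ext (V := C_R_NormedModule) (fun s => (0%R, y) + RtoC s * 1)); [|apply rderiv_affine].
  intros s. unfold RtoC, Cplus, Cmult; simpl. f_equal; ring.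
Qed.

Lemma rderiv_ver (x y : R) : rderiv (fun s => (x, s) : C) y Ci.
Proof.
  apply (is_derive_ext (V := C_R_NormedModule) (fun s => RtoC x + RtoC s * Ci)); [|apply rderiv_affine].
  intros s. unfold RtoC, Ci, Cplus, Cmult; simpl. f_equal; ring.
Qed.

(** The integral along the boundary of a rectangle, counterclockwise. *)
Definition rect_int (f : C -> C) (x1 x2 y1 y2 : R) : C :=
  (CInt (fun x => f (x, y1)) x1 x2 - CInt (fun x => f (x, y2)) x1 x2)
  + Ci * (CInt (fun y => f (x2, y)) y1 y2 - CInt (fun y => f (x1, y)) y1 y2).

Definition ccont_rect (f : C -> C) (x1 x2 y1 y2 : R) : Prop :=
  forall x y, (x1 <= x <= x2) -> (y1 <= y <= y2) -> ccont f (x, y).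

Lemma ccont_rect_hor (f : C -> C) (x1 x2 y1 y2 y : R) :
  ccont_rect f x1 x2 y1 y2 -> (y1 <= y <= y2) -> rcont_on (fun x => f (x, y)) x1 x2.
Proof.
  intros Hf Hy s Hs. apply (ccont_rcont f (fun x => (x, y))).
  - apply Hf; assumption.
  - eapply rderiv_rcont, rderiv_hor.
Qed.

Lemma ccont_rect_ver (f : C -> C) (x1 x2 y1 y2 x : R) :
  ccont_rect f x1 x2 y1 y2 -> (x1 <= x <= x2) -> rcont_on (fun y => f (x, y)) y1 y2.
Proof.
  intros Hf Hx s Hs. apply (ccont_rcont f (fun y => (x, y))).
  - apply Hf; assumption.
  - eapply rderiv_rcont, rderiv_ver.
Qed.

Lemma rect_int_minus (f g : C -> C) (x1 x2 y1 y2 : R) : (x1 <= x2) -> (y1 <= y2) ->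
  ccont_rect f x1 x2 y1 y2 -> ccont_rect g x1 x2 y1 y2 ->
  rect_int (fun z => f z - g z) x1 x2 y1 y2 = rect_int f x1 x2 y1 y2 - rect_int g x1 x2 y1 y2.
Proof.
  intros Hx Hy Hf Hg. unfold rect_int.
  rewrite !CInt_minus; try assumption;
    try (eapply ccont_rect_hor; [eassumption|lra]);
    try (eapply ccont_rect_ver; [eassumption|lra]).
  ring.
Qed.

Lemma rect_int_primitive (f p : C -> C) (x1 x2 y1 y2 : R) : (x1 <= x2) -> (y1 <= y2) ->
  ccont_rect f x1 x2 y1 y2 ->
  (forall x y, (x1 <= x <= x2) -> (y1 <= y <= y2) -> cderiv p (x, y) (f (x, y))) ->
  rect_int f x1 x2 y1 y2 = 0.
Proof.
  intros Hx Hy Hf Hp.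
  assert (H : forall y, (y1 <= y <= y2) ->
    CInt (fun x => f (x, y)) x1 x2 = p (x2, y) - p (x1, y)).
  { intros y Hyy. apply (CInt_FTC (fun x => p (x, y))); [exact Hx| |].
    - intros s Hs. eapply rderiv_val.
      2: { apply (cderiv_rderiv p (fun x => (x, y))); [apply Hp; assumption|apply rderiv_hor]. }
      ring.
    - eapply ccont_rect_hor; eassumption. }
  assert (V : forall x, (x1 <= x <= x2) ->
    Ci * CInt (fun y => f (x, y)) y1 y2 = p (x, y2) - p (x, y1)).
  { intros x Hxx. assert (Hc := ccont_rect_ver f x1 x2 y1 y2 x Hf Hxx).
    rewrite <- CInt_scal; [|exact Hy|exact Hc].
    apply (CInt_FTC (fun y => p (x, y))); [exact Hy| |].
    - intros s Hs. apply (cderiv_rderiv p (fun y => (x, y)));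
        [apply Hp; assumption|apply rderiv_ver].
    - intros s Hs. apply (ccont_rcont (fun z => Ci * z) (fun y => f (x, y))).
      + eapply cderiv_ccont. apply (cderiv_scal (fun z => z)), cderiv_id.
      + apply Hc, Hs. }
  unfold rect_int. rewrite !H by lra.
  replace (Ci * (CInt (fun y => f (x2, y)) y1 y2 - CInt (fun y => f (x1, y)) y1 y2))
    with (Ci * CInt (fun y => f (x2, y)) y1 y2 - Ci * CInt (fun y => f (x1, y)) y1 y2) by ring.
  rewrite !V by lra. ring.
Qed.

Lemma rect_int_bound (f : C -> C) (x1 x2 y1 y2 M : R) : (x1 <= x2) -> (y1 <= y2) ->
  ccont_rect f x1 x2 y1 y2 ->
  (forall x y, (x1 <= x <= x2) -> (y1 <= y <= y2) -> (Cmod (f (x, y)) <= M)) ->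
  (Cmod (rect_int f x1 x2 y1 y2) <= 2 * M * ((x2 - x1) + (y2 - y1))).
Proof.
  intros Hx Hy Hf HM.
  assert (H : forall y, (y1 <= y <= y2) ->
    (Cmod (CInt (fun x => f (x, y)) x1 x2) <= M * (x2 - x1))%R).
  { intros y Hyy. apply CInt_bound; [exact Hx|eapply ccont_rect_hor; eassumption|auto]. }
  assert (V : forall x, (x1 <= x <= x2) ->
    (Cmod (CInt (fun y => f (x, y)) y1 y2) <= M * (y2 - y1))%R).
  { intros x Hxx. apply CInt_bound; [exact Hy|eapply ccont_rect_ver; eassumption|auto]. }
  unfold rect_int. eapply Rle_trans; [apply Cmod_triangle|].
  rewrite Cmod_mult, Cmod_Ci, Rmult_1_l.
  assert (h1 := Cmod_triangle_minus (CInt (fun x => f (x, y1)) x1 x2) (CInt (fun x => f (x, y2)) x1 x2)).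
  assert (h2 := Cmod_triangle_minus (CInt (fun y => f (x2, y)) y1 y2) (CInt (fun y => f (x1, y)) y1 y2)).
  assert (k1 := H y1 ltac:(lra)). assert (k2 := H y2 ltac:(lra)).
  assert (k3 := V x1 ltac:(lra)). assert (k4 := V x2 ltac:(lra)). lra.
Qed.

Lemma rect_int_quarters (f : C -> C) (x1 m x2 y1 n y2 : R) :
  (x1 <= m <= x2) -> (y1 <= n <= y2) -> ccont_rect f x1 x2 y1 y2 ->
  rect_int f x1 x2 y1 y2 = rect_int f x1 m y1 n + rect_int f m x2 y1 n
    + rect_int f x1 m n y2 + rect_int f m x2 n y2.
Proof.
  intros Hm Hn Hf. unfold rect_int.
  assert (H : forall y, (y1 <= y <= y2) ->
    CInt (fun x => f (x, y)) x1 x2 = CInt (fun x => f (x, y)) x1 m + CInt (fun x => f (x, y)) m x2).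
  { intros y Hy. symmetry. apply CInt_Chasles; [exact Hm|eapply ccont_rect_hor; eassumption]. }
  assert (V : forall x, (x1 <= x <= x2) ->
    CInt (fun y => f (x, y)) y1 y2 = CInt (fun y => f (x, y)) y1 n + CInt (fun y => f (x, y)) n y2).
  { intros x Hx. symmetry. apply CInt_Chasles; [exact Hn|eapply ccont_rect_ver; eassumption]. }
  rewrite (H y1), (H y2), (V x1), (V x2) by lra. ring.
Qed.

(** On a small rectangle around a point of differentiability, subtracting the
    affine part of [f], which has a primitive, leaves an integral that is
    small compared with the square of the perimeter; bounds of this kind add up
    over the quarters of a rectangle. *)
Theorem goursat (f : C -> C) (a b c d : R) : (a <= b) -> (c <= d) ->
  (forall x y, (a <= x <= b) -> (c <= y <= d) -> holo_at f (x, y)) ->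
  rect_int f a b c d = 0.
Proof.
  intros Hab Hcd Hf.
  apply (Cmod_le_all_eps _ (2 * ((b - a) + (d - c)) * ((b - a) + (d - c)))%R).
  intros eps He.
  replace (2 * (b - a + (d - c)) * (b - a + (d - c)) * eps)%R with
    (2 * eps * (((b - a) + (d - c)) * ((b - a) + (d - c))))%R by ring.
  assert (Hc : ccont_rect f a b c d) by (intros x y Hx Hy; apply holo_at_ccont, Hf; assumption).
  assert (sub : forall x1 x2 y1 y2, (a <= x1) -> (x2 <= b) -> (c <= y1) -> (y2 <= d) ->
    ccont_rect f x1 x2 y1 y2) by (intros x1 x2 y1 y2 h1 h2 h3 h4 x y hx hy; apply Hc; lra).
  apply (rect_induction (fun x1 x2 y1 y2 => (Cmod (rect_int f x1 x2 y1 y2) <=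
    2 * eps * (((x2 - x1) + (y2 - y1)) * ((x2 - x1) + (y2 - y1)))))); try assumption.
  - intros x1 x2 y1 y2 h1 h2 h3 h4 q1 q2 q3 q4.
    rewrite (rect_int_quarters f x1 ((x1 + x2) / 2) x2 y1 ((y1 + y2) / 2) y2); try lra.
    2: { apply sub; lra. }
    assert (E4 : forall u v, (u = (x2 - x1) / 2)%R -> (v = (y2 - y1) / 2)%R ->
      (2 * eps * ((u + v) * (u + v)) =
       2 * eps * ((x2 - x1 + (y2 - y1)) * (x2 - x1 + (y2 - y1))) / 4)%R)
      by (intros u v -> ->; field).
    rewrite E4 in q1, q2, q3, q4 by field.
    eapply Rle_trans; [apply Cmod_triangle|].
    eapply Rle_trans; [apply Rplus_le_compat_r, Cmod_triangle|].
    eapply Rle_trans; [apply Rplus_le_compat_r, Rplus_le_compat_r, Cmod_triangle|]. lra.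
  - intros x y Hx Hy. destruct (Hf x y Hx Hy) as [l Hl].
    destruct (proj1 (cderiv_iff f (x, y) l) Hl eps He) as [e [He' H]].
    exists (e / 2)%R. split; [lra|]. intros x1 x2 y1 y2 h1 h2 h3 h4 hw hh.
    set (p := ((x, y) : C)) in *.
    pose (lin := fun z : C => f p + (z - p) * l).
    pose (prim := fun z : C => f p * z + (z - p) * (z - p) * (l / 2)).
    assert (Elin : forall z, cderiv lin z l).
    { intros z. eapply cderiv_val.
      2: { unfold lin. apply cderiv_plus; [apply cderiv_const|].
           apply (cderiv_mult (fun z => z - p) (fun _ => l)).
           - apply cderiv_sub_const.
           - apply cderiv_const. }
      ring. }
    assert (Eprim : forall z, cderiv prim z (lin z)).
    { intros z.
      assert (H1 := cderiv_sub_const p z).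
      assert (H2 := cderiv_mult _ _ z _ _ H1 H1).
      assert (H3 := cderiv_mult _ _ z _ _ H2 (cderiv_const (l / 2) z)).
      assert (H4 := cderiv_plus _ _ z _ _ (cderiv_scal _ z _ (f p) (cderiv_id z)) H3).
      refine (cderiv_val _ _ _ _ _ H4). unfold lin. field. }
    assert (Clin : ccont_rect lin x1 x2 y1 y2).
    { intros u v _ _. eapply cderiv_ccont, Elin. }
    assert (Cf : ccont_rect f x1 x2 y1 y2) by (apply sub; lra).
    replace (rect_int f x1 x2 y1 y2) with (rect_int (fun z => f z - lin z) x1 x2 y1 y2).
    2: { rewrite rect_int_minus; try lra; try assumption.
         assert (E0 : rect_int lin x1 x2 y1 y2 = 0).
         { apply (rect_int_primitive lin prim); try lra; try assumption.
           intros; apply Eprim. }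
         rewrite E0. ring. }
    replace (2 * eps * ((x2 - x1 + (y2 - y1)) * (x2 - x1 + (y2 - y1))))%R with
      (2 * (eps * (x2 - x1 + (y2 - y1))) * (x2 - x1 + (y2 - y1)))%R by ring.
    apply rect_int_bound; try lra.
    + intros u v Hu Hv. destruct (Hf u v) as [l' Hl']; try lra.
      eapply cderiv_ccont, cderiv_minus; [exact Hl'|apply Elin].
    + intros u v Hu Hv.
      assert (Hlt : (Cmod ((u, v) - p) < e)).
      { replace e with (2 * (e / 2))%R by field. unfold p.
        apply Cmod_coord; apply Rabs_def1; lra. }
      specialize (H _ Hlt). rewrite Cplus_minus_cancel in H.
      unfold lin. replace (f (u, v) - (f p + ((u, v) - p) * l)) with
        (f (u, v) - f p - ((u, v) - p) * l) by ring.
      eapply Rle_trans; [exact H|]. apply Rmult_le_compat_l; [lra|].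
      assert (T := Cmod_triangle (RtoC (u - x)) (RtoC (v - y) * Ci)).
      rewrite Cmod_mult, Cmod_Ci, !Cmod_R in T.
      replace (RtoC (u - x) + RtoC (v - y) * Ci) with ((u, v) - p) in T.
      2: { unfold p, RtoC, Ci, Cminus, Cplus, Copp, Cmult; simpl. f_equal; ring. }
      assert (Rabs (u - x) <= x2 - x1) by (apply Rabs_le; lra).
      assert (Rabs (v - y) <= y2 - y1) by (apply Rabs_le; lra). lra.
Qed.

(** * Circle means and the mean value property *)

Definition Cexp (z : C) : C :=
  ((exp (fst z) * cos (snd z))%R, (exp (fst z) * sin (snd z))%R).

Lemma Cexp_plus (z w : C) : Cexp (z + w) = Cexp z * Cexp w.
Proof.
  destruct z as [a b], w as [c d]. unfold Cexp, Cmult, Cplus; simpl.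
  rewrite exp_plus, cos_plus, sin_plus. f_equal; ring.
Qed.

Lemma Cexp_0 : Cexp 0 = 1.
Proof. unfold Cexp, RtoC; simpl. rewrite exp_0, cos_0, sin_0. f_equal; ring. Qed.

Lemma Cexp_neq_0 (z : C) : Cexp z <> 0.
Proof.
  intros H.
  assert (K : Cexp z * Cexp (- z) = 1).
  { rewrite <- Cexp_plus. replace (z + - z) with (RtoC 0) by ring. apply Cexp_0. }
  rewrite H in K. replace (0 * Cexp (- z)) with (RtoC 0) in K by ring.
  apply RtoC_inj in K. lra.
Qed.

Lemma Cmod_Cexp (z : C) : Cmod (Cexp z) = exp (fst z).
Proof.
  unfold Cmod, Cexp; simpl fst; simpl snd.
  replace ((exp (fst z) * cos (snd z)) ^ 2 + (exp (fst z) * sin (snd z)) ^ 2)%R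
    with (exp (fst z) * exp (fst z))%R.
  - apply sqrt_square, Rlt_le, exp_pos.
  - assert (H := sin2_cos2 (snd z)). unfold Rsqr in H. nra.
Qed.

Lemma derivable_pt_lim_0_bound (f : R -> R) (l : R) : derivable_pt_lim f 0 l ->
  forall eps : R, (0 < eps) -> exists d : R, (0 < d) /\
    forall h : R, (Rabs h < d) -> (Rabs (f h - f 0 - h * l) <= eps * Rabs h).
Proof.
  intros H eps He. destruct (H eps He) as [[d Hd] H']. exists d. split; [exact Hd|].
  intros h Hh. destruct (Req_dec h 0) as [->|Hh0].
  - replace (f 0 - f 0 - 0 * l)%R with 0%R by ring. rewrite Rabs_R0. lra.
  - specialize (H' h Hh0 Hh). rewrite Rplus_0_l in H'.
    replace (f h - f 0 - h * l)%R with (((f h - f 0) / h - l) * h)%R by (field; exact Hh0).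
    rewrite Rabs_mult. apply Rmult_le_compat_r; [apply Rabs_pos|lra].
Qed.

Lemma im_le_Cmod (z : C) : (Rabs (snd z) <= Cmod z).
Proof. eapply Rle_trans; [apply Rmax_r|apply Rmax_Cmod]. Qed.

Lemma cderiv_Cexp (z : C) : cderiv Cexp z (Cexp z).
Proof.
  assert (H0 : cderiv Cexp 0 1).
  { apply cderiv_iff. intros eps He.
    set (e := Rmin (eps / 10) 1).
    assert (He1 : (0 < e)) by (apply Rmin_glb_lt; lra).
    assert (e1 := Rmin_l (eps / 10) 1). assert (e2 := Rmin_r (eps / 10) 1). fold e in e1, e2.
    destruct (derivable_pt_lim_0_bound exp 1 derivable_pt_lim_exp_0 e He1) as [d1 [Hd1 H1]].
    destruct (derivable_pt_lim_0_bound cos 0) with (eps := e) as [d2 [Hd2 H2]]; [|exact He1|].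
    { assert (K := derivable_pt_lim_cos 0). rewrite sin_0, Ropp_0 in K. exact K. }
    destruct (derivable_pt_lim_0_bound sin 1) with (eps := e) as [d3 [Hd3 H3]]; [|exact He1|].
    { assert (K := derivable_pt_lim_sin 0). rewrite cos_0 in K. exact K. }
    exists (Rmin (Rmin d1 d2) (Rmin d3 e)). split; [repeat apply Rmin_glb_lt; lra|].
    intros h Hh. Rmin_bounds. rewrite Cplus_0_l, Cexp_0.
    destruct h as [x y].
    assert (hx := re_le_Cmod (x, y)). change (Re (x, y)) with x in hx.
    assert (hy := im_le_Cmod (x, y)). simpl snd in hy.
    set (m := Cmod (x, y)) in *.
    specialize (H1 x ltac:(lra)). specialize (H2 y ltac:(lra)). specialize (H3 y ltac:(lra)).
    rewrite exp_0 in H1. rewrite cos_0 in H2. rewrite sin_0 in H3.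
    assert (px := Rabs_pos x). assert (py := Rabs_pos y).
    set (A := (exp x - 1 - x * 1)%R) in H1.
    set (B := (cos y - 1 - y * 0)%R) in H2.
    set (D := (sin y - 0 - y * 1)%R) in H3.
    assert (Ex : (exp x = 1 + x + A)%R) by (unfold A; ring).
    assert (Ey : (cos y = 1 + B)%R) by (unfold B; ring).
    assert (Ez : (sin y = y + D)%R) by (unfold D; ring).
    assert (HA : (Rabs A <= e * m)) by nra.
    assert (HB : (Rabs B <= e * m)) by nra.
    assert (HD : (Rabs D <= e * m)) by nra.
    assert (Hm0 : (0 <= m)) by (apply Cmod_ge_0).
    assert (Hme : (m <= e)) by lra.
    assert (HxA : (Rabs (x + A) <= 2 * m)).
    { eapply Rle_trans; [apply Rabs_triang|]. nra. }
    eapply Rle_trans; [apply Cmod_le_coord|].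
    unfold Cexp. simpl fst. simpl snd.
    rewrite Ex, Ey, Ez.
    apply Rle_trans with ((e * m + e * m + 2 * m * e) + (e * m + 2 * m * e + 2 * m * e))%R; [|nra].
    apply Rplus_le_compat.
    - match goal with |- (Rabs ?u <= _) => replace u with (A + B + (x + A) * B)%R by ring end.
      eapply Rle_trans; [apply Rabs_triang|]. apply Rplus_le_compat.
      + eapply Rle_trans; [apply Rabs_triang|]. lra.
      + rewrite Rabs_mult. apply Rmult_le_compat; try apply Rabs_pos; nra.
    - match goal with |- (Rabs ?u <= _) => replace u with (D + (x + A) * y + (x + A) * D)%R by ring end.
      eapply Rle_trans; [apply Rabs_triang|]. apply Rplus_le_compat.
      + eapply Rle_trans; [apply Rabs_triang|]. apply Rplus_le_compat; [exact HD|].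
        rewrite Rabs_mult. apply Rmult_le_compat; try apply Rabs_pos; nra.
      + rewrite Rabs_mult. apply Rmult_le_compat; try apply Rabs_pos; nra. }
  apply cderiv_iff. intros eps He.
  assert (Hp : (0 < Cmod (Cexp z))) by (rewrite Cmod_Cexp; apply exp_pos).
  destruct (proj1 (cderiv_iff Cexp 0 1) H0 (eps / Cmod (Cexp z))%R) as [d [Hd H]].
  { apply Rdiv_lt_0_compat; assumption. }
  exists d. split; [exact Hd|]. intros h Hh. specialize (H h Hh).
  rewrite Cplus_0_l, Cexp_0 in H.
  replace (Cexp (z + h) - Cexp z - h * Cexp z) with (Cexp z * (Cexp h - 1 - h * 1))
    by (rewrite Cexp_plus; ring).
  rewrite Cmod_mult.
  replace (eps * Cmod h)%R with (Cmod (Cexp z) * (eps / Cmod (Cexp z) * Cmod h))%R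
    by (field; lra).
  apply Rmult_le_compat_l; lra.
Qed.

Definition circle_pt (a : C) (r t : R) : C := a + RtoC r * Cexp (0%R, t).

Lemma circle_pt_dist (a : C) (r t : R) : (0 <= r) -> Cmod (circle_pt a r t - a) = r.
Proof.
  intros Hr. unfold circle_pt. replace (a + RtoC r * Cexp (0%R, t) - a) with (RtoC r * Cexp (0%R, t)) by ring.
  rewrite Cmod_mult, Cmod_R, Cmod_Cexp, Rabs_pos_eq by exact Hr. simpl. rewrite exp_0. ring.
Qed.

Lemma circle_pt_rcont (a : C) (r t : R) : rcont (circle_pt a r) t.
Proof.
  apply (ccont_rcont (fun z => a + RtoC r * Cexp z) (fun t => (0%R, t))).
  - eapply cderiv_ccont, cderiv_plus; [apply cderiv_const|apply cderiv_scal, cderiv_Cexp].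
  - eapply rderiv_rcont, rderiv_ver.
Qed.

Definition circle_mean (f : C -> C) (a : C) (r : R) : C :=
  RtoC (/ (2 * PI)) * CInt (fun t => f (circle_pt a r t)) 0 (2 * PI).

Definition ccont_circle (f : C -> C) (a : C) (r : R) : Prop :=
  forall z, Cmod (z - a) = r -> ccont f z.

Lemma two_PI_pos : (0 < 2 * PI).
Proof. assert (H := PI_RGT_0). lra. Qed.

Lemma ccont_circle_rcont (f : C -> C) (a : C) (r u v : R) : (0 <= r) -> ccont_circle f a r ->
  rcont_on (fun t => f (circle_pt a r t)) u v.
Proof.
  intros Hr Hf s _. apply ccont_rcont; [|apply circle_pt_rcont].
  apply Hf, circle_pt_dist, Hr.
Qed.

Lemma circle_mean_ext (f g : C -> C) (a : C) (r : R) : (0 <= r) ->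
  (forall z, Cmod (z - a) = r -> f z = g z) -> circle_mean f a r = circle_mean g a r.
Proof.
  intros Hr H. unfold circle_mean. f_equal. assert (h := two_PI_pos).
  apply CInt_ext; [lra|]. intros s _. apply H, circle_pt_dist, Hr.
Qed.

Lemma circle_mean_plus (f g : C -> C) (a : C) (r : R) : (0 <= r) ->
  ccont_circle f a r -> ccont_circle g a r ->
  circle_mean (fun z => f z + g z) a r = circle_mean f a r + circle_mean g a r.
Proof.
  intros Hr Hf Hg. unfold circle_mean. assert (h := two_PI_pos).
  rewrite CInt_plus; [ring|lra| |]; apply ccont_circle_rcont; assumption.
Qed.

Lemma circle_mean_minus (f g : C -> C) (a : C) (r : R) : (0 <= r) ->
  ccont_circle f a r -> ccont_circle g a r ->
  circle_mean (fun z => f z - g z) a r = circle_mean f a r - circle_mean g a r.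
Proof.
  intros Hr Hf Hg. unfold circle_mean. assert (h := two_PI_pos).
  rewrite CInt_minus; [ring|lra| |]; apply ccont_circle_rcont; assumption.
Qed.

Lemma circle_mean_scal (c : C) (f : C -> C) (a : C) (r : R) : (0 <= r) ->
  ccont_circle f a r -> circle_mean (fun z => c * f z) a r = c * circle_mean f a r.
Proof.
  intros Hr Hf. unfold circle_mean. assert (h := two_PI_pos).
  rewrite CInt_scal; [ring|lra|]; apply ccont_circle_rcont; assumption.
Qed.

Lemma circle_mean_bound (f : C -> C) (a : C) (r M : R) : (0 <= r) ->
  ccont_circle f a r -> (forall z, Cmod (z - a) = r -> (Cmod (f z) <= M)) ->
  (Cmod (circle_mean f a r) <= M).
Proof.
  intros Hr Hf HM. unfold circle_mean. assert (h := two_PI_pos).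
  assert (h' : (0 < / (2 * PI))) by (apply Rinv_0_lt_compat, h).
  rewrite Cmod_mult, Cmod_R, Rabs_pos_eq by lra.
  replace M with (/ (2 * PI) * (M * (2 * PI - 0)))%R by (field; lra).
  apply Rmult_le_compat_l; [lra|]. apply CInt_bound; [lra| |].
  - apply ccont_circle_rcont; assumption.
  - intros s _. apply HM, circle_pt_dist, Hr.
Qed.

Lemma circle_mean_const (c a : C) (r : R) : circle_mean (fun _ => c) a r = c.
Proof.
  unfold circle_mean. rewrite CInt_const. assert (h := two_PI_pos).
  rewrite Cmult_assoc, <- RtoC_mult.
  replace (/ (2 * PI) * (2 * PI - 0))%R with 1%R by (field; lra). ring.
Qed.

(** In the coordinate [w] with [z = a + exp w], the circles around [a] become
    vertical segments of length [2 * PI], and the horizontal sides of a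
    rectangle between two of them cancel by periodicity.  Hence Goursat's
    lemma makes the mean independent of the radius, and continuity at the
    centre gives its limit for small radii. *)
Theorem mean_value_property (f : C -> C) (a : C) (r : R) : (0 < r) ->
  (forall z, z <> a -> (Cmod (z - a) <= r) -> holo_at f z) -> ccont f a ->
  circle_mean f a r = f a.
Proof.
  intros Hr Hf Ha. assert (hpi := two_PI_pos).
  assert (holo : forall w, (fst w <= ln r) -> holo_at (fun w => f (a + Cexp w)) w).
  { intros w Hw.
    assert (Hle : (exp (fst w) <= r)).
    { rewrite <- (exp_ln r Hr). destruct Hw as [Hw|Hw]; [left; apply exp_increasing, Hw|rewrite Hw; right; reflexivity]. }
    assert (E : a + Cexp w - a = Cexp w) by ring.
    destruct (Hf (a + Cexp w)) as [l Hl].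
    - intros K. apply (Cexp_neq_0 w). rewrite <- E, K. ring.
    - rewrite E, Cmod_Cexp. exact Hle.
    - eexists. apply (cderiv_comp f (fun w => a + Cexp w)); [exact Hl|].
      apply cderiv_plus; [apply cderiv_const|apply cderiv_Cexp]. }
  assert (pt : forall u t, circle_pt a (exp u) t = a + Cexp (u, t)).
  { intros u t. unfold circle_pt. f_equal. unfold RtoC, Cexp, Cmult; simpl.
    rewrite exp_0. f_equal; ring. }
  assert (same : forall u, (u <= ln r) -> circle_mean f a r = circle_mean f a (exp u)).
  { intros u Hu.
    assert (G := goursat (fun w => f (a + Cexp w)) u (ln r) 0 (2 * PI) Hu ltac:(lra)).
    assert (G' : rect_int (fun w => f (a + Cexp w)) u (ln r) 0 (2 * PI) = 0).
    { apply G. intros x y Hx Hy. apply holo. simpl. lra. }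
    unfold rect_int in G'. cbv beta in G'.
    rewrite (CInt_ext (fun x => f (a + Cexp (x, 2 * PI)%R)) (fun x => f (a + Cexp (x, 0%R)))) in G'.
    2: exact Hu.
    2: { intros s _. unfold Cexp; simpl. rewrite cos_2PI, sin_2PI, cos_0, sin_0. reflexivity. }
    assert (G2 : CInt (fun y => f (a + Cexp (ln r, y))) 0 (2 * PI)
                 = CInt (fun y => f (a + Cexp (u, y))) 0 (2 * PI)).
    { match type of G' with (?x - ?x + Ci * (?y - ?z) = _) =>
        assert (K : Ci * (y - z) = 0) by (rewrite <- G'; ring);
        assert (K2 : y - z = - Ci * (Ci * (y - z))) end.
      { unfold Ci. set (q := CInt _ _ _ - CInt _ _ _). destruct q.
        unfold Cmult, Copp; simpl. f_equal; ring. }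
      rewrite K in K2.
      match goal with |- ?y = ?z => replace y with (z + (y - z)) by ring; rewrite K2; ring end. }
    unfold circle_mean. f_equal.
    transitivity (CInt (fun y => f (a + Cexp (ln r, y))) 0 (2 * PI)).
    - apply CInt_ext; [lra|]. intros s _. rewrite <- pt, exp_ln by exact Hr. reflexivity.
    - rewrite G2. apply CInt_ext; [lra|]. intros s _. rewrite pt. reflexivity. }
  assert (K : circle_mean f a r - f a = 0).
  { apply (Cmod_le_all_eps _ 1). intros eps He. rewrite Rmult_1_l.
    destruct (Ha eps He) as [d [Hd H]].
    set (d' := (Rmin r d / 2)%R).
    assert (k3 : (0 < Rmin r d)) by (apply Rmin_glb_lt; assumption). Rmin_bounds.
    assert (Hd' : (0 < d')) by (unfold d'; lra).
    rewrite (same (ln d')).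
    2: { apply Rlt_le, ln_increasing; unfold d'; lra. }
    rewrite exp_ln by exact Hd'.
    assert (Hc : ccont_circle f a d').
    { intros z Hz. apply holo_at_ccont, Hf.
      - intros E. rewrite E in Hz. replace (a - a) with (RtoC 0) in Hz by ring.
        rewrite Cmod_0 in Hz. lra.
      - rewrite Hz. unfold d'. lra. }
    assert (Hk : ccont_circle (fun _ => f a) a d').
    { intros z _. eapply cderiv_ccont, cderiv_const. }
    rewrite <- (circle_mean_const (f a) a d') at 1.
    rewrite <- circle_mean_minus; [|lra|exact Hc|exact Hk].
    apply circle_mean_bound; [lra| |].
    - intros z Hz. destruct (Hf z) as [l Hl].
      + intros E. rewrite E in Hz. replace (a - a) with (RtoC 0) in Hz by ring.
        rewrite Cmod_0 in Hz. lra.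
      + rewrite Hz. unfold d'. lra.
      + eapply cderiv_ccont, cderiv_minus; [exact Hl|apply cderiv_const].
    - intros z Hz. apply Rlt_le, H. rewrite Hz. unfold d'. lra. }
  replace (circle_mean f a r) with (circle_mean f a r - f a + f a) by ring. rewrite K. ring.
Qed.

(** * Cauchy estimates *)

Definition holo_disc (f : C -> C) (a : C) (r : R) : Prop :=
  forall z, (Cmod (z - a) <= r) -> holo_at f z.

Lemma Cmod_self (a : C) : Cmod (a - a) = 0%R.
Proof. replace (a - a) with (RtoC 0) by ring. apply Cmod_0. Qed.

Lemma disc_sub (a b z : C) (r s : R) :
  (Cmod (z - b) <= s) -> (s + Cmod (b - a) <= r) -> (Cmod (z - a) <= r).
Proof.
  intros H1 H2. assert (T := Cmod_dist_triangle z b a). lra.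
Qed.

Lemma disc_convex (a y h : C) (r s : R) :
  (Cmod (y - a) <= r) -> (Cmod (y + h - a) <= r) -> (0 <= s <= 1) ->
  (Cmod (y + RtoC s * h - a) <= r).
Proof.
  intros H1 H2 Hs.
  replace (y + RtoC s * h - a) with (RtoC (1 - s) * (y - a) + RtoC s * (y + h - a)).
  2: { rewrite RtoC_minus. ring. }
  eapply Rle_trans; [apply Cmod_triangle|].
  rewrite !Cmod_mult, !Cmod_R, !Rabs_pos_eq by lra. nra.
Qed.

Lemma holo_disc_bounded (f : C -> C) (a : C) (r : R) : holo_disc f a r ->
  exists M : R, (0 <= M) /\ forall z, (Cmod (z - a) <= r) -> (Cmod (f z) <= M).
Proof.
  intros H. apply ccont_disc_bounded. intros z Hz. apply holo_at_ccont, H, Hz.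
Qed.

Definition dquot (f : C -> C) (a z : C) : C :=
  if excluded_middle_informative (z = a) then C_derive f a else (f z - f a) / (z - a).

Lemma dquot_at (f : C -> C) (a : C) : dquot f a a = C_derive f a.
Proof. unfold dquot. destruct (excluded_middle_informative (a = a)); [reflexivity|tauto]. Qed.

Lemma dquot_off (f : C -> C) (a z : C) : z <> a -> dquot f a z = (f z - f a) / (z - a).
Proof. intros H. unfold dquot. destruct (excluded_middle_informative (z = a)); [tauto|reflexivity]. Qed.

Lemma dquot_spec (f : C -> C) (a z : C) : f z = f a + (z - a) * dquot f a z.
Proof.
  destruct (classic (z = a)) as [->|H].
  - ring.
  - rewrite dquot_off by exact H. field. intros K. apply H.
    replace z with (z - a + a) by ring. rewrite K. ring.
Qed.

Lemma Cminus_neq_0 (z a : C) : z <> a -> z - a <> 0.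
Proof.
  intros H K. apply H. replace z with (z - a + a) by ring. rewrite K. ring.
Qed.

Lemma Cmod_pos_neq (z a : C) : z <> a -> (0 < Cmod (z - a)).
Proof. intros H. apply Cmod_gt_0, Cminus_neq_0, H. Qed.

Lemma dquot_ccont (f : C -> C) (a : C) : holo_at f a -> ccont (dquot f a) a.
Proof.
  intros H eps He. apply holo_at_cderiv in H.
  destruct (proj1 (cderiv_iff _ _ _) H (eps / 2)%R) as [d [Hd H']]; [lra|].
  exists d. split; [exact Hd|]. intros z Hz. rewrite dquot_at.
  destruct (classic (z = a)) as [->|Hza].
  - rewrite dquot_at, Cmod_self. exact He.
  - rewrite dquot_off by exact Hza. specialize (H' _ Hz). rewrite Cplus_minus_cancel in H'.
    assert (Hp := Cmod_pos_neq z a Hza). assert (Hn := Cminus_neq_0 z a Hza).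
    replace ((f z - f a) / (z - a) - C_derive f a) with
      ((f z - f a - (z - a) * C_derive f a) / (z - a)) by (field; exact Hn).
    rewrite Cmod_div by exact Hn.
    apply Rle_lt_trans with (eps / 2 * Cmod (z - a) / Cmod (z - a))%R.
    + apply Rmult_le_compat_r; [apply Rlt_le, Rinv_0_lt_compat, Hp|exact H'].
    + replace (eps / 2 * Cmod (z - a) / Cmod (z - a))%R with (eps / 2)%R by (field; lra). lra.
Qed.

Lemma dquot_holo_off (f : C -> C) (a z : C) : z <> a -> holo_at f z -> holo_at (dquot f a) z.
Proof.
  intros Hza [l Hl]. assert (Hp := Cmod_pos_neq z a Hza).
  eexists. apply (cderiv_ext_near (fun z => (f z - f a) / (z - a)) _ z _ (Cmod (z - a)) Hp).
  - intros y Hy. symmetry. apply dquot_off. intros ->. rewrite Cmod_minus_sym in Hy. lra.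
  - apply (cderiv_div (fun z => f z - f a) (fun z => z - a)).
    + apply Cminus_neq_0, Hza.
    + apply cderiv_minus; [exact Hl|apply cderiv_const].
    + apply cderiv_sub_const.
Qed.

Lemma circle_neq (a z : C) (r : R) : (0 < r) -> Cmod (z - a) = r -> z <> a.
Proof. intros Hr Hz ->. rewrite Cmod_self in Hz. lra. Qed.

(** The difference quotient satisfies the mean value property although it is
    only known to be continuous at [a]. *)
Lemma cauchy_formula (f : C -> C) (a : C) (r : R) : (0 < r) -> holo_disc f a r ->
  C_derive f a = circle_mean (fun z => (f z - f a) / (z - a)) a r.
Proof.
  intros Hr Hf. rewrite <- dquot_at.
  rewrite <- (mean_value_property (dquot f a) a r Hr).
  - apply circle_mean_ext; [lra|]. intros z Hz. apply dquot_off.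
    eapply circle_neq; eassumption.
  - intros z Hza Hz. apply dquot_holo_off; [exact Hza|apply Hf, Hz].
  - apply dquot_ccont, Hf. rewrite Cmod_self. lra.
Qed.

Lemma circle_mean_translate (f : C -> C) (a : C) (r : R) :
  circle_mean f a r = circle_mean (fun z => f (a + z)) 0 r.
Proof.
  unfold circle_mean. f_equal. assert (h := two_PI_pos). apply CInt_ext; [lra|].
  intros s _. f_equal. unfold circle_pt. ring.
Qed.

Lemma cauchy_formula_0 (f : C -> C) (a : C) (r : R) : (0 < r) -> holo_disc f a r ->
  C_derive f a = circle_mean (fun z => (f (a + z) - f a) / z) 0 r.
Proof.
  intros Hr Hf. rewrite (cauchy_formula f a r Hr Hf), circle_mean_translate.
  apply circle_mean_ext; [lra|]. intros z _. f_equal. ring.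
Qed.

Lemma cderiv_affine_shift (f : C -> C) (a z : C) : holo_at f (a + z) ->
  cderiv (fun y => f (a + y)) z (C_derive f (a + z)).
Proof. intros H. apply cderiv_shift, holo_at_cderiv, H. Qed.

Lemma cauchy_estimate (f : C -> C) (a : C) (r M : R) : (0 < r) -> holo_disc f a r ->
  (forall z, (Cmod (z - a) <= r) -> (Cmod (f z) <= M)) ->
  (Cmod (C_derive f a) <= 2 * M / r).
Proof.
  intros Hr Hf HM. rewrite (cauchy_formula f a r Hr Hf).
  apply circle_mean_bound; [lra| |].
  - intros z Hz. apply holo_at_ccont. destruct (Hf z) as [l Hl]; [lra|].
    eexists. apply (cderiv_div (fun z => f z - f a) (fun z => z - a)).
    + apply Cminus_neq_0. eapply circle_neq; eassumption.
    + apply cderiv_minus; [exact Hl|apply cderiv_const].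
    + apply cderiv_sub_const.
  - intros z Hz. rewrite Cmod_div, Hz by (apply Cminus_neq_0; eapply circle_neq; eassumption).
    apply Rmult_le_compat_r; [apply Rlt_le, Rinv_0_lt_compat, Hr|].
    eapply Rle_trans; [apply Cmod_triangle_minus|].
    assert (h1 := HM z ltac:(lra)). assert (h2 := HM a). rewrite Cmod_self in h2.
    specialize (h2 ltac:(lra)). lra.
Qed.

Lemma ccont_quot_0 (g : C -> C) (r : R) : (0 < r) ->
  (forall z, Cmod (z - 0) = r -> ccont g z) -> ccont_circle (fun z => g z / z) 0 r.
Proof.
  intros Hr Hg z Hz. apply (ccont_mult g Cinv); [apply Hg, Hz|].
  eapply cderiv_ccont, cderiv_inv_id, circle_neq; eassumption.
Qed.

Lemma deriv_bound_half (f : C -> C) (a : C) (r M : R) (y : C) :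
  (0 < r) -> holo_disc f a r -> (forall z, (Cmod (z - a) <= r) -> (Cmod (f z) <= M)) ->
  (Cmod (y - a) <= r / 2) ->
  (Cmod (C_derive f y) <= 4 * M / r).
Proof.
  intros HR Hf HM Hy. replace (4 * M / r)%R with (2 * M / (r / 2))%R by (field; lra).
  apply cauchy_estimate; [lra| |].
  - intros z Hz. apply Hf. eapply disc_sub; [exact Hz|lra].
  - intros z Hz. apply HM. eapply disc_sub; [exact Hz|lra].
Qed.

Lemma lipschitz_half (f : C -> C) (a : C) (r M : R) (y h : C) :
  (0 < r) -> holo_disc f a r -> (forall z, (Cmod (z - a) <= r) -> (Cmod (f z) <= M)) ->
  (Cmod (y - a) <= r / 2) -> (Cmod (y + h - a) <= r / 2) ->
  (Cmod (f (y + h)%C - f y) <= 4 * M / r * Cmod h).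
Proof.
  intros HR Hf HM Hy Hyh. apply (segment_bound f (C_derive f)).
  - intros s Hs. apply holo_at_cderiv, Hf.
    eapply Rle_trans; [apply (disc_convex a y h (r / 2)); assumption|lra].
  - intros s Hs. apply (deriv_bound_half f a r M); [assumption..|]. apply disc_convex; assumption.
Qed.

(** Cauchy's formula expresses the increment of the derivative as a mean of
    increments of [f], whose Lipschitz constant comes from the previous bound
    on the derivative. *)
Lemma deriv_lipschitz_quarter (f : C -> C) (a : C) (r M : R) (y h : C) :
  (0 < r) -> holo_disc f a r -> (forall z, (Cmod (z - a) <= r) -> (Cmod (f z) <= M)) ->
 
  (Cmod (y - a) <= r / 4) -> (Cmod (y + h - a) <= r / 4) ->
  (Cmod (C_derive f (y + h)%C - C_derive f y) <= 32 * M / (r * r) * Cmod h).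
Proof.
  intros HR Hf HM Hy Hyh.
  assert (near : forall x z, (Cmod (x - a) <= r / 4) -> Cmod (z - 0) = (r / 4)%R ->
    (Cmod (x + z - a) <= r / 2)).
  { intros x z Hx Hz. replace (z - 0) with z in Hz by ring.
    assert (T := Cmod_triangle (x - a) z). replace (x - a + z) with (x + z - a) in T by ring. lra. }
  assert (cont : forall x, (Cmod (x - a) <= r / 4) ->
    ccont_circle (fun z => (f (x + z) - f x) / z) 0 (r / 4)).
  { intros x Hx. apply (ccont_quot_0 (fun z => f (x + z) - f x)); [lra|].
    intros z Hz. eapply cderiv_ccont, cderiv_minus; [|apply cderiv_const].
    apply cderiv_affine_shift, Hf. eapply Rle_trans; [apply near; eassumption|lra]. }
  assert (form : forall x, (Cmod (x - a) <= r / 4) ->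
    C_derive f x = circle_mean (fun z => (f (x + z) - f x) / z) 0 (r / 4)).
  { intros x Hx. apply cauchy_formula_0; [lra|]. intros z Hz. apply Hf.
    eapply disc_sub; [exact Hz|lra]. }
  rewrite (form (y + h) Hyh), (form y Hy).
  rewrite <- circle_mean_minus; [|lra|apply cont, Hyh|apply cont, Hy].
  assert (Hc : ccont_circle (fun z => ((f (y + h + z) - f (y + h)) - (f (y + z) - f y)) / z) 0 (r / 4)).
  { apply (ccont_quot_0 (fun z => (f (y + h + z) - f (y + h)) - (f (y + z) - f y))); [lra|].
    intros z Hz.
    eapply cderiv_ccont, cderiv_minus; (eapply cderiv_minus; [|apply cderiv_const]);
    apply cderiv_affine_shift, Hf; (eapply Rle_trans; [apply near; eassumption|lra]). }
  rewrite (circle_mean_ext _ (fun z => ((f (y + h + z) - f (y + h)) - (f (y + z) - f y)) / z)).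
  2: lra.
  2: { intros z _. unfold Cdiv. ring. }
  apply circle_mean_bound; [lra|exact Hc|].
  intros z Hz. assert (Hz0 : z <> 0) by (apply (circle_neq 0 z (r / 4)); [lra|exact Hz]).
  rewrite Cmod_div by exact Hz0. assert (Hz' : Cmod z = (r / 4)%R).
  { rewrite <- Hz. f_equal. ring. }
  rewrite Hz'.
  replace (32 * M / (r * r) * Cmod h)%R with
    ((4 * M / r * Cmod h + 4 * M / r * Cmod h) / (r / 4))%R by (field; lra).
  apply Rmult_le_compat_r; [apply Rlt_le, Rinv_0_lt_compat; lra|].
  replace (f (y + h + z) - f (y + h) - (f (y + z) - f y)) with
    ((f (y + z + h) - f (y + z)) - (f (y + h) - f y)).
  2: { replace (y + z + h) with (y + h + z) by ring. ring. }
  eapply Rle_trans; [apply Cmod_triangle_minus|]. apply Rplus_le_compat.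
  - apply (lipschitz_half f a r M); [assumption..|apply near; assumption|].
    replace (y + z + h) with (y + h + z) by ring. apply near; assumption.
  - apply (lipschitz_half f a r M); try assumption; lra.
Qed.

(** The constant depends only on the bound and the radius.  This uniformity
    replaces differentiation under the integral sign and interchange of limits
    in later arguments. *)
Lemma quadratic_bound (f : C -> C) (a : C) (r M : R) (y h : C) :
  (0 < r) -> holo_disc f a r -> (forall z, (Cmod (z - a) <= r) -> (Cmod (f z) <= M)) ->
 
  (Cmod (y - a) <= r / 4) -> (Cmod (y + h - a) <= r / 4) ->
  (Cmod (f (y + h)%C - f y - h * C_derive f y) <= 32 * M / (r * r) * Cmod h * Cmod h).
Proof.
  intros HR Hf HM Hy Hyh.
  replace (f (y + h) - f y - h * C_derive f y) with
    ((f (y + h) - C_derive f y * (y + h)) - (f y - C_derive f y * y)) by ring.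
  apply (segment_bound (fun x => f x - C_derive f y * x)
    (fun x => C_derive f x - C_derive f y)).
  - intros s Hs. eapply cderiv_val.
    2: { apply cderiv_minus; [|apply cderiv_scal, cderiv_id].
         apply holo_at_cderiv, Hf.
         eapply Rle_trans; [apply (disc_convex a y h (r / 4)); assumption|lra]. }
    ring.
  - intros s Hs.
    eapply Rle_trans; [apply (deriv_lipschitz_quarter f a r M); [assumption..|exact Hy|apply disc_convex; assumption]|].
    rewrite Cmod_mult, Cmod_R, Rabs_pos_eq by lra.
    assert (h0 := Cmod_ge_0 h).
    assert (hM : (0 <= M)).
    { eapply Rle_trans; [apply (Cmod_ge_0 (f a))|apply HM]. rewrite Cmod_self. lra. }
    apply Rmult_le_compat_l; [|nra].
    apply Rdiv_le_0_compat; [lra|nra].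
Qed.

(** The candidate for the second derivative is given by the Cauchy formula
    for the first one; the error is the mean of a quadratic remainder. *)
Theorem holo_derive (f : C -> C) (a : C) (r : R) : (0 < r) -> holo_disc f a r ->
  holo_at (C_derive f) a.
Proof.
  intros Hr Hf. destruct (holo_disc_bounded f a r Hf) as [M [HM0 HM]].
  set (Kq := (32 * M / (r * r))%R).
  assert (HKq : (0 <= Kq)).
  { unfold Kq. apply Rdiv_le_0_compat; [lra|nra]. }
  set (D := circle_mean (fun z => (C_derive f (a + z) - C_derive f a) / z) 0 (r / 8)).
  exists D. apply cderiv_iff. intros eps He.
  set (Kd := (2 * Kq / (r / 8))%R).
  assert (HKd : (0 <= Kd)).
  { unfold Kd. apply Rdiv_le_0_compat; [lra|lra]. }
  exists (Rmin (r / 8) (eps / (Kd + 1))). split.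
  { apply Rmin_glb_lt; [lra|]. apply Rdiv_lt_0_compat; lra. }
  intros h Hh. Rmin_bounds.
  assert (h0 := Cmod_ge_0 h).
  assert (Ha : (Cmod (a - a) <= r / 4)) by (rewrite Cmod_self; lra).
  assert (Hah : (Cmod (a + h - a) <= r / 8)) by (replace (a + h - a) with h by ring; lra).
  assert (circ : forall z, Cmod (z - 0) = (r / 8)%R ->
    (Cmod z = r / 8)%R /\ z <> 0 /\ (Cmod (a + z - a) <= r / 8) /\ (Cmod (a + h + z - a) <= r / 4)).
  { intros z Hz. assert (Hz' : Cmod z = (r / 8)%R) by (rewrite <- Hz; f_equal; ring).
    split; [exact Hz'|]. split; [apply (circle_neq 0 z (r / 8)); [lra|exact Hz]|].
    replace (a + z - a) with z by ring. split; [lra|].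
    replace (a + h + z - a) with (h + z) by ring. assert (T := Cmod_triangle h z). lra. }
  assert (dcont : forall z, (Cmod (z - a) <= r / 8) -> ccont (C_derive f) z).
  { intros z Hz e' He'. exists (Rmin (r / 8) (e' / (Kq + 1))). split.
    { apply Rmin_glb_lt; [lra|]. apply Rdiv_lt_0_compat; lra. }
    intros y Hy. Rmin_bounds.
    replace y with (z + (y - z)) by ring.
    eapply Rle_lt_trans; [apply (deriv_lipschitz_quarter f a r M z (y - z) Hr Hf HM)|].
    - lra.
    - rewrite Cplus_minus_cancel. assert (T := Cmod_dist_triangle y z a). lra.
    - fold Kq. assert (hy := Cmod_ge_0 (y - z)).
      replace e' with ((Kq + 1) * (e' / (Kq + 1)))%R by (field; lra).
      apply Rle_lt_trans with ((Kq + 1) * Cmod (y - z))%R; [nra|].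
      apply Rmult_lt_compat_l; lra. }
  assert (holo1 : forall b, (Cmod (b - a) <= r / 8) -> holo_disc f b (r / 8)).
  { intros b Hb z Hz. apply Hf. eapply disc_sub; [exact Hz|lra]. }
  rewrite (cauchy_formula_0 f (a + h) (r / 8)); [|lra|apply holo1; exact Hah].
  rewrite (cauchy_formula_0 f a (r / 8)); [|lra|apply holo1; rewrite Cmod_self; lra].
  assert (hol : forall b z, (Cmod (b - a) <= r / 8) -> Cmod (z - 0) = (r / 8)%R -> holo_at f (b + z)).
  { intros b z Hb Hz. apply (holo1 b Hb). replace (b + z - b) with (z - 0) by ring. lra. }
  assert (c1 : forall b, (Cmod (b - a) <= r / 8) ->
    ccont_circle (fun z => (f (b + z) - f b) / z) 0 (r / 8)).
  { intros b Hb. apply (ccont_quot_0 (fun z => f (b + z) - f b)); [lra|].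
    intros z Hz. eapply cderiv_ccont, cderiv_minus; [|apply cderiv_const].
    apply cderiv_affine_shift, hol; assumption. }
  assert (c2 : ccont_circle (fun z => (C_derive f (a + z) - C_derive f a) / z) 0 (r / 8)).
  { apply (ccont_quot_0 (fun z => C_derive f (a + z) - C_derive f a)); [lra|].
    intros z Hz. destruct (circ z Hz) as (_ & _ & q & _).
    apply ccont_minus; [|apply ccont_const].
    apply (ccont_comp (C_derive f) (fun z => a + z)); [apply dcont, q|].
    eapply cderiv_ccont, cderiv_plus; [apply cderiv_const|apply cderiv_id]. }
  assert (Haa : (Cmod (a - a) <= r / 8)) by (rewrite Cmod_self; lra).
  assert (c3 : ccont_circle (fun z => h * ((C_derive f (a + z) - C_derive f a) / z)) 0 (r / 8))
    by (intros z Hz; apply ccont_mult; [apply ccont_const|apply c2, Hz]).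
  assert (c4 : ccont_circle (fun z => (f (a + h + z) - f (a + h)) / z - (f (a + z) - f a) / z) 0 (r / 8))
    by (intros z Hz; apply ccont_minus; apply c1; assumption).
  unfold D. rewrite <- circle_mean_scal; [|lra|exact c2].
  rewrite <- circle_mean_minus; [|lra|apply c1, Hah|apply c1, Haa].
  rewrite <- circle_mean_minus; [|lra|exact c4|exact c3].
  apply Rle_trans with (Kd * Cmod h * Cmod h)%R.
  - apply circle_mean_bound; [lra| |].
    + intros z Hz. apply ccont_minus; [apply c4, Hz|apply c3, Hz].
    + intros z Hz. destruct (circ z Hz) as (q1 & q2 & q3 & q4).
      replace ((f (a + h + z) - f (a + h)) / z - (f (a + z) - f a) / z
         - h * ((C_derive f (a + z) - C_derive f a) / z)) with
        (((f (a + z + h) - f (a + z) - h * C_derive f (a + z))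
          - (f (a + h) - f a - h * C_derive f a)) / z).
      2: { replace (a + z + h) with (a + h + z) by ring. unfold Cdiv. ring. }
      rewrite Cmod_div by exact q2. rewrite q1.
      replace (Kd * Cmod h * Cmod h)%R with
        ((Kq * Cmod h * Cmod h + Kq * Cmod h * Cmod h) / (r / 8))%R by (unfold Kd; field; lra).
      apply Rmult_le_compat_r; [apply Rlt_le, Rinv_0_lt_compat; lra|].
      eapply Rle_trans; [apply Cmod_triangle_minus|].
      apply Rplus_le_compat; apply (quadratic_bound f a r M _ _ Hr Hf HM); try lra.
      replace (a + z + h) with (a + h + z) by ring. exact q4.
  - apply Rmult_le_compat_r; [exact h0|].
    apply Rmult_div_succ_le; lra.
Qed.

(** * Divided differences and the maximum principle *)

Lemma holo_disc_derive (f : C -> C) (a : C) (r s : R) : (s < r) ->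
  holo_disc f a r -> holo_disc (C_derive f) a s.
Proof.
  intros Hs Hf z Hz. apply (holo_derive f z (r - s)); [lra|].
  intros y Hy. apply Hf. eapply disc_sub; [exact Hy|lra].
Qed.

Lemma entire1_derive (f : C -> C) : entire1 f -> entire1 (C_derive f).
Proof. intros Hf z. apply (holo_derive f z 1); [lra|]. intros y _. apply Hf. Qed.

(** Since the derivative of [f] is differentiable at [a], the mean value
    inequality gives a Taylor expansion of [f] to second order, that is, an
    expansion of the difference quotient to first order. *)
Lemma dquot_holo_at (f : C -> C) (a : C) (r : R) : (0 < r) -> holo_disc f a r ->
  holo_at (dquot f a) a.
Proof.
  intros Hr Hf. assert (H2 := holo_at_cderiv _ _ (holo_derive f a r Hr Hf)).
  set (f1 := C_derive f a) in *. set (f2 := C_derive (C_derive f) a) in *.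
  exists (f2 / 2). apply cderiv_iff. intros eps He.
  destruct (proj1 (cderiv_iff _ _ _) H2 eps He) as [d [Hd H]].
  exists (Rmin d r). split; [apply Rmin_glb_lt; assumption|].
  intros h Hh. Rmin_bounds.
  assert (hp := Cmod_ge_0 h).
  destruct (classic (h = 0)) as [->|Hh0].
  { replace (a + 0) with a by ring.
    replace (dquot f a a - dquot f a a - 0 * (f2 / 2)) with (RtoC 0) by ring. rewrite Cmod_0. lra. }
  assert (Hne : a + h <> a) by (intros K; apply Hh0; replace h with (a + h - a) by ring; rewrite K; ring).
  rewrite dquot_at, dquot_off by exact Hne. fold f1.
  replace (a + h - a) with h by ring.
  replace ((f (a + h) - f a) / h - f1 - h * (f2 / 2)) with
    ((f (a + h) - f a - h * f1 - h * h * (f2 / 2)) / h) by (field; exact Hh0).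
  assert (hp' := proj1 (Cmod_gt_0 h) Hh0).
  rewrite Cmod_div by exact Hh0. apply Rmult_le_reg_r with (Cmod h); [exact hp'|].
  unfold Rdiv. rewrite Rmult_assoc, Rinv_l, Rmult_1_r by lra.
  (* The derivative of the second order Taylor remainder is small of first order. *)
  assert (S := segment_bound (fun y => f y - (y - a) * f1 - (y - a) * (y - a) * (f2 / 2))
    (fun y => C_derive f y - f1 - (y - a) * f2) a h (eps * Cmod h)).
  cbv beta in S. replace (a + h - a) with h in S by ring. replace (a - a) with (RtoC 0) in S by ring.
  replace (f (a + h) - f a - h * f1 - h * h * (f2 / 2)) with
    (f (a + h) - h * f1 - h * h * (f2 / 2) - (f a - 0 * f1 - 0 * 0 * (f2 / 2))) by ring.
  apply S.
  - intros s Hs. set (y := a + RtoC s * h).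
    assert (Hy : holo_at f y).
    { apply Hf. unfold y. replace (a + RtoC s * h - a) with (RtoC s * h) by ring.
      rewrite Cmod_mult, Cmod_R, Rabs_pos_eq by lra. nra. }
    assert (D1 := cderiv_sub_const a y).
    assert (D2 := cderiv_mult _ _ y _ _ D1 D1).
    assert (D3 := cderiv_mult _ _ y _ _ D1 (cderiv_const f1 y)).
    assert (D4 := cderiv_mult _ _ y _ _ D2 (cderiv_const (f2 / 2) y)).
    assert (D5 := cderiv_minus _ _ y _ _ (cderiv_minus _ _ y _ _ (holo_at_cderiv f y Hy) D3) D4).
    refine (cderiv_val _ _ _ _ _ D5). field.
  - intros s Hs.
    assert (Hsm : (Cmod (RtoC s * h) <= Cmod h))
      by (rewrite Cmod_mult, Cmod_R, Rabs_pos_eq by lra; nra).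
    replace (a + RtoC s * h - a) with (RtoC s * h) by ring.
    eapply Rle_trans; [apply H; lra|]. apply Rmult_le_compat_l; lra.
Qed.

Lemma dquot_entire (f : C -> C) (a : C) : entire1 f -> entire1 (dquot f a).
Proof.
  intros Hf z. destruct (classic (z = a)) as [->|Hza].
  - apply (dquot_holo_at f a 1); [lra|]. intros y _. apply Hf.
  - apply dquot_holo_off; [exact Hza|apply Hf].
Qed.

(** For [z] off the centre, the value at [z] is the central value of the
    composition with the automorphism of the disc that takes the centre to [z];
    it preserves the boundary circle. *)
Lemma max_principle (f : C -> C) (a z : C) (r M : R) : entire1 f ->
  (forall y, Cmod (y - a) = r -> (Cmod (f y) <= M)) ->
  (Cmod (z - a) < r) -> (Cmod (f z) <= M).
Proof.
  intros Hf HM Hz. set (b := z - a) in *.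
  assert (hb := Cmod_ge_0 b). assert (Hr : (0 < r)) by lra.
  assert (Hrc : RtoC r <> 0) by (intros K; apply RtoC_inj in K; lra).
  pose (den := fun y => RtoC r * RtoC r + Cconj b * y).
  pose (phi := fun y => a + RtoC r * RtoC r * (y + b) / den y).
  assert (Hden : forall y, (Cmod y <= r) -> den y <> 0).
  { intros y Hy K.
    assert (E : RtoC r * RtoC r = - (Cconj b * y)).
    { unfold den in K. replace (RtoC r * RtoC r) with (RtoC r * RtoC r + Cconj b * y - Cconj b * y) by ring.
      rewrite K. ring. }
    apply (f_equal Cmod) in E. rewrite Cmod_opp, !Cmod_mult, Cmod_conj, Cmod_R, Rabs_pos_eq in E by lra.
    assert (hy := Cmod_ge_0 y). nra. }
  assert (Hphi : forall y, (Cmod y <= r) -> holo_at phi y).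
  { intros y Hy.
    assert (D1 : cderiv (fun y => y + b) y (1 + 0))
      by (apply cderiv_plus; [apply cderiv_id|apply cderiv_const]).
    assert (D2 := cderiv_scal _ y _ (RtoC r * RtoC r) D1).
    assert (D3 := cderiv_plus _ _ y _ _ (cderiv_const (RtoC r * RtoC r) y)
                    (cderiv_scal _ y _ (Cconj b) (cderiv_id y))).
    assert (D4 := cderiv_div _ _ y _ _ (Hden y Hy) D2 D3).
    eexists. apply (cderiv_plus (fun _ => a)); [apply cderiv_const|exact D4]. }
  assert (Hholo : forall y, (Cmod y <= r) -> holo_at (fun y => f (phi y)) y).
  { intros y Hy. destruct (Hphi y Hy) as [l Hl]. destruct (Hf (phi y)) as [l' Hl'].
    eexists. apply (cderiv_comp f phi); eassumption. }
  replace z with (phi 0).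
  2: { unfold phi, den, b. field. exact Hrc. }
  rewrite <- (mean_value_property (fun y => f (phi y)) 0 r Hr).
  - apply circle_mean_bound; [lra| |].
    + intros y Hy. apply holo_at_ccont, Hholo. replace y with (y - 0) by ring. lra.
    + intros y Hy. replace (y - 0) with y in Hy by ring. apply HM.
      unfold phi. replace (a + RtoC r * RtoC r * (y + b) / den y - a) with
        (RtoC r * RtoC r * (y + b) / den y) by ring.
      assert (Hd := Hden y ltac:(lra)).
      (* on the circle [r * r = y * Cconj y] *)
      assert (E : den y = y * Cconj (y + b)).
      { unfold den. rewrite <- RtoC_mult. replace (r * r)%R with (Cmod y ^ 2)%R by (rewrite Hy; ring).
        rewrite Cmod2_conj.
        replace (Cconj (y + b)) with (Cconj y + Cconj b); [ring|].
        destruct y, b; unfold Cconj, Cplus; simpl; f_equal; ring. }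
      rewrite Cmod_div by exact Hd. rewrite E, !Cmod_mult, Cmod_conj, Cmod_R, Hy, Rabs_pos_eq by lra.
      assert (Hyb : (0 < Cmod (y + b))).
      { apply Cmod_gt_0. intros K. apply Hd. rewrite E, K.
        unfold Cconj, RtoC, Cmult; simpl. destruct y; f_equal; simpl; ring. }
      field. lra.
  - intros y _ Hy. apply Hholo. replace y with (y - 0) by ring. exact Hy.
  - apply holo_at_ccont, Hholo. rewrite Cmod_0. lra.
Qed.

(** * Taylor expansion *)

Definition derive_iter (n : nat) (f : C -> C) : C -> C := Nat.iter n C_derive f.

Lemma derive_iter_S (n : nat) (f : C -> C) :
  derive_iter (S n) f = derive_iter n (C_derive f).
Proof. apply Nat.iter_succ_r. Qed.

Lemma entire1_iter (n : nat) (f : C -> C) : entire1 f -> entire1 (derive_iter n f).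
Proof. intros Hf. induction n as [|n IH]; [exact Hf|]. apply entire1_derive, IH. Qed.

Lemma holo_disc_iter (n : nat) (f : C -> C) (a : C) (r s : R) : (s < r) ->
  holo_disc f a r -> holo_disc (derive_iter n f) a s.
Proof.
  revert s. induction n as [|n IH]; intros s Hs Hf.
  - intros z Hz. apply Hf. lra.
  - apply (holo_disc_derive _ a ((s + r) / 2)); [lra|]. apply IH; [lra|exact Hf].
Qed.

(** Each derivative is estimated on a disc whose radius is smaller by [d]. *)
Lemma iter_bound (f : C -> C) (a : C) (r M d : R) : (0 < d) -> holo_disc f a r ->
  (forall z, (Cmod (z - a) <= r) -> (Cmod (f z) <= M)) ->
  forall k z, (Cmod (z - a) <= r - INR k * d) ->
    (Cmod (derive_iter k f z) <= M * (2 / d) ^ k).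
Proof.
  intros Hd Hf HM. induction k as [|k IH]; intros z Hz.
  - simpl. rewrite Rmult_1_r. apply HM. simpl in Hz. lra.
  - rewrite S_INR in Hz. change (derive_iter (S k) f z) with (C_derive (derive_iter k f) z).
    replace (M * (2 / d) ^ S k)%R with (2 * (M * (2 / d) ^ k) / d)%R by (simpl; field; lra).
    apply cauchy_estimate; [exact Hd| |].
    + destruct k as [|k].
      * intros y Hy. apply Hf. eapply disc_sub; [exact Hy|]. simpl in Hz. lra.
      * intros y Hy. apply (holo_disc_iter (S k) f a r (r - INR (S k) * d)).
        -- assert (h := lt_0_INR (S k) ltac:(lia)). nra.
        -- exact Hf.
        -- eapply disc_sub; [exact Hy|lra].
    + intros y Hy. apply IH. eapply disc_sub; [exact Hy|lra].
Qed.

Fixpoint taylor (n : nat) (f : C -> C) (a z : C) : C :=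
  match n with
  | O => 0
  | S m => taylor m f a z + derive_iter m f a / RtoC (INR (fact m)) * (z - a) ^ m
  end.

Lemma fact_C_neq_0 (n : nat) : RtoC (INR (fact n)) <> 0.
Proof. intros K. apply RtoC_inj in K. exact (INR_fact_neq_0 n K). Qed.

Lemma cderiv_pow (a z : C) (n : nat) :
  cderiv (fun y => (y - a) ^ S n) z (RtoC (INR (S n)) * (z - a) ^ n).
Proof.
  assert (D1 := cderiv_sub_const a z).
  induction n as [|n IH].
  - eapply cderiv_ext; [|refine (cderiv_val _ _ _ _ _ D1)].
    + intros y. simpl. ring.
    + simpl. ring.
  - assert (D2 := cderiv_mult _ _ z _ _ D1 IH). refine (cderiv_val _ _ _ _ _ D2).
    rewrite (S_INR (S n)), RtoC_plus. change ((z - a) ^ S n) with ((z - a) * (z - a) ^ n). ring.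
Qed.

Lemma cderiv_taylor (n : nat) (f : C -> C) (a z : C) :
  cderiv (taylor (S n) f a) z (taylor n (C_derive f) a z).
Proof.
  induction n as [|n IH].
  - apply (cderiv_ext (fun _ => f a)); [|apply cderiv_const].
    intros y. simpl. field.
  - assert (D := cderiv_plus _ _ z _ _ IH
      (cderiv_scal _ z _ (derive_iter (S n) f a / RtoC (INR (fact (S n)))) (cderiv_pow a z n))).
    refine (cderiv_val _ _ _ _ _ D). simpl taylor. rewrite derive_iter_S. f_equal.
    replace (INR (fact (S n))) with (INR (S n) * INR (fact n))%R
      by (rewrite <- mult_INR; reflexivity).
    rewrite RtoC_mult. field. split; [apply fact_C_neq_0|].
    intros K. apply RtoC_inj in K. revert K. apply not_0_INR. lia.
Qed.

Lemma taylor_at (n : nat) (f : C -> C) (a : C) : taylor (S n) f a a = f a.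
Proof.
  induction n as [|n IH].
  - simpl. field.
  - change (taylor (S (S n)) f a a) with
      (taylor (S n) f a a + derive_iter (S n) f a / RtoC (INR (fact (S n))) * ((a - a) * (a - a) ^ n)).
    rewrite IH. ring.
Qed.

(** The derivative of the remainder of [f] of order [n + 1] is the remainder of
    order [n] of the derivative of [f]. *)
Lemma taylor_bound (n : nat) (r B : R) (a : C) : forall (f : C -> C) (z : C) (s : R),
  (r < s) -> holo_disc f a s -> (Cmod (z - a) <= r) ->
  (forall y, (Cmod (y - a) <= r) -> (Cmod (derive_iter n f y) <= B)) ->
  (Cmod (f z - taylor n f a z) <= B * (Cmod (z - a) ^ n / INR (fact n))).
Proof.
  induction n as [|n IH]; intros f z s Hrs Hf Hz HB.
  - simpl. replace (f z - 0) with (f z) by ring. replace (1 / 1)%R with 1%R by field.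
    rewrite Rmult_1_r. apply HB, Hz.
  - assert (Hn := INR_fact_neq_0 n).
    assert (HSn : INR (S n) <> 0%R) by (apply not_0_INR; lia).
    set (h := z - a) in *.
    assert (S1 := segment_bound_pow (fun y => f y - taylor (S n) f a y)
      (fun y => C_derive f y - taylor n (C_derive f) a y) a h (B / INR (fact n)) n).
    cbv beta in S1. replace (a + h) with z in S1 by (unfold h; ring).
    rewrite taylor_at in S1.
    replace (f z - taylor (S n) f a z - (f a - f a)) with (f z - taylor (S n) f a z) in S1 by ring.
    replace (B * (Cmod h ^ S n / INR (fact (S n))))%R with
      (B / INR (fact n) * Cmod h ^ S n / INR (S n))%R.
    2: { change (fact (S n)) with (S n * fact n)%nat. rewrite mult_INR. field. auto. }
    assert (pt : forall u, (0 <= u <= 1) -> (Cmod (a + RtoC u * h - a) = u * Cmod h)%R).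
    { intros u Hu. replace (a + RtoC u * h - a) with (RtoC u * h) by ring.
      rewrite Cmod_mult, Cmod_R, Rabs_pos_eq by lra. reflexivity. }
    assert (hh := Cmod_ge_0 h).
    apply S1.
    + intros u Hu. apply cderiv_minus; [|apply cderiv_taylor].
      apply holo_at_cderiv, Hf. rewrite pt by exact Hu. nra.
    + intros u Hu. rewrite <- (pt u Hu).
      replace (B / INR (fact n) * Cmod (a + RtoC u * h - a) ^ n)%R with
        (B * (Cmod (a + RtoC u * h - a) ^ n / INR (fact n)))%R by (field; auto).
      apply (IH (C_derive f) _ ((r + s) / 2)%R); [lra| | |].
      * apply (holo_disc_derive f a s); [lra|exact Hf].
      * rewrite pt by exact Hu. nra.
      * intros y Hy. rewrite <- derive_iter_S. apply HB, Hy.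
Qed.

(** The induction step is [(1 + 1 / m) ^ m <= exp 1 <= 3]. *)
Lemma pow_self_le_fact (n : nat) : (INR n ^ n <= 3 ^ n * INR (fact n)).
Proof.
  induction n as [|n IH]; [simpl; lra|].
  destruct n as [|n]; [simpl; lra|].
  set (m := S n) in *.
  assert (Hm : (0 < INR m)) by (apply lt_0_INR; unfold m; lia).
  change (fact (S m)) with (S m * fact m)%nat. rewrite mult_INR, S_INR.
  assert (K : ((INR m + 1) ^ m <= 3 * INR m ^ m)).
  { replace (INR m + 1)%R with ((1 + / INR m) * INR m)%R by (field; lra).
    rewrite Rpow_mult_distr. apply Rmult_le_compat_r; [apply pow_le; lra|].
    apply Rle_trans with (exp (/ INR m) ^ m)%R.
    - apply pow_incr. assert (Hi := Rinv_0_lt_compat _ Hm). split; [lra|]. apply Rlt_le, exp_ineq1. lra.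
    - rewrite <- Rpower_pow by apply exp_pos.
      unfold Rpower. rewrite ln_exp. replace (INR m * / INR m)%R with 1%R by (field; lra).
      apply exp_le_3. }
  change ((INR m + 1) ^ S m)%R with ((INR m + 1) * (INR m + 1) ^ m)%R.
  change (3 ^ S m)%R with (3 * 3 ^ m)%R. assert (P : (0 <= INR m + 1)) by lra.
  apply Rle_trans with ((INR m + 1) * (3 * INR m ^ m))%R.
  - apply Rmult_le_compat_l; assumption.
  - replace (3 * 3 ^ m * ((INR m + 1) * INR (fact m)))%R with
      ((INR m + 1) * (3 * (3 ^ m * INR (fact m))))%R by ring.
    apply Rmult_le_compat_l; [exact P|]. lra.
Qed.

Lemma exp_partial_sum (x : R) (n : nat) : (0 <= x) ->
  (sum_f_R0 (fun k => / INR (fact k) * x ^ k) n <= exp x)%R.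
Proof.
  intros Hx. apply sum_incr.
  - unfold exp. destruct (exist_exp x) as [l Hl]. simpl. exact Hl.
  - intros k. apply Rmult_le_pos.
    + apply Rlt_le, Rinv_0_lt_compat, INR_fact_lt_0.
    + apply pow_le, Hx.
Qed.

Lemma taylor_exp_bound (f : C -> C) (a z : C) (B q : R) (n : nat) : (0 <= B) -> (0 <= q) ->
  (forall k, (Cmod (derive_iter k f a) <= B * q ^ k)) ->
  (Cmod (taylor n f a z) <= B * exp (q * Cmod (z - a))).
Proof.
  intros HB Hq H. set (x := (q * Cmod (z - a))%R).
  assert (Hx : (0 <= x)) by (apply Rmult_le_pos; [exact Hq|apply Cmod_ge_0]).
  assert (K : forall m, (Cmod (taylor (S m) f a z)
     <= B * sum_f_R0 (fun k => / INR (fact k) * x ^ k) m)%R).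
  { assert (term : forall m, (Cmod (derive_iter m f a / RtoC (INR (fact m)) * (z - a) ^ m)
       <= B * (/ INR (fact m) * x ^ m))).
    { intros m. rewrite Cmod_mult, Cmod_div, Cmod_pow, Cmod_R by apply fact_C_neq_0.
      rewrite Rabs_pos_eq by (apply Rlt_le, INR_fact_lt_0). unfold x. rewrite Rpow_mult_distr.
      replace (B * (/ INR (fact m) * (q ^ m * Cmod (z - a) ^ m)))%R with
        (B * q ^ m / INR (fact m) * Cmod (z - a) ^ m)%R by (unfold Rdiv; ring).
      apply Rmult_le_compat_r; [apply pow_le, Cmod_ge_0|].
      apply Rmult_le_compat_r; [apply Rlt_le, Rinv_0_lt_compat, INR_fact_lt_0|apply H]. }
    induction m as [|m IH].
    - replace (taylor 1 f a z) with (derive_iter 0 f a / RtoC (INR (fact 0)) * (z - a) ^ 0)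
        by (simpl; ring). apply term.
    - simpl sum_f_R0. rewrite Rmult_plus_distr_l.
      eapply Rle_trans; [apply Cmod_triangle|]. apply Rplus_le_compat; [exact IH|apply term]. }
  destruct n as [|n].
  - simpl. rewrite Cmod_0. apply Rmult_le_pos; [exact HB|apply Rlt_le, exp_pos].
  - eapply Rle_trans; [apply K|]. apply Rmult_le_compat_l; [exact HB|]. apply exp_partial_sum, Hx.
Qed.

(** The Taylor series converges on the disc of radius [r] because the [n]-th
    derivative is bounded there by [n] Cauchy steps of size [12 * r / n]; the
    factor [13] is what makes the resulting geometric ratio [1 / 2]. *)
Lemma holo_exp_bound (f : C -> C) (a z : C) (r B q : R) : (0 < r) ->
  holo_disc f a (13 * r) -> (0 <= B) -> (0 <= q) ->
  (forall k, (Cmod (derive_iter k f a) <= B * q ^ k)) ->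
  (Cmod (z - a) <= r) -> (Cmod (f z) <= B * exp (q * Cmod (z - a))).
Proof.
  intros Hr Hf HB Hq H Hz.
  destruct (holo_disc_bounded f a _ Hf) as [M [HM0 HM]].
  set (x := (B * exp (q * Cmod (z - a)))%R).
  apply le_epsilon. intros eps He.
  destruct (pow_lt_1_zero (/ 2)) with (y := (eps / (M + 1))%R) as [N HN].
  { rewrite Rabs_pos_eq; lra. } { apply Rdiv_lt_0_compat; lra. }
  specialize (HN (S N) ltac:(lia)). set (n := S N) in *.
  rewrite Rabs_pos_eq in HN by (apply pow_le; lra).
  assert (Hn : (0 < INR n)) by (apply lt_0_INR; unfold n; lia).
  assert (HB' : forall y, (Cmod (y - a) <= r) ->
    (Cmod (derive_iter n f y) <= M * (2 / (12 * r / INR n)) ^ n)).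
  { intros y Hy. apply (iter_bound f a (13 * r)); try assumption.
    - apply Rdiv_lt_0_compat; lra.
    - replace (13 * r - INR n * (12 * r / INR n))%R with r by (field; lra). exact Hy. }
  assert (T := taylor_bound n r _ a f z (13 * r) ltac:(lra) Hf Hz HB').
  assert (E := taylor_exp_bound f a z B q n HB Hq H). fold x in E.
  assert (R1 : (M * (2 / (12 * r / INR n)) ^ n * (Cmod (z - a) ^ n / INR (fact n))
     <= M * (/ 2) ^ n)).
  { rewrite Rmult_assoc. apply Rmult_le_compat_l; [exact HM0|].
    assert (hf := INR_fact_lt_0 n).
    apply Rle_trans with ((2 / (12 * r / INR n)) ^ n * (r ^ n / INR (fact n)))%R.
    - apply Rmult_le_compat_l.
      + apply pow_le. apply Rlt_le. repeat apply Rdiv_lt_0_compat; lra.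
      + apply Rmult_le_compat_r; [apply Rlt_le, Rinv_0_lt_compat, hf|].
        apply pow_incr. split; [apply Cmod_ge_0|exact Hz].
    - unfold Rdiv at 3. rewrite <- Rmult_assoc, <- Rpow_mult_distr.
      replace (2 / (12 * r / INR n) * r)%R with (/ 6 * INR n)%R by (field; lra).
      rewrite Rpow_mult_distr. apply Rmult_le_reg_r with (INR (fact n)); [exact hf|].
      rewrite Rmult_assoc, Rinv_l, Rmult_1_r by lra.
      apply Rle_trans with ((/ 6) ^ n * (3 ^ n * INR (fact n)))%R.
      + apply Rmult_le_compat_l; [apply pow_le; lra|apply pow_self_le_fact].
      + rewrite <- Rmult_assoc, <- Rpow_mult_distr. replace (/ 6 * 3)%R with (/ 2)%R by field. lra. }
  assert (R2 : (M * (/ 2) ^ n <= eps)).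
  { assert (hp : (0 < (/ 2) ^ n)) by (apply pow_lt; lra).
    apply Rmult_div_succ_le; lra. }
  assert (T2 := Cmod_minus_le (f z) (taylor n f a z)). lra.
Qed.

Lemma entire1_exp_bound (f : C -> C) (a z : C) (B q : R) : entire1 f -> (0 <= B) -> (0 <= q) ->
  (forall k, (Cmod (derive_iter k f a) <= B * q ^ k)) ->
  (Cmod (f z) <= B * exp (q * Cmod (z - a))).
Proof.
  intros Hf HB Hq H. assert (h := Cmod_ge_0 (z - a)).
  apply (holo_exp_bound f a z (Cmod (z - a) + 1)); try assumption; try lra.
  intros y _. apply Hf.
Qed.

Lemma holo_zero_derivatives (f : C -> C) (a z : C) (r : R) : (0 < r) ->
  holo_disc f a (13 * r) -> (forall k, derive_iter k f a = 0) ->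
  (Cmod (z - a) <= r) -> f z = 0.
Proof.
  intros Hr Hf H Hz. apply Cmod_eq_0, Rle_antisym; [|apply Cmod_ge_0].
  replace 0%R with (0 * exp (0 * Cmod (z - a)))%R by ring.
  apply (holo_exp_bound f a z r); try assumption; try lra.
  intros k. rewrite H, Cmod_0. lra.
Qed.

(** Near [a], the first nonvanishing Taylor term dominates the remainder. *)
Lemma zeros_isolated (f : C -> C) (a : C) (r : R) : (0 < r) -> holo_disc f a r ->
  (exists k, derive_iter k f a <> 0) ->
  exists d : R, (0 < d) /\ forall z, z <> a -> (Cmod (z - a) < d) -> f z <> 0.
Proof.
  intros Hr Hf Hex.
  assert (Hleast : exists n, derive_iter n f a <> 0 /\ forall k, (k < n)%nat -> derive_iter k f a = 0).
  { destruct Hex as [k Hk]. revert Hk. induction k as [k IH] using lt_wf_ind. intros Hk.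
    destruct (classic (exists j, (j < k)%nat /\ derive_iter j f a <> 0)) as [(j & Hj & Hj')|N].
    - exact (IH j Hj Hj').
    - exists k. split; [exact Hk|]. intros j Hj. apply NNPP. intros K. apply N. exists j. auto. }
  destruct Hleast as [n [Hn Hlt]]. clear Hex.
  assert (T0 : forall z m, (m <= n)%nat -> taylor m f a z = 0).
  { intros z. induction m as [|m IH]; intros Hm; [reflexivity|]. simpl.
    rewrite IH, Hlt by lia. unfold Cdiv. ring. }
  set (c := derive_iter n f a / RtoC (INR (fact n))).
  assert (Hc : c <> 0).
  { unfold c. intros K. apply Hn.
    replace (derive_iter n f a) with (derive_iter n f a / RtoC (INR (fact n)) * RtoC (INR (fact n)))
      by (field; apply fact_C_neq_0). rewrite K. ring. }
  assert (Hcm := proj1 (Cmod_gt_0 c) Hc).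
  assert (Hfn : holo_disc (derive_iter (S n) f) a (r / 2)) by (apply (holo_disc_iter _ f a r); [lra|exact Hf]).
  destruct (holo_disc_bounded _ a _ Hfn) as [B [HB0 HB]].
  exists (Rmin (r / 2) (Cmod c / (B + 1))). split.
  { apply Rmin_glb_lt; [lra|]. apply Rdiv_lt_0_compat; lra. }
  intros z Hza Hz Hfz.
  Rmin_bounds.
  assert (T := taylor_bound (S n) (r / 2) B a f z r ltac:(lra) Hf ltac:(lra) HB).
  change (taylor (S n) f a z) with (taylor n f a z + c * (z - a) ^ n) in T.
  rewrite T0, Hfz in T by lia.
  replace (0 - (0 + c * (z - a) ^ n)) with (- (c * (z - a) ^ n)) in T by ring.
  rewrite Cmod_opp, Cmod_mult, Cmod_pow in T.
  assert (hp := Cmod_pos_neq z a Hza). set (x := Cmod (z - a)) in *.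
  assert (hx : (0 < x ^ n)) by (apply pow_lt, hp).
  assert (T' : (Cmod c * x ^ n <= (B * x) * x ^ n)).
  { eapply Rle_trans; [exact T|]. simpl pow.
    replace (B * x * x ^ n)%R with (B * (x * x ^ n))%R by ring.
    apply Rmult_le_compat_l; [exact HB0|].
    assert (hf : (1 <= INR (fact (S n)))).
    { change 1%R with (INR 1). apply le_INR. apply lt_O_fact. }
    apply Rmult_le_reg_r with (INR (fact (S n))); [lra|].
    unfold Rdiv. rewrite Rmult_assoc, Rinv_l, Rmult_1_r by (apply INR_fact_neq_0). assert (hxx : (0 < x * x ^ n)) by (apply Rmult_lt_0_compat; assumption).
    rewrite <- (Rmult_1_r (x * x ^ n)) at 1. apply Rmult_le_compat_l; [lra|exact hf]. }
  apply Rmult_le_reg_r in T'; [|exact hx].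
  assert (K : ((B + 1) * x < Cmod c)).
  { replace (Cmod c) with ((B + 1) * (Cmod c / (B + 1)))%R by (field; lra).
    apply Rmult_lt_compat_l; lra. }
  nra.
Qed.

(** * Entire solutions of the heat equation *)

Definition locally_bounded2 (G : C -> C -> C) : Prop :=
  forall t z : C, exists d M : R, (0 < d) /\
    forall t' z' : C, (Cmod (t' - t) <= d) -> (Cmod (z' - z) <= d) ->
      (Cmod (G t' z') <= M).

(** In contrast to joint differentiability, separate holomorphy with local
    boundedness passes to the [z]-derivative by one-variable arguments. *)
Record heat_class (G : C -> C -> C) : Prop := {
  heat_entire_t : forall z, entire1 (fun t => G t z);
  heat_entire_z : forall t, entire1 (G t);
  heat_locally_bounded : locally_bounded2 G;
  heat_eq : heat_equation G }.

Lemma cderiv_quotient_limit (f : C -> C) (z l : C) : cderiv f z l ->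
  forall eps : R, (0 < eps) -> exists d : R, (0 < d) /\
    forall h : C, h <> 0 -> (Cmod h < d) -> (Cmod ((f (z + h)%C - f z) / h - l) <= eps).
Proof.
  intros H eps He. destruct (proj1 (cderiv_iff f z l) H eps He) as [d [Hd H']].
  exists d. split; [exact Hd|]. intros h Hh0 Hh. specialize (H' h Hh).
  assert (hp := proj1 (Cmod_gt_0 h) Hh0).
  replace ((f (z + h) - f z) / h - l) with ((f (z + h) - f z - h * l) / h) by (field; exact Hh0).
  rewrite Cmod_div by exact Hh0. apply Rmult_le_reg_r with (Cmod h); [exact hp|].
  unfold Rdiv. rewrite Rmult_assoc, Rinv_l, Rmult_1_r by lra. exact H'.
Qed.

(** The difference quotients of [G] in [z] satisfy a quadratic Taylor bound in
    [t] which is uniform in the step, so that it passes to the limit; the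
    derivatives in [t] converge by the heat equation. *)
Lemma heat_mixed_derivative (G : C -> C -> C) (t z : C) : heat_class G ->
  cderiv (fun s => C_derive (G s) z) t (C_derive (C_derive (C_derive (G t))) z).
Proof.
  intros [Ht Hz Hb He]. destruct (Hb t z) as (d & M & Hd & HM).
  set (K := (32 * (4 * M / d) / (d * d))%R).
  assert (HM0 : (0 <= M)).
  { eapply Rle_trans; [apply (Cmod_ge_0 (G t z))|]. apply HM; rewrite Cmod_self; lra. }
  assert (HK : (0 <= K)).
  { assert (h1 : (0 <= 4 * M / d)) by (apply Rdiv_le_0_compat; lra).
    unfold K. apply Rdiv_le_0_compat; [lra|nra]. }
  set (G3 := C_derive (C_derive (C_derive (G t))) z).
  assert (quad : forall s, (Cmod s <= d / 4) ->
    (Cmod (C_derive (G (t + s)%C) z - C_derive (G t) z - s * G3) <= K * Cmod s * Cmod s)).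
  { intros s Hs. apply le_epsilon. intros eps Heps.
    assert (hs := Cmod_ge_0 s).
    set (e := (eps / (2 + Cmod s))%R).
    assert (He0 : (0 < e)) by (apply Rdiv_lt_0_compat; lra).
    destruct (cderiv_quotient_limit _ z _ (holo_at_cderiv _ _ (Hz (t + s) z)) e He0) as [d1 [Hd1 H1]].
    destruct (cderiv_quotient_limit _ z _ (holo_at_cderiv _ _ (Hz t z)) e He0) as [d2 [Hd2 H2]].
    destruct (cderiv_quotient_limit _ z _
      (holo_at_cderiv _ _ (entire1_derive _ (entire1_derive _ (Hz t)) z)) e He0) as [d3 [Hd3 H3]].
    fold G3 in H3.
    set (m := Rmin (Rmin d1 d2) (Rmin d3 (d / 2))).
    assert (Hm : (0 < m)) by (repeat apply Rmin_glb_lt; lra).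
    assert (Hm' : (m <= Rmin (Rmin d1 d2) (Rmin d3 (d / 2)))) by (right; reflexivity).
    Rmin_bounds.
    set (h := RtoC (m / 2)).
    assert (Hh : Cmod h = (m / 2)%R) by (unfold h; rewrite Cmod_R; apply Rabs_pos_eq; lra).
    assert (Hh0 : h <> 0) by (apply Cmod_gt_0; lra).
    specialize (H1 h Hh0 ltac:(lra)). specialize (H2 h Hh0 ltac:(lra)). specialize (H3 h Hh0 ltac:(lra)).
    set (q := fun s => (G s (z + h) - G s z) / h).
    assert (qd : forall x, cderiv q x
       ((C_derive (C_derive (G x)) (z + h) - C_derive (C_derive (G x)) z) / h)).
    { intros x. rewrite <- !He.
      assert (D := cderiv_minus _ _ x _ _ (holo_at_cderiv _ _ (Ht (z + h) x)) (holo_at_cderiv _ _ (Ht z x))).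
      refine (cderiv_val _ _ _ _ _ (cderiv_ext _ _ _ _ _ (cderiv_scal _ x _ (/ h) D))).
      - unfold Cdiv. ring.
      - intros y. unfold q, Cdiv. ring. }
    assert (qb : forall x, (Cmod (x - t) <= d) -> (Cmod (q x) <= 4 * M / d)).
    { intros x Hx. unfold q. rewrite Cmod_div by exact Hh0.
      assert (hp : (0 < Cmod h)) by lra.
      apply Rmult_le_reg_r with (Cmod h); [exact hp|].
      unfold Rdiv at 1. rewrite Rmult_assoc, Rinv_l, Rmult_1_r by lra.
      apply (lipschitz_half (G x) z d M).
      - exact Hd.
      - intros y _. apply Hz.
      - intros y Hy. apply HM; assumption.
      - rewrite Cmod_self. lra.
      - replace (z + h - z) with h by ring. lra. }
    assert (Q := quadratic_bound q t d (4 * M / d) t s Hd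
      (fun x _ => cderiv_ex _ _ _ (qd x)) qb ltac:(rewrite Cmod_self; lra)
      ltac:(replace (t + s - t) with s by ring; exact Hs)).
    rewrite (cderiv_C_derive _ _ _ (qd t)) in Q. fold K in Q.
    unfold q in Q at 1 2.
    set (q1 := (G (t + s) (z + h) - G (t + s) z) / h) in *.
    set (q2 := (G t (z + h) - G t z) / h) in *.
    set (q3 := (C_derive (C_derive (G t)) (z + h) - C_derive (C_derive (G t)) z) / h) in *.
    set (g1 := C_derive (G (t + s)) z) in *. set (g2 := C_derive (G t) z) in *.
    replace (g1 - g2 - s * G3) with ((q1 - q2 - s * q3) - ((q1 - g1) - (q2 - g2) - s * (q3 - G3))) by ring.
    eapply Rle_trans; [apply Cmod_triangle_minus|]. apply Rplus_le_compat; [exact Q|].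
    eapply Rle_trans; [apply Cmod_triangle_minus|].
    assert (T := Cmod_triangle_minus (q1 - g1) (q2 - g2)). rewrite Cmod_mult.
    assert (P : (Cmod s * Cmod (q3 - G3) <= Cmod s * e)) by (apply Rmult_le_compat_l; assumption).
    replace eps with ((2 + Cmod s) * e)%R by (unfold e; field; lra). lra. }
  apply cderiv_iff. intros eps Heps.
  exists (Rmin (d / 4) (eps / (K + 1))). split.
  { apply Rmin_glb_lt; [lra|]. apply Rdiv_lt_0_compat; lra. }
  intros s Hs. Rmin_bounds. assert (hs := Cmod_ge_0 s).
  eapply Rle_trans; [apply quad; lra|]. apply Rmult_le_compat_r; [exact hs|].
  apply Rmult_div_succ_le; lra.
Qed.

Lemma heat_class_dz (G : C -> C -> C) : heat_class G -> heat_class (fun t => C_derive (G t)).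
Proof.
  intros HG. split.
  - intros z t. eexists. apply heat_mixed_derivative, HG.
  - intros t. exact (entire1_derive _ (heat_entire_z G HG t)).
  - intros t z. destruct (heat_locally_bounded G HG t z) as (d & M & Hd & HM).
    exists (d / 2)%R, (2 * M / (d / 2))%R. split; [lra|]. intros t' z' Ht' Hz'.
    apply cauchy_estimate; [lra| |].
    + intros y _. apply (heat_entire_z G HG).
    + intros y Hy. apply HM; [lra|]. eapply disc_sub; [exact Hy|lra].
  - intros t z. apply cderiv_C_derive, heat_mixed_derivative, HG.
Qed.

Lemma heat_class_iter (G : C -> C -> C) (n : nat) : heat_class G ->
  heat_class (fun t => derive_iter n (G t)).
Proof.
  intros HG. induction n as [|n IH]; [exact HG|].
  exact (heat_class_dz (fun t => derive_iter n (G t)) IH).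
Qed.

(** The increment of [G] is taken first in [t], then in [z]; the quadratic bound
    in [z] is uniform in [t], and the [z]-derivative is continuous in [t]. *)
Lemma heat_chain_rule (G : C -> C -> C) (c : C -> C) (t l : C) : heat_class G -> cderiv c t l ->
  cderiv (fun s => G s (c s)) t
    (C_derive (C_derive (G t)) (c t) + l * C_derive (G t) (c t)).
Proof.
  intros HG Hc. set (z := c t).
  destruct (heat_locally_bounded G HG t z) as (d & M & Hd & HM).
  assert (HM0 : (0 <= M)).
  { eapply Rle_trans; [apply (Cmod_ge_0 (G t z))|]. apply HM; rewrite Cmod_self; lra. }
  set (K := (32 * M / (d * d))%R).
  assert (HK : (0 <= K)).
  { unfold K. apply Rdiv_le_0_compat; [lra|nra]. }
  destruct (cderiv_lipschitz _ _ _ Hc) as [d1 [Hd1 H1]]. fold z in H1.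
  set (L := (1 + Cmod l)%R) in H1.
  destruct (cderiv_lipschitz _ _ _ (heat_mixed_derivative G t z HG)) as [d2 [Hd2 H2]].
  set (G3 := C_derive (C_derive (C_derive (G t))) z) in H2. set (L2 := (1 + Cmod G3)%R) in H2.
  assert (HL : (1 <= L)) by (unfold L; assert (h := Cmod_ge_0 l); lra).
  assert (HL2 : (1 <= L2)) by (unfold L2; assert (h := Cmod_ge_0 G3); lra).
  set (g := C_derive (G t) z) in *.
  assert (hg := Cmod_ge_0 g).
  assert (Dt : cderiv (fun s => G s z) t (C_derive (C_derive (G t)) z)).
  { rewrite <- (heat_eq G HG). apply holo_at_cderiv, (heat_entire_t G HG z t). }
  apply cderiv_iff. intros eps He.
  destruct (proj1 (cderiv_iff _ _ _) Dt (eps / 3)%R) as [d3 [Hd3 H3]]; [lra|].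
  destruct (proj1 (cderiv_iff _ _ _) Hc (eps / 3 / (1 + Cmod g))%R) as [d4 [Hd4 H4]].
  { repeat apply Rdiv_lt_0_compat; lra. }
  fold z in H4.
  set (N := (K * L * L + L * L2)%R).
  assert (HN : (0 < N)) by (unfold N; assert (0 <= K * L * L) by (apply Rmult_le_pos; [apply Rmult_le_pos|]; lra);
    assert (0 < L * L2) by (apply Rmult_lt_0_compat; lra); lra).
  set (m := Rmin (Rmin d1 d2) (Rmin (Rmin d3 d4) (Rmin (d / 4 / L) (eps / 3 / N)))).
  assert (Hm : (0 < m)).
  { assert (0 < d / 4 / L) by (repeat apply Rdiv_lt_0_compat; lra).
    assert (0 < eps / 3 / N) by (repeat apply Rdiv_lt_0_compat; lra).
    unfold m. repeat apply Rmin_glb_lt; lra. }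
  assert (Hms : (m <= Rmin (Rmin d1 d2) (Rmin (Rmin d3 d4) (Rmin (d / 4 / L) (eps / 3 / N)))))
    by (right; reflexivity).
  Rmin_bounds.
  exists m. split; [exact Hm|]. intros s Hs. assert (hs := Cmod_ge_0 s).
  assert (HdL : (d / 4 / L <= d / 4)).
  { unfold Rdiv at 1. rewrite <- (Rmult_1_r (d / 4)) at 2. apply Rmult_le_compat_l; [lra|].
    rewrite <- Rinv_1. apply Rinv_le_contravar; lra. }
  specialize (H1 s ltac:(lra)). specialize (H2 s ltac:(lra)).
  specialize (H3 s ltac:(lra)). specialize (H4 s ltac:(lra)).
  set (u := c (t + s) - z) in *.
  assert (hu := Cmod_ge_0 u).
  assert (Hud : (Cmod u <= d / 4)).
  { eapply Rle_trans; [exact H1|]. replace (d / 4)%R with (L * (d / 4 / L))%R by (field; lra).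
    apply Rmult_le_compat_l; lra. }
  replace (c (t + s)) with (z + u) by (unfold u; ring). fold z.
  assert (Q : (Cmod (G (t + s)%C (z + u)%C - G (t + s)%C z - u * C_derive (G (t + s)%C) z) <= K * Cmod u * Cmod u)).
  { apply (quadratic_bound (G (t + s)) z d M).
    - exact Hd.
    - intros y _. apply (heat_entire_z G HG).
    - intros y Hy. apply HM; [|exact Hy]. replace (t + s - t) with s by ring. lra.
    - rewrite Cmod_self. lra.
    - replace (z + u - z) with u by ring. exact Hud. }
  fold g in H2.
  set (gz := C_derive (G (t + s)) z) in *. set (gzz := C_derive (C_derive (G t)) z) in *.
  replace (G (t + s) (z + u) - G t z - s * (gzz + l * g)) with
    ((G (t + s) (z + u) - G (t + s) z - u * gz) + u * (gz - g)
      + (G (t + s) z - G t z - s * gzz) + g * (u - s * l)) by ring.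
  eapply Rle_trans; [apply Cmod_triangle|]. eapply Rle_trans; [apply Rplus_le_compat_r, Cmod_triangle|].
  eapply Rle_trans; [apply Rplus_le_compat_r, Rplus_le_compat_r, Cmod_triangle|].
  rewrite !Cmod_mult.
  assert (A1 : (K * Cmod u * Cmod u <= K * L * L * Cmod s * Cmod s)).
  { replace (K * L * L * Cmod s * Cmod s)%R with (K * ((L * Cmod s) * (L * Cmod s)))%R by ring.
    rewrite Rmult_assoc. apply Rmult_le_compat_l; [exact HK|]. apply Rmult_le_compat; assumption. }
  assert (A2 : (Cmod u * Cmod (gz - g) <= (L * Cmod s) * (L2 * Cmod s)))
    by (apply Rmult_le_compat; try assumption; apply Cmod_ge_0).
  assert (A3 : (Cmod g * Cmod (u - s * l) <= (1 + Cmod g) * (eps / 3 / (1 + Cmod g) * Cmod s))).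
  { apply Rmult_le_compat; try lra. apply Cmod_ge_0. }
  replace ((1 + Cmod g) * (eps / 3 / (1 + Cmod g) * Cmod s))%R with (eps / 3 * Cmod s)%R in A3 by (field; lra).
  assert (A4 : (N * Cmod s * Cmod s <= eps / 3 * Cmod s)).
  { apply Rmult_le_compat_r; [exact hs|].
    replace (eps / 3)%R with (N * (eps / 3 / N))%R by (field; lra).
    apply Rmult_le_compat_l; lra. }
  unfold N in A4. lra.
Qed.

Lemma norm_pair (u v : C) :
  (@norm C_AbsRing (prod_NormedModule C_AbsRing C_NormedModule C_NormedModule) (u, v)
    <= Cmod u + Cmod v).
Proof.
  change (sqrt (Cmod u ^ 2 + Cmod v ^ 2) <= Cmod u + Cmod v).
  assert (hu := Cmod_ge_0 u). assert (hv := Cmod_ge_0 v).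
  rewrite <- (sqrt_pow2 (Cmod u + Cmod v)) by lra. apply sqrt_le_1_alt. nra.
Qed.

Lemma entire2_differential (F : C -> C -> C) (t z : C) : entire2 F ->
  exists (a b : C),
  forall eps : R, (0 < eps) -> exists d : R, (0 < d) /\
    forall u v : C, (Cmod u < d) -> (Cmod v < d) ->
      (Cmod (F (t + u)%C (z + v)%C - F t z - (u * a + v * b)) <= eps * (Cmod u + Cmod v)).
Proof.
  intros HF. destruct (HF (t, z)) as [l [Hlin Hl]].
  exists (l (RtoC 1, RtoC 0)), (l (RtoC 0, RtoC 1)). intros eps He.
  destruct (Hl (t, z) (fun P HP => HP) (mkposreal eps He)) as [[d Hd] H].
  exists d. split; [exact Hd|]. intros u v Hu Hv.
  specialize (H (t + u, z + v)%C).
  assert (Hlv : l (u, v) = u * l (RtoC 1, RtoC 0) + v * l (RtoC 0, RtoC 1)).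
  { transitivity (plus (l (scal u ((RtoC 1, RtoC 0) : C * C))) (l (scal v ((RtoC 0, RtoC 1) : C * C)))).
    - rewrite <- (linear_plus l Hlin). f_equal.
      change ((u, v) = ((u * 1 + v * 0)%C, (u * 0 + v * 1)%C)). f_equal; ring.
    - rewrite !(linear_scal l Hlin). reflexivity. }
  assert (Em : minus ((t + u, z + v)%C : prod_NormedModule C_AbsRing C_NormedModule C_NormedModule) (t, z) = (u, v)).
  { change ((t + u - t, z + v - z)%C = (u, v)). f_equal; ring. }
  match type of H with ?A -> _ => assert (HA : A) end.
  { split; apply C_NormedModule_mixin_compat1; simpl.
    - change (Cmod (t + u - t) < d). replace (t + u - t) with u by ring. exact Hu.
    - change (Cmod (z + v - z) < d). replace (z + v - z) with v by ring. exact Hv. }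
  specialize (H HA). rewrite Em in H. simpl fst in H. simpl snd in H. rewrite Hlv in H.
  eapply Rle_trans; [exact H|]. apply Rmult_le_compat_l; [simpl; lra|]. apply norm_pair.
Qed.

(** Fréchet differentiability restricts to each variable, and gives continuity,
    hence local boundedness. *)
Lemma entire2_heat_class (F : C -> C -> C) : entire2 F -> heat_equation F -> heat_class F.
Proof.
  intros HF Heq. split; [| | |exact Heq].
  - intros z t. destruct (entire2_differential F t z HF) as (a & b & H). exists a.
    apply cderiv_iff. intros eps He. destruct (H eps He) as [d [Hd H']].
    exists d. split; [exact Hd|]. intros h Hh. specialize (H' h 0 Hh).
    rewrite Cmod_0 in H'. specialize (H' Hd).
    replace (z + 0) with z in H' by ring. replace (h * a + 0 * b) with (h * a) in H' by ring.
    rewrite Rplus_0_r in H'. exact H'.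
  - intros t z. destruct (entire2_differential F t z HF) as (a & b & H). exists b.
    apply cderiv_iff. intros eps He. destruct (H eps He) as [d [Hd H']].
    exists d. split; [exact Hd|]. intros h Hh. specialize (H' 0 h).
    rewrite Cmod_0 in H'. specialize (H' Hd Hh).
    replace (t + 0) with t in H' by ring. replace (0 * a + h * b) with (h * b) in H' by ring.
    rewrite Rplus_0_l in H'. exact H'.
  - intros t z. destruct (entire2_differential F t z HF) as (a & b & H).
    destruct (H 1%R Rlt_0_1) as [d [Hd H']].
    exists (d / 2)%R, (Cmod (F t z) + (d * Cmod a + d * Cmod b) + 2 * d)%R. split; [lra|].
    intros t' z' Ht Hz. specialize (H' (t' - t) (z' - z) ltac:(lra) ltac:(lra)).
    rewrite !Cplus_minus_cancel in H'.
    replace (F t' z') with (F t z + ((t' - t) * a + (z' - z) * b)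
      + (F t' z' - F t z - ((t' - t) * a + (z' - z) * b))) by ring.
    eapply Rle_trans; [apply Cmod_triangle|]. apply Rplus_le_compat; [|lra].
    eapply Rle_trans; [apply Cmod_triangle|]. apply Rplus_le_compat_l.
    eapply Rle_trans; [apply Cmod_triangle|]. rewrite !Cmod_mult.
    apply Rplus_le_compat; (apply Rmult_le_compat_r; [apply Cmod_ge_0|lra]).
Qed.

(** This is the heat equation, iterated for the solutions
    [C_derive (C_derive (G s))]. *)
Lemma heat_iter_t (n : nat) : forall (G : C -> C -> C) (z t : C), heat_class G ->
  derive_iter n (fun s => G s z) t = derive_iter (2 * n) (G t) z.
Proof.
  induction n as [|n IH]; intros G z t HG; [reflexivity|].
  rewrite derive_iter_S. replace (2 * S n)%nat with (S (S (2 * n))) by lia.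
  rewrite !derive_iter_S.
  replace (C_derive (fun s => G s z)) with (fun s => C_derive (C_derive (G s)) z).
  2: { apply functional_extensionality. intros s. symmetry. apply (heat_eq G HG). }
  apply (IH (fun s => C_derive (C_derive (G s)))).
  exact (heat_class_dz _ (heat_class_dz _ HG)).
Qed.

Lemma derive_iter_zero (f : C -> C) (k : nat) (z : C) : (forall y, f y = 0) -> derive_iter k f z = 0.
Proof.
  revert f. induction k as [|k IH]; intros f Hf; [apply Hf|].
  rewrite derive_iter_S. apply IH. intros y. apply cderiv_C_derive.
  apply (cderiv_ext (fun _ => 0)); [intros; symmetry; apply Hf|apply cderiv_const].
Qed.

Lemma entire1_zero_derivatives (f : C -> C) (a : C) : entire1 f ->
  (forall k, derive_iter k f a = 0) -> forall z, f z = 0.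
Proof.
  intros Hf H z. assert (h := Cmod_ge_0 (z - a)).
  apply (holo_zero_derivatives f a z (Cmod (z - a) + 1)); try assumption; try lra.
  intros y _. apply Hf.
Qed.

(** [G (t, -)] vanishes by Taylor expansion in [z]; then all time derivatives at
    [t] vanish as well, being [z]-derivatives of even order. *)
Lemma heat_flat_point (G : C -> C -> C) (t w : C) : heat_class G ->
  (forall k, derive_iter k (G t) w = 0) -> forall s z, G s z = 0.
Proof.
  intros HG H s z.
  assert (Ht : forall y, G t y = 0)
    by (apply (entire1_zero_derivatives _ w); [apply (heat_entire_z G HG)|exact H]).
  apply (entire1_zero_derivatives (fun s => G s z) t).
  - apply (heat_entire_t G HG).
  - intros k. rewrite heat_iter_t by exact HG. apply derive_iter_zero, Ht.
Qed.

(** A growth bound in [z] at one time propagates to all times, because a step of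
    the Cauchy estimates with radius one only costs a constant factor and the
    Taylor series in time has a factorial in its denominators. *)
Lemma heat_growth (G : C -> C -> C) (W : C -> R) (A : R) (t0 : C) : heat_class G ->
  (0 <= A) -> (forall z, (0 <= W z)) ->
  (forall y z, (Cmod (y - z) <= 1) -> (W y <= 3 * W z)) ->
  (forall z, (Cmod (G t0 z) <= A * W z)) ->
  forall t z, (Cmod (G t z) <= A * exp (36 * Cmod (t - t0)) * W z).
Proof.
  intros HG HA HW Hshift Hb t z.
  assert (D : forall k y, (Cmod (derive_iter k (G t0) y) <= A * 6 ^ k * W y)).
  { induction k as [|k IH]; intros y; [simpl; rewrite Rmult_1_r; apply Hb|].
    change (derive_iter (S k) (G t0) y) with (C_derive (derive_iter k (G t0)) y).
    replace (A * 6 ^ S k * W y)%R with (2 * (A * 6 ^ k * (3 * W y)) / 1)%R by (simpl; field).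
    apply cauchy_estimate; [lra| |].
    - intros x _. apply entire1_iter, (heat_entire_z G HG).
    - intros x Hx. eapply Rle_trans; [apply IH|]. apply Rmult_le_compat_l.
      + apply Rmult_le_pos; [exact HA|apply pow_le; lra].
      + apply Hshift, Hx. }
  replace (A * exp (36 * Cmod (t - t0)) * W z)%R with ((A * W z) * exp (36 * Cmod (t - t0)))%R by ring.
  apply (entire1_exp_bound (fun s => G s z)); [apply (heat_entire_t G HG)|apply Rmult_le_pos; auto|lra|].
  intros k. rewrite heat_iter_t by exact HG. eapply Rle_trans; [apply D|].
  rewrite pow_mult. replace (6 ^ 2)%R with 36%R by ring. lra.
Qed.

(** * Growth of order below one *)

Lemma max_modulus_ge (g : C -> C) (z : C) : entire1 g ->
  (Cmod (g z) <= max_modulus g (Cmod z)).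
Proof.
  intros Hg.
  destruct (holo_disc_bounded g 0 (Cmod z)) as [M [HM0 HM]]; [intros y _; apply Hg|].
  unfold max_modulus.
  match goal with |- (_ <= real (Lub_Rbar ?E)) =>
    destruct (Lub_Rbar_correct E) as [H1 H2]; set (L := Lub_Rbar E) in * end.
  assert (Hz : Rbar_le (Cmod (g z)) L) by (apply H1; exists z; auto).
  assert (HL : Rbar_le L M).
  { apply H2. intros y [x [Hx ->]]. apply HM. replace (x - 0) with x by ring. lra. }
  destruct L as [L| |]; simpl in *; [exact Hz|contradiction|contradiction].
Qed.

(** The infimum over [a] of the suprema beyond [a] is below one, so that one of
    these suprema is; it is replaced by [1 / 2] if it is smaller, to have a
    positive exponent. *)
Lemma LimSup_p_infty_lt_1 (f : R -> R) : Rbar_lt (LimSup_p_infty f) 1%R ->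
  exists c a : R, (0 < c < 1) /\ forall r, (a < r) -> (f r <= c).
Proof.
  unfold LimSup_p_infty, Rbar_glb.
  match goal with |- context [Rbar_ex_glb ?E] => destruct (Rbar_ex_glb E) as [l [Hl1 Hl2]] end.
  simpl. intros Hlt.
  assert (Hex : exists a : R,
    Rbar_lt (Lub_Rbar (fun y => exists r, (a < r) /\ y = f r)) 1%R).
  { apply NNPP. intros N. apply (Rbar_lt_not_le _ _ Hlt). apply Hl2.
    intros s [a ->]. apply Rbar_not_lt_le. intros K. apply N. exists a. exact K. }
  destruct Hex as [a Ha].
  match type of Ha with Rbar_lt (Lub_Rbar ?E) _ =>
    destruct (Lub_Rbar_correct E) as [H1 _]; set (L := Lub_Rbar E) in * end.
  assert (H : forall r, (a < r) -> Rbar_le (f r) L) by (intros r Hr; apply H1; exists r; auto).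
  destruct L as [L| |]; simpl in Ha; try contradiction.
  - exists (Rmax L (/ 2)), a. split.
    + split; [apply Rlt_le_trans with (/ 2)%R; [lra|apply Rmax_r]|apply Rmax_lub_lt; lra].
    + intros r Hr. eapply Rle_trans; [apply (H r Hr)|apply Rmax_l].
  - exfalso. apply (H (a + 1)%R). lra.
Qed.

Lemma Rpower_shift (c x y : R) : (0 < c <= 1) -> (1 <= x) -> (0 <= y) ->
  (Rpower (x + y) c <= Rpower x c + y).
Proof.
  intros Hc Hx Hy.
  assert (hi : (0 < / x)) by (apply Rinv_0_lt_compat; lra).
  assert (hq : (0 <= y * / x)) by (apply Rmult_le_pos; lra).
  replace (x + y)%R with (x * (1 + y * / x))%R by (field; lra).
  rewrite <- Rpower_mult_distr by lra.
  assert (h0 : (0 < Rpower x c)) by (apply exp_pos).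
  assert (h1 : (Rpower (1 + y * / x) c <= 1 + y * / x)).
  { rewrite <- (Rpower_1 (1 + y * / x)) at 2 by lra. apply Rle_Rpower; lra. }
  assert (h2 : (Rpower x c <= x)).
  { rewrite <- (Rpower_1 x) at 2 by lra. apply Rle_Rpower; lra. }
  apply Rle_trans with (Rpower x c * (1 + y * / x))%R; [apply Rmult_le_compat_l; lra|].
  rewrite Rmult_plus_distr_l, Rmult_1_r. apply Rplus_le_compat_l.
  replace (Rpower x c * (y * / x))%R with ((Rpower x c * / x) * y)%R by ring.
  rewrite <- (Rmult_1_l y) at 2. apply Rmult_le_compat_r; [exact Hy|].
  apply Rmult_le_reg_r with x; [lra|]. rewrite Rmult_assoc, Rinv_l by lra. lra.
Qed.

Lemma exp_le (x y : R) : (x <= y) -> (exp x <= exp y).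
Proof. intros [H| ->]; [left; apply exp_increasing, H|right; reflexivity]. Qed.

(** Adding one to the modulus makes the exponent a Lipschitz function with
    constant one, which controls the effect of a translation. *)
Definition weight (c : R) (z : C) : R := exp (Rpower (1 + Cmod z) c).

Lemma weight_ge_1 (c : R) (z : C) : (1 <= weight c z).
Proof.
  unfold weight. rewrite <- exp_0. apply exp_le, Rlt_le, exp_pos.
Qed.

Lemma weight_shift (c : R) (y z : C) : (0 < c <= 1) ->
  (weight c y <= exp (Cmod (y - z)) * weight c z).
Proof.
  intros Hc. unfold weight. rewrite <- exp_plus. apply exp_le.
  assert (hz := Cmod_ge_0 z). assert (hy := Cmod_ge_0 y). assert (hyz := Cmod_ge_0 (y - z)).
  assert (T := Cmod_minus_le y z).
  eapply Rle_trans; [|rewrite Rplus_comm; apply Rpower_shift; lra].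
  apply Rle_Rpower_l; lra.
Qed.

Lemma order_growth (g : C -> C) : entire1 g -> Rbar_lt (entire_order g) 1%R ->
  exists c A : R, (0 < c < 1) /\ (0 <= A) /\
    forall z, (Cmod (g z) <= A * weight c z).
Proof.
  intros Hg Hord. destruct (LimSup_p_infty_lt_1 _ Hord) as (c & a & Hc & H).
  set (r0 := (Rmax a 1 + 1)%R).
  destruct (holo_disc_bounded g 0 r0) as [B [HB0 HB]]; [intros y _; apply Hg|].
  exists c, (B + 1)%R. split; [exact Hc|]. split; [lra|]. intros z.
  assert (hw := weight_ge_1 c z). assert (hm1 := Rmax_l a 1). assert (hm2 := Rmax_r a 1).
  destruct (Rle_or_lt (Cmod z) r0) as [Hz|Hz].
  - apply Rle_trans with B; [apply HB; replace (z - 0) with z by ring; exact Hz|]. nra.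
  - set (r := Cmod z) in *.
    assert (Hr : (a < r)) by (unfold r0 in Hz; lra).
    assert (Hr1 : (1 < r)) by (unfold r0 in Hz; lra).
    specialize (H r Hr). set (m := max_modulus g r) in *.
    assert (Hlr : (0 < ln r)) by (rewrite <- ln_1; apply ln_increasing; lra).
    assert (Hll : (ln (ln m) <= c * ln r)).
    { apply Rmult_le_reg_r with (/ ln r)%R; [apply Rinv_0_lt_compat, Hlr|].
      rewrite Rmult_assoc, Rinv_r, Rmult_1_r by lra. exact H. }
    assert (Hm : (m <= weight c z)).
    { destruct (Rle_or_lt m 1) as [Hm|Hm]; [lra|].
      assert (Hlm : (0 < ln m)) by (rewrite <- ln_1; apply ln_increasing; lra).
      rewrite <- (exp_ln m) by lra. unfold weight. fold r. apply exp_le.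
      apply Rle_trans with (Rpower r c).
      - rewrite <- (exp_ln (ln m)) by exact Hlm. apply exp_le, Hll.
      - apply Rle_Rpower_l; lra. }
    eapply Rle_trans; [apply max_modulus_ge, Hg|]. fold r. fold m. nra.
Qed.

(** * Logarithms of zero-free functions *)

Lemma holo_rcont_ray (f : C -> C) (a b : C) (s : R) :
  holo_at f (a + RtoC s * b) -> rcont (fun s => f (a + RtoC s * b)) s.
Proof.
  intros H. apply (ccont_rcont f (fun s => a + RtoC s * b)).
  - apply holo_at_ccont, H.
  - eapply rderiv_rcont, rderiv_affine.
Qed.

Lemma ray_in_disc (a b : C) (s : R) : (0 <= s <= 1) ->
  (Cmod (a + RtoC s * b - a) <= Cmod b).
Proof.
  intros Hs. replace (a + RtoC s * b - a) with (RtoC s * b) by ring.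
  rewrite Cmod_mult, Cmod_R, Rabs_pos_eq by lra. assert (h := Cmod_ge_0 b). nra.
Qed.

(** The primitive is the integral along the rays from [a]: differentiating
    [(z - a) * f (a + s * (z - a))] in [z] gives the derivative of
    [s * f (a + s * (z - a))] in [s]. *)
Lemma disc_primitive (f : C -> C) (a : C) (r : R) :
  (forall z, (Cmod (z - a) < r) -> holo_at f z) ->
  exists p : C -> C, p a = 0 /\ forall z, (Cmod (z - a) < r) -> cderiv p z (f z).
Proof.
  intros Hf.
  pose (J := fun z => CInt (fun s => f (a + RtoC s * (z - a))) 0 1).
  exists (fun z => (z - a) * J z). split; [ring|]. intros z Hz.
  set (b := z - a) in *. assert (hb := Cmod_ge_0 b).
  set (d := ((r - Cmod b) / 2)%R). assert (Hd : (0 < d)) by (unfold d; lra).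
  assert (Hdisc : holo_disc f a (Cmod b + d)) by (intros y Hy; apply Hf; unfold d in Hy; lra).
  destruct (holo_disc_bounded f a _ Hdisc) as [M [HM0 HM]].
  assert (near : forall s y, (0 <= s <= 1) -> (Cmod (y - (a + RtoC s * b)) <= d) ->
    (Cmod (y - a) <= Cmod b + d)).
  { intros s y Hs Hy. eapply disc_sub; [exact Hy|]. assert (h := ray_in_disc a b s Hs). lra. }
  assert (holo1 : forall s, (0 <= s <= 1) -> holo_disc f (a + RtoC s * b) d)
    by (intros s Hs y Hy; apply Hdisc, (near s); assumption).
  assert (holo2 : forall s, (0 <= s <= 1) -> holo_at (C_derive f) (a + RtoC s * b))
    by (intros s Hs; apply (holo_derive f _ d); auto).
  assert (holo0 : forall s, (0 <= s <= 1) -> holo_at f (a + RtoC s * b))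
    by (intros s Hs; apply (holo1 s Hs); rewrite Cmod_self; lra).
  set (K := (32 * M / (d * d))%R).
  assert (HK : (0 <= K)).
  { unfold K. apply Rdiv_le_0_compat; [lra|nra]. }
  set (D := CInt (fun s => RtoC s * C_derive f (a + RtoC s * b)) 0 1).
  assert (cD : rcont_on (fun s => RtoC s * C_derive f (a + RtoC s * b)) 0 1).
  { intros s Hs. apply (ccont_rcont (fun w => w * C_derive f (a + w * b)) RtoC).
    - destruct (holo2 s Hs) as [l Hl].
      eapply cderiv_ccont, (cderiv_mult (fun w => w)); [apply cderiv_id|].
      apply (cderiv_comp (C_derive f) (fun w => a + w * b)); [exact Hl|].
      apply cderiv_plus; [apply cderiv_const|]. apply (cderiv_mult (fun w => w) (fun _ => b));
        [apply cderiv_id|apply cderiv_const].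
    - eapply rderiv_rcont, rderiv_RtoC. }
  assert (c0 : rcont_on (fun s => f (a + RtoC s * b)) 0 1)
    by (intros s Hs; apply holo_rcont_ray, holo0, Hs).
  assert (HJ : cderiv J z D).
  { apply cderiv_iff. intros eps He.
    exists (Rmin (d / 4) (eps / (K + 1))). split.
    { apply Rmin_glb_lt; [lra|]. apply Rdiv_lt_0_compat; lra. }
    intros h Hh. Rmin_bounds. assert (hh := Cmod_ge_0 h).
    assert (ray : forall s, (0 <= s <= 1) -> (Cmod (RtoC s * h) <= Cmod h)).
    { intros s Hs. rewrite Cmod_mult, Cmod_R, Rabs_pos_eq by lra. nra. }
    assert (c1 : rcont_on (fun s => f (a + RtoC s * (b + h))) 0 1).
    { intros s Hs. apply holo_rcont_ray. apply (holo1 s Hs).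
      replace (a + RtoC s * (b + h) - (a + RtoC s * b)) with (RtoC s * h) by ring.
      specialize (ray s Hs). lra. }
    assert (c2 : rcont_on (fun s => h * (RtoC s * C_derive f (a + RtoC s * b))) 0 1).
    { intros s Hs. apply (ccont_rcont (fun w => h * w) (fun s => RtoC s * C_derive f (a + RtoC s * b))).
      - eapply cderiv_ccont, (cderiv_scal (fun w => w)), cderiv_id.
      - apply cD, Hs. }
    assert (c01 : rcont_on (fun s => f (a + RtoC s * (b + h)) - f (a + RtoC s * b)) 0 1)
      by (intros s Hs; apply rcont_minus; [apply c1, Hs|apply c0, Hs]).
    unfold J, D. replace (z + h - a) with (b + h) by (unfold b; ring). fold b.
    rewrite <- CInt_scal by (lra || exact cD).
    rewrite <- CInt_minus by (lra || assumption).
    rewrite <- CInt_minus by (lra || assumption).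
    apply Rle_trans with (K * Cmod h * Cmod h * (1 - 0))%R.
    - apply CInt_bound; [lra| |].
      + intros s Hs. apply rcont_minus; [apply c01, Hs|apply c2, Hs].
      + intros s Hs.
        replace (f (a + RtoC s * (b + h)) - f (a + RtoC s * b) - h * (RtoC s * C_derive f (a + RtoC s * b)))
          with (f (a + RtoC s * b + RtoC s * h) - f (a + RtoC s * b) - RtoC s * h * C_derive f (a + RtoC s * b)).
        2: { replace (a + RtoC s * (b + h)) with (a + RtoC s * b + RtoC s * h) by ring. ring. }
        eapply Rle_trans.
        * apply (quadratic_bound f (a + RtoC s * b) d M); [exact Hd|apply holo1, Hs| | |].
          -- intros y Hy. apply HM, (near s); assumption.
          -- rewrite Cmod_self. lra.
          -- replace (a + RtoC s * b + RtoC s * h - (a + RtoC s * b)) with (RtoC s * h) by ring.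
             specialize (ray s Hs). lra.
        * fold K. rewrite !Rmult_assoc. apply Rmult_le_compat_l; [exact HK|].
          assert (hs := Cmod_ge_0 (RtoC s * h)). specialize (ray s Hs).
          apply Rmult_le_compat; assumption.
    - rewrite Rminus_0_r, Rmult_1_r. apply Rmult_le_compat_r; [exact hh|].
      apply Rmult_div_succ_le; lra. }
  assert (DB := cderiv_sub_const a z).
  refine (cderiv_val _ _ _ _ _ (cderiv_mult _ _ z _ _ DB HJ)). fold b.
  unfold J, D. fold b.
  replace (1 * CInt (fun s => f (a + RtoC s * b)) 0 1
     + b * CInt (fun s => RtoC s * C_derive f (a + RtoC s * b)) 0 1) with
    (CInt (fun s => f (a + RtoC s * b)) 0 1
     + b * CInt (fun s => RtoC s * C_derive f (a + RtoC s * b)) 0 1) by ring.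
  assert (c3 : rcont_on (fun s => b * (RtoC s * C_derive f (a + RtoC s * b))) 0 1).
  { intros s Hs. apply (ccont_rcont (fun w => b * w) (fun s => RtoC s * C_derive f (a + RtoC s * b))).
    - eapply cderiv_ccont, (cderiv_scal (fun w => w)), cderiv_id.
    - apply cD, Hs. }
  rewrite <- CInt_scal by (lra || exact cD).
  rewrite <- CInt_plus by (lra || assumption).
  rewrite (CInt_FTC (fun s => RtoC s * f (a + RtoC s * b))).
  - replace (a + RtoC 1 * b) with z by (unfold b; ring). ring.
  - lra.
  - intros s Hs.
    assert (D1 : cderiv (fun w => a + w * b) (RtoC s) (0 + (1 * b + RtoC s * 0))).
    { apply cderiv_plus; [apply cderiv_const|]. apply (cderiv_mult (fun w => w) (fun _ => b));
        [apply cderiv_id|apply cderiv_const]. }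
    assert (D2 := cderiv_comp f (fun w => a + w * b) (RtoC s) _ _ (holo_at_cderiv _ _ (holo0 s Hs)) D1).
    assert (D3 := cderiv_mult _ _ (RtoC s) _ _ (cderiv_id (RtoC s)) D2).
    refine (rderiv_val _ _ _ _ _ (cderiv_rderiv _ RtoC s _ _ D3 (rderiv_RtoC s))). ring.
  - intros s Hs. apply rcont_plus; [apply c0, Hs|apply c3, Hs].
Qed.

Lemma circle_mean_inv (a : C) (r : R) : (0 < r) -> circle_mean (fun z => / (z - a)) a r = 0.
Proof.
  intros Hr. unfold circle_mean. assert (hpi := two_PI_pos).
  assert (Hrc : RtoC r <> 0) by (intros K; apply RtoC_inj in K; lra).
  rewrite (CInt_ext _ (fun t => / RtoC r * Cexp (RtoC t * - Ci))); [|lra|].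
  2: { intros t _. unfold circle_pt.
       replace (a + RtoC r * Cexp (0%R, t) - a) with (RtoC r * Cexp (0%R, t)) by ring.
       assert (E : Cexp (0%R, t) * Cexp (RtoC t * - Ci) = 1).
       { rewrite <- Cexp_plus, <- Cexp_0. f_equal. unfold RtoC, Ci, Cmult, Copp, Cplus; simpl. f_equal; ring. }
       replace (Cexp (RtoC t * - Ci)) with (/ Cexp (0%R, t)).
       - field. split; [apply Cexp_neq_0|exact Hrc].
       - replace (Cexp (RtoC t * - Ci)) with (/ Cexp (0%R, t) * (Cexp (0%R, t) * Cexp (RtoC t * - Ci)))
           by (field; apply Cexp_neq_0). rewrite E. field. apply Cexp_neq_0. }
  assert (D : forall t, rderiv (fun t => / RtoC r * (Ci * Cexp (RtoC t * - Ci))) t (/ RtoC r * Cexp (RtoC t * - Ci))).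
  { intros t.
    assert (D1 : cderiv (fun w => w * - Ci) (RtoC t) (1 * - Ci + RtoC t * 0))
      by (apply (cderiv_mult (fun w => w) (fun _ => - Ci)); [apply cderiv_id|apply cderiv_const]).
    assert (D2 := cderiv_comp Cexp _ (RtoC t) _ _ (cderiv_Cexp _) D1).
    assert (D3 := cderiv_scal _ _ _ (/ RtoC r) (cderiv_scal _ _ _ Ci D2)).
    refine (rderiv_val _ _ _ _ _ (cderiv_rderiv _ RtoC t _ _ D3 (rderiv_RtoC t))).
    set (q := Cexp (RtoC t * - Ci)). replace (1 * (/ RtoC r * (Ci * ((1 * - Ci + RtoC t * 0) * q))))
      with (- (Ci * Ci) * (/ RtoC r * q)) by ring.
    replace (- (Ci * Ci)) with (RtoC 1); [ring|]. unfold RtoC, Ci, Cmult, Copp; simpl. f_equal; ring. }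
  rewrite (CInt_FTC (fun t => / RtoC r * (Ci * Cexp (RtoC t * - Ci)))).
  - replace (Cexp (RtoC (2 * PI) * - Ci)) with (Cexp (RtoC 0 * - Ci)); [ring|].
    assert (E : forall t : R, RtoC t * - Ci = (0%R, (- t)%R))
      by (intros t; unfold RtoC, Ci, Cmult, Copp; simpl; f_equal; ring).
    rewrite !E. unfold Cexp. simpl fst. simpl snd.
    rewrite !cos_neg, !sin_neg, cos_2PI, sin_2PI, cos_0, sin_0. reflexivity.
  - lra.
  - intros t _. apply D.
  - intros t _. apply (ccont_rcont (fun w => / RtoC r * Cexp (w * - Ci)) RtoC).
    + eapply cderiv_ccont, cderiv_scal, (cderiv_comp Cexp (fun w => w * - Ci)); [apply cderiv_Cexp|].
      apply (cderiv_mult (fun w => w) (fun _ => - Ci)); [apply cderiv_id|apply cderiv_const].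
    + eapply rderiv_rcont, rderiv_RtoC.
Qed.

Lemma circle_mean_Re_nonneg (f : C -> C) (a : C) (r : R) : (0 <= r) -> ccont_circle f a r ->
  (forall z, Cmod (z - a) = r -> (0 <= Re (f z))) -> (0 <= Re (circle_mean f a r)).
Proof.
  intros Hr Hf H. unfold circle_mean. assert (hpi := two_PI_pos).
  rewrite re_scal_l. apply Rmult_le_pos; [apply Rlt_le, Rinv_0_lt_compat, hpi|].
  assert (Hc := ccont_circle_rcont f a r 0 (2 * PI) Hr Hf).
  destruct (CInt_components _ 0 (2 * PI) _ (CInt_is _ 0 (2 * PI) ltac:(lra) Hc)) as [H1 _].
  apply (is_RInt_ge_0 (fun s => fst (f (circle_pt a r s))) 0 (2 * PI)); [lra|exact H1|].
  intros s _. apply H, circle_pt_dist, Hr.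
Qed.

(** Testing the nonnegative function [A - Re p] against the Poisson-like kernel
    [1 + Re (w * r / (z - a))], which is nonnegative and has mean one, singles
    out the first Taylor coefficient of [p]. *)
Lemma borel_caratheodory (p : C -> C) (a : C) (r A : R) : (0 < r) -> holo_disc p a r ->
  p a = 0 -> (forall z, Cmod (z - a) = r -> (Re (p z) <= A)) ->
  (Cmod (C_derive p a) <= 2 * A / r).
Proof.
  intros Hr Hp Hpa HA.
  destruct (unit_direction (C_derive p a)) as [w [Hw Ew]].
  assert (Hrc : RtoC r <> 0) by (intros K; apply RtoC_inj in K; lra).
  pose (u := fun z => RtoC A - p z).
  pose (m := Cconj w / (2 * RtoC r)). pose (n := w * RtoC r / 2).
  assert (Hu : holo_disc u a r).
  { intros z Hz. destruct (Hp z Hz) as [l Hl]. eexists.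
    apply (cderiv_minus (fun _ => RtoC A)); [apply cderiv_const|exact Hl]. }
  assert (Hus : holo_disc (fun z => u z * (1 + m * (z - a))) a r).
  { intros z Hz. destruct (Hu z Hz) as [l Hl]. eexists.
    apply (cderiv_mult u (fun z => 1 + m * (z - a))); [exact Hl|].
    apply (cderiv_plus (fun _ => RtoC 1)); [apply cderiv_const|].
    apply (cderiv_scal (fun z => z - a)), cderiv_minus; [apply cderiv_id|apply cderiv_const]. }
  assert (on_circle : forall f, holo_disc f a r -> ccont_circle f a r).
  { intros f Hf z Hz. apply holo_at_ccont, Hf. lra. }
  assert (Hinv : forall z, Cmod (z - a) = r -> ccont (fun z => / (z - a)) z).
  { intros z Hz. eapply cderiv_ccont, (cderiv_inv (fun z => z - a)).
    - apply Cminus_neq_0. eapply circle_neq; eassumption.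
    - apply cderiv_sub_const. }
  assert (c1 : ccont_circle (fun z => (p z - p a) / (z - a)) a r).
  { intros z Hz. apply (ccont_mult (fun z => p z - p a) (fun z => / (z - a))); [|apply Hinv, Hz].
    apply ccont_minus; [apply on_circle; assumption|apply ccont_const]. }
  assert (c2 : ccont_circle (fun z => RtoC A * / (z - a)) a r).
  { intros z Hz. apply ccont_mult; [apply ccont_const|apply Hinv, Hz]. }
  assert (c3 : ccont_circle (fun z => RtoC A * / (z - a) - (p z - p a) / (z - a)) a r).
  { intros z Hz. apply ccont_minus; [apply c2, Hz|apply c1, Hz]. }
  assert (c4 : ccont_circle (fun z => n * (RtoC A * / (z - a) - (p z - p a) / (z - a))) a r).
  { intros z Hz. apply ccont_mult; [apply ccont_const|apply c3, Hz]. }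
  pose (g := fun z => u z * (1 + m * (z - a)) + n * (RtoC A * / (z - a) - (p z - p a) / (z - a))).
  assert (Eg : circle_mean g a r = RtoC A - n * C_derive p a).
  { unfold g. rewrite circle_mean_plus; [|lra|apply on_circle, Hus|exact c4].
    rewrite (mean_value_property (fun z => u z * (1 + m * (z - a))) a r Hr).
    2: { intros z _ Hz. apply Hus, Hz. }
    2: { apply holo_at_ccont, Hus. rewrite Cmod_self. lra. }
    rewrite circle_mean_scal; [|lra|exact c3].
    rewrite circle_mean_minus; [|lra|exact c2|exact c1].
    rewrite <- (cauchy_formula p a r Hr Hp).
    rewrite circle_mean_scal; [|lra|intros z Hz; apply Hinv, Hz].
    rewrite (circle_mean_inv a r Hr). unfold u. rewrite Hpa. ring. }
  assert (Hpos : (0 <= Re (circle_mean g a r))).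
  { apply circle_mean_Re_nonneg; [lra| |].
    - intros z Hz. apply ccont_plus; [apply (on_circle _ Hus z Hz)|apply c4, Hz].
    - intros z Hz. assert (Hza : z - a <> 0) by (apply Cminus_neq_0; eapply circle_neq; eassumption).
      set (e := w * RtoC r / (z - a)).
      assert (He : Cmod e = 1%R).
      { unfold e. rewrite Cmod_div, Cmod_mult, Hw, Hz, Cmod_R, Rabs_pos_eq by (lra || exact Hza).
        field. lra. }
      (* on the circle [Cconj (z - a) = r * r / (z - a)] *)
      assert (Ec : m * (z - a) = Cconj e / 2).
      { assert (E1 : e * (z - a) = w * RtoC r) by (unfold e; field; exact Hza).
        assert (E2 : e * Cconj e = 1).
        { rewrite <- Cmod2_conj, He. rewrite pow1. reflexivity. }
        assert (E3 : w * Cconj w = 1).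
        { rewrite <- Cmod2_conj, Hw. rewrite pow1. reflexivity. }
        unfold m. replace (z - a) with (Cconj e * w * RtoC r).
        - replace (Cconj w / (2 * RtoC r) * (Cconj e * w * RtoC r)) with (w * Cconj w * Cconj e / 2)
            by (field; exact Hrc).
          rewrite E3. unfold Cdiv. ring.
        - replace (Cconj e * w * RtoC r) with (Cconj e * (e * (z - a))) by (rewrite E1; ring).
          replace (Cconj e * (e * (z - a))) with (e * Cconj e * (z - a)) by ring. rewrite E2. ring. }
      replace (g z) with (u z * RtoC (1 + Re e)).
      + rewrite re_scal_r. apply Rmult_le_pos.
        * unfold u. specialize (HA z Hz).
          replace (Re (RtoC A - p z)) with (A - Re (p z))%R by (destruct (p z); simpl; ring). lra.
        * assert (h := re_le_Cmod e). rewrite He in h. apply Rabs_le_between in h. lra.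
      + unfold g. rewrite Ec, Hpa.
        replace (n * (RtoC A * / (z - a) - (p z - 0) / (z - a))) with (u z * (e / 2)).
        2: { unfold n, e, u. field. exact Hza. }
        replace (RtoC (1 + Re e)) with (1 + (e + Cconj e) / 2).
        2: { rewrite RtoC_plus. f_equal. symmetry. apply re_alt. }
        unfold Cdiv. ring. }
  rewrite Eg in Hpos. unfold n in Hpos.
  replace (RtoC A - w * RtoC r / 2 * C_derive p a) with
    (RtoC A - RtoC (r / 2) * (w * C_derive p a)) in Hpos.
  2: { rewrite RtoC_div by lra. unfold Cdiv. ring. }
  rewrite Ew, <- RtoC_mult, <- RtoC_minus, re_RtoC in Hpos.
  apply Rmult_le_reg_r with (r / 2)%R; [lra|].
  replace (2 * A / r * (r / 2))%R with A by (field; lra). lra.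
Qed.

(** A zero-free function on a disc has a holomorphic logarithm, to which the
    previous estimate applies. *)
Lemma log_derivative_bound (u : C -> C) (a : C) (r s A : R) : (0 < s < r) ->
  (forall z, (Cmod (z - a) < r) -> holo_at u z) ->
  (forall z, (Cmod (z - a) < r) -> u z <> 0) ->
  (forall z, (Cmod (z - a) < r) -> (Cmod (u z) <= exp A * Cmod (u a))) ->
  (Cmod (C_derive u a / u a) <= 2 * A / s).
Proof.
  intros Hs Hu Hu0 HA.
  assert (Ha : (Cmod (a - a) < r)) by (rewrite Cmod_self; lra).
  assert (Hu1 : forall z, (Cmod (z - a) < r) -> holo_at (C_derive u) z).
  { intros z Hz. apply (holo_derive u z ((r - Cmod (z - a)) / 2)); [lra|].
    intros y Hy. apply Hu. assert (T := Cmod_dist_triangle y z a). lra. }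
  destruct (disc_primitive (fun z => C_derive u z / u z) a r) as [p [Hpa Hp]].
  { intros z Hz. destruct (Hu1 z Hz) as [l Hl]. eexists.
    apply (cderiv_div (C_derive u) u); [apply Hu0, Hz|exact Hl|apply holo_at_cderiv, Hu, Hz]. }
  assert (Hconst : forall z, (Cmod (z - a) < r) -> u z = u a * Cexp (p z)).
  { intros z Hz.
    assert (D : forall y, (Cmod (y - a) < r) -> cderiv (fun y => u y * Cexp (- p y)) y 0).
    { intros y Hy.
      assert (D1 : cderiv (fun y => - p y) y (0 - C_derive u y / u y)).
      { apply (cderiv_ext (fun y => 0 - p y)); [intros; ring|].
        apply cderiv_minus; [apply cderiv_const|apply Hp, Hy]. }
      assert (D2 := cderiv_comp Cexp _ y _ _ (cderiv_Cexp _) D1).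
      refine (cderiv_val _ _ _ _ _ (cderiv_mult _ _ y _ _ (holo_at_cderiv _ _ (Hu y Hy)) D2)).
      field. apply Hu0, Hy. }
    assert (S := segment_bound (fun y => u y * Cexp (- p y)) (fun _ => 0) a (z - a) 0).
    cbv beta in S. rewrite Cplus_minus_cancel, Rmult_0_l in S.
    assert (E : u z * Cexp (- p z) - u a * Cexp (- p a) = 0).
    { apply Cmod_eq_0, Rle_antisym; [|apply Cmod_ge_0]. apply S.
      - intros x Hx. apply D. eapply Rle_lt_trans; [apply ray_in_disc, Hx|exact Hz].
      - intros _ _. rewrite Cmod_0. lra. }
    rewrite Hpa in E. replace (- RtoC 0) with (RtoC 0) in E by ring. rewrite Cexp_0 in E.
    replace (u z) with (u z * Cexp (- p z) * Cexp (p z)).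
    - replace (u z * Cexp (- p z)) with (u a + (u z * Cexp (- p z) - u a * 1)) by ring. rewrite E. ring.
    - rewrite <- Cmult_assoc, <- Cexp_plus. replace (- p z + p z) with (RtoC 0) by ring.
      rewrite Cexp_0. ring. }
  rewrite <- (cderiv_C_derive p a _ (Hp a Ha)).
  apply borel_caratheodory; [lra| |exact Hpa|].
  - intros z Hz. eexists. apply Hp. lra.
  - intros z Hz. assert (Hz' : (Cmod (z - a) < r)) by lra.
    specialize (HA z Hz'). rewrite (Hconst z Hz'), Cmod_mult, Cmod_Cexp, Rmult_comm in HA.
    apply Rmult_le_reg_r in HA; [|apply Cmod_gt_0, Hu0, Ha].
    destruct (Rle_or_lt (Re (p z)) A) as [K|K]; [exact K|].
    apply exp_increasing in K. unfold Re in K. lra.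
Qed.

(** * Zeros listed with multiplicity *)

Lemma Cpow_self_minus (w : C) (n : nat) : (w - w) ^ S n = 0.
Proof. simpl. ring. Qed.

Lemma lists_zeros_neq (g : C -> C) (zs : nat -> option C) (w : C) :
  lists_zeros g zs -> (forall j, zs j <> Some w) -> g w <> 0.
Proof.
  intros H Hw. destruct (H w) as (l & _ & Hl & (h & _ & Hh & E)).
  destruct l as [|j l].
  - rewrite E. simpl. rewrite Cmult_1_l. exact Hh.
  - exfalso. apply (Hw j), Hl. left. reflexivity.
Qed.

Lemma lists_zeros_ext (g : C -> C) (zs zs' : nat -> option C) :
  (forall j, zs j = zs' j) -> lists_zeros g zs -> lists_zeros g zs'.
Proof.
  intros E H w. destruct (H w) as (l & Hn & Hl & Hm). exists l. split; [exact Hn|].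
  split; [|exact Hm]. intros j. rewrite <- E. apply Hl.
Qed.

Lemma entire1_scal (h : C -> C) (c : C) : entire1 h -> entire1 (fun z => c * h z).
Proof. intros H z. eexists. apply cderiv_scal, holo_at_cderiv, H. Qed.

Lemma entire1_mult (f g : C -> C) : entire1 f -> entire1 g -> entire1 (fun z => f z * g z).
Proof. intros Hf Hg z. eexists. apply cderiv_mult; apply holo_at_cderiv; [apply Hf|apply Hg]. Qed.

Lemma entire1_pow (a : C) (n : nat) : entire1 (fun z => (z - a) ^ n).
Proof.
  intros z. destruct n as [|n].
  - exists (RtoC 0). apply (cderiv_ext (fun _ => 1)); [reflexivity|apply cderiv_const].
  - eexists. apply cderiv_pow.
Qed.

Lemma lists_zeros_scal (g : C -> C) (zs : nat -> option C) (c : C) : c <> 0 ->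
  lists_zeros g zs -> lists_zeros (fun z => c * g z) zs.
Proof.
  intros Hc H w. destruct (H w) as (l & Hn & Hl & (h & He & Hh & E)).
  exists l. split; [exact Hn|]. split; [exact Hl|]. exists (fun z => c * h z).
  split; [apply entire1_scal, He|]. split.
  - intros K. apply Hh. replace (h w) with (/ c * (c * h w)) by (field; exact Hc). rewrite K. ring.
  - intros z. rewrite E. ring.
Qed.

Lemma ccont_eq_off_point (f g : C -> C) (v : C) : ccont f v -> ccont g v ->
  (forall z, z <> v -> f z = g z) -> f v = g v.
Proof.
  intros Hf Hg E. assert (K : f v - g v = 0).
  { apply (Cmod_le_all_eps _ 1). intros eps He. rewrite Rmult_1_l.
    destruct (ccont_minus f g v Hf Hg eps He) as [d [Hd H]].
    specialize (H (v + RtoC (d / 2))).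
    assert (Hm : Cmod (RtoC (d / 2)) = (d / 2)%R) by (rewrite Cmod_R; apply Rabs_pos_eq; lra).
    assert (Hne : v + RtoC (d / 2) <> v).
    { intros K. assert (E0 : RtoC (d / 2) = 0) by (replace (RtoC (d / 2)) with (v + RtoC (d / 2) - v) by ring; rewrite K; ring).
      apply RtoC_inj in E0. lra. }
    replace (v + RtoC (d / 2) - v) with (RtoC (d / 2)) in H by ring.
    rewrite Hm, (E _ Hne) in H. specialize (H ltac:(lra)).
    replace (g (v + RtoC (d / 2)) - g (v + RtoC (d / 2)) - (f v - g v)) with (- (f v - g v)) in H by ring.
    rewrite Cmod_opp in H. lra. }
  replace (f v) with (f v - g v + g v) by ring. rewrite K. ring.
Qed.

Lemma Cpow_minus_neq_0 (z w : C) (n : nat) : z <> w -> (z - w) ^ n <> 0.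
Proof. intros H. apply Cpow_nz, Cminus_neq_0, H. Qed.

Lemma Cmult_cancel (a x y : C) : a <> 0 -> a * x = a * y -> x = y.
Proof.
  intros Ha E. replace x with (/ a * (a * x)) by (field; exact Ha). rewrite E. field. exact Ha.
Qed.

(** At a zero [w] different from [v], the cofactor [hw] of [(z - w) ^ m]
    vanishes at [v], hence is divisible by [z - v]. *)
Lemma lists_zeros_remove (g : C -> C) (zs : nat -> option C) (j : nat) (v : C) :
  lists_zeros g zs -> zs j = Some v ->
  exists k : C -> C, entire1 k /\ (forall z, g z = (z - v) * k z) /\
    lists_zeros k (fun i => if Nat.eq_dec i j then None else zs i).
Proof.
  intros H Hj. destruct (H v) as (l & Hn & Hl & (h & He & Hh & E)).
  assert (Hjl : In j l) by (apply Hl, Hj).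
  destruct (in_split j l Hjl) as (l1 & l2 & ->).
  rewrite length_app in E. simpl length in E. rewrite Nat.add_succ_r, <- length_app in E.
  set (n := length (l1 ++ l2)) in *.
  assert (Hk : entire1 (fun z => (z - v) ^ n * h z)) by (apply entire1_mult; [apply entire1_pow|exact He]).
  assert (Eg : forall z, g z = (z - v) * ((z - v) ^ n * h z)) by (intros z; rewrite E; simpl; ring).
  exists (fun z => (z - v) ^ n * h z). split; [exact Hk|]. split; [exact Eg|].
  intros w. destruct (classic (w = v)) as [->|Hwv].
  - exists (l1 ++ l2). destruct (NoDup_remove _ _ _ Hn) as [Hn1 Hn2].
    split; [exact Hn1|]. split; [|exists h; auto].
    intros i. destruct (Nat.eq_dec i j) as [->|Hij].
    + split; [tauto|discriminate].
    + rewrite <- Hl, !in_app_iff. simpl. intuition congruence.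
  - destruct (H w) as (lw & Hnw & Hlw & (hw & Hew & Hhw & Ew)).
    exists lw. split; [exact Hnw|]. split.
    { intros i. rewrite Hlw. destruct (Nat.eq_dec i j) as [->|Hij]; [|tauto].
      rewrite Hj. split; [|discriminate]. intros K. injection K as K. congruence. }
    set (m := length lw) in *.
    assert (Hv0 : hw v = 0).
    { assert (K : (v - w) ^ m * hw v = (v - w) ^ m * 0).
      { rewrite <- Ew, Eg. ring. }
      apply Cmult_cancel in K; [exact K|]. apply Cpow_minus_neq_0. congruence. }
    assert (Eq : forall z, hw z = (z - v) * dquot hw v z).
    { intros z. rewrite (dquot_spec hw v z) at 1. rewrite Hv0. ring. }
    exists (dquot hw v). split; [apply dquot_entire, Hew|]. split.
    { intros K. apply Hhw. rewrite Eq, K. ring. }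
    assert (off : forall z, z <> v -> (z - v) ^ n * h z = (z - w) ^ m * dquot hw v z).
    { intros z Hz. apply (Cmult_cancel (z - v)); [apply Cminus_neq_0, Hz|].
      rewrite <- Eg, Ew, Eq. ring. }
    intros z. destruct (classic (z = v)) as [->|Hz]; [|apply off, Hz].
    apply (ccont_eq_off_point (fun z => (z - v) ^ n * h z) (fun z => (z - w) ^ m * dquot hw v z)).
    + apply holo_at_ccont, Hk.
    + apply holo_at_ccont. apply entire1_mult; [apply entire1_pow|apply dquot_entire, Hew].
    + exact off.
Qed.

Definition csum (a : nat -> C) (l : list nat) : C := fold_right (fun j s => a j + s) 0 l.
Definition rsum (a : nat -> R) (l : list nat) : R := fold_right (fun j s => (a j + s)%R) 0%R l.

Definition pole (zs : nat -> option C) (w : C) (j : nat) : C :=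
  match zs j with Some v => 1 / (w - v) | None => 0 end.

(** Dividing out the listed zeros with indices in [J], normalised so that the
    value at [w] is kept, changes the modulus by explicit factors and the
    logarithmic derivative at [w] by the corresponding poles. *)
Lemma lists_zeros_remove_list (w : C) (J : list nat) : forall (h : C -> C) (zs : nat -> option C),
  entire1 h -> lists_zeros h zs -> h w <> 0 -> NoDup J -> (forall j, In j J -> zs j <> None) ->
  exists u : C -> C, entire1 u /\ u w = h w /\
    lists_zeros u (fun i => if in_dec Nat.eq_dec i J then None else zs i) /\
    (forall z q, (0 <= q) ->
       (forall j v, In j J -> zs j = Some v -> (Cmod (w - v) <= q * Cmod (z - v))) ->
       (Cmod (u z) <= q ^ length J * Cmod (h z))) /\
    C_derive h w / h w = csum (pole zs w) J + C_derive u w / u w.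
Proof.
  induction J as [|j J IH]; intros h zs Hh Hz Hw HJ HS.
  - exists h. split; [exact Hh|]. split; [reflexivity|]. split; [exact Hz|]. split.
    + intros z q _ _. simpl. lra.
    + simpl. ring.
  - destruct (zs j) as [v|] eqn:Ej; [|exfalso; apply (HS j); [left; reflexivity|exact Ej]].
    destruct (lists_zeros_remove h zs j v Hz Ej) as (k & Hk & Ek & Hzk).
    assert (Hwv : w - v <> 0).
    { intros K. apply Hw. rewrite Ek, K. ring. }
    assert (Hkw : k w <> 0) by (intros K; apply Hw; rewrite Ek, K; ring).
    inversion HJ as [|j' J' HjJ HJ']; subst j' J'.
    destruct (IH (fun z => (w - v) * k z) (fun i => if Nat.eq_dec i j then None else zs i))
      as (u & Hu & Euw & Hzu & Hub & Hud).
    + apply entire1_scal, Hk.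
    + apply lists_zeros_scal; assumption.
    + rewrite <- Ek. exact Hw.
    + exact HJ'.
    + intros i Hi. destruct (Nat.eq_dec i j) as [->|_]; [contradiction|]. apply HS. right. exact Hi.
    + exists u. split; [exact Hu|]. split; [rewrite Euw, <- Ek; reflexivity|]. split; [|split].
      * refine (lists_zeros_ext _ _ _ _ Hzu). intros i.
        destruct (in_dec Nat.eq_dec i J) as [H1|H1]; destruct (in_dec Nat.eq_dec i (j :: J)) as [H2|H2].
        -- reflexivity.
        -- exfalso. apply H2. right. exact H1.
        -- destruct H2 as [->|H2]; [|contradiction]. destruct (Nat.eq_dec i i); [reflexivity|congruence].
        -- destruct (Nat.eq_dec i j) as [->|_]; [|reflexivity]. exfalso. apply H2. left. reflexivity.
      * intros z q Hq Hle.
        assert (Hj := Hle j v (or_introl eq_refl) Ej).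
        apply Rle_trans with (q ^ length J * Cmod ((w - v) * k z)%C)%R.
        -- apply Hub; [exact Hq|]. intros i x Hi Hx. apply (Hle i); [right; exact Hi|].
           destruct (Nat.eq_dec i j); [discriminate|exact Hx].
        -- simpl length. rewrite Ek, !Cmod_mult.
           replace (q ^ S (length J) * (Cmod (z - v) * Cmod (k z)))%R with
             (q ^ length J * ((q * Cmod (z - v)) * Cmod (k z)))%R by (simpl; ring).
           apply Rmult_le_compat_l; [apply pow_le, Hq|].
           apply Rmult_le_compat_r; [apply Cmod_ge_0|exact Hj].
      * assert (Dk := holo_at_cderiv k w (Hk w)).
        assert (Dh : C_derive h w = k w + (w - v) * C_derive k w).
        { apply cderiv_C_derive. apply (cderiv_ext (fun z => (z - v) * k z)); [intros; symmetry; apply Ek|].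
          assert (D1 := cderiv_sub_const v w).
          refine (cderiv_val _ _ _ _ _ (cderiv_mult _ _ w _ _ D1 Dk)). ring. }
        rewrite (cderiv_C_derive _ _ _ (cderiv_scal k w _ (w - v) Dk)) in Hud.
        rewrite Dh, Ek.
        change (csum (pole zs w) (j :: J)) with (pole zs w j + csum (pole zs w) J).
        assert (Ecs : csum (pole (fun i => if Nat.eq_dec i j then None else zs i) w) J = csum (pole zs w) J).
        { clear - HjJ. induction J as [|i J IHJ]; [reflexivity|].
          simpl. rewrite IHJ by (intros K; apply HjJ; right; exact K). f_equal.
          unfold pole. destruct (Nat.eq_dec i j) as [->|_]; [|reflexivity].
          exfalso. apply HjJ. left. reflexivity. }
        rewrite Ecs in Hud.
        replace (csum (pole zs w) J + C_derive u w / u w) with ((w - v) * C_derive k w / ((w - v) * k w)) by exact Hud.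
        replace (pole zs w j + csum (pole zs w) J + C_derive u w / u w) with
          (pole zs w j + (csum (pole zs w) J + C_derive u w / u w)) by ring.
        rewrite <- Hud. unfold pole. rewrite Ej. field. auto.
Qed.

(** * Partial fractions of the logarithmic derivative *)

Lemma exists_pow2_ge (x : R) : exists k : nat, (x <= 2 ^ k).
Proof.
  destruct (Pow_x_infinity 2) with (b := x) as [N HN].
  - rewrite Rabs_pos_eq; lra.
  - exists N. specialize (HN N (Nat.le_refl N)).
    rewrite Rabs_pos_eq in HN by (apply pow_le; lra). lra.
Qed.

Lemma rsum_filter (a : nat -> R) (b : nat -> bool) (l : list nat) :
  rsum a l = (rsum a (filter b l) + rsum a (filter (fun j => negb (b j)) l))%R.
Proof.
  induction l as [|j l IH]; simpl; [ring|]. rewrite IH. destruct (b j); simpl; ring.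
Qed.

Lemma rsum_le_const (a : nat -> R) (x : R) (l : list nat) :
  (forall j, In j l -> (a j <= x)) -> (rsum a l <= x * INR (length l)).
Proof.
  induction l as [|j l IH]; intros H; [simpl; lra|].
  change (length (j :: l)) with (S (length l)). rewrite S_INR.
  change (rsum a (j :: l)) with (a j + rsum a l)%R.
  assert (h1 := H j (or_introl eq_refl)).
  assert (h2 := IH (fun i Hi => H i (or_intror Hi))). lra.
Qed.

(** Dyadic summation: between [r] and [2 * r] there are at most
    [K * (2 * r) ^ c] terms, each below [1 / r], and these contributions form
    a geometric series of ratio [2 ^ (c - 1) < 1]. *)
Lemma counting_tail (d : nat -> R) (P : nat -> Prop) (K c : R) : (c < 1) -> (0 <= K) ->
  (forall r J, (1 <= r) -> NoDup J -> (forall j, In j J -> P j /\ (d j <= r)) ->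
     (INR (length J) <= K * Rpower r c)) ->
  exists T : R, (0 <= T) /\ forall r J, (1 <= r) -> NoDup J ->
    (forall j, In j J -> P j /\ (r < d j)) ->
    (rsum (fun j => / d j) J <= T * Rpower r (c - 1))%R.
Proof.
  intros Hc HK Hcount.
  set (q := Rpower 2 (c - 1)).
  assert (Hq : (0 < q < 1)).
  { split; [apply exp_pos|]. unfold q, Rpower.
    apply Rlt_le_trans with (exp 0); [|rewrite exp_0; lra]. apply exp_increasing.
    assert (h : (0 < ln 2)) by (rewrite <- ln_1; apply ln_increasing; lra). nra. }
  assert (h2c : (0 < Rpower 2 c)) by apply exp_pos.
  set (T := (K * Rpower 2 c / (1 - q))%R).
  assert (HT : (0 <= T)).
  { unfold T, Rdiv. apply Rmult_le_pos; [apply Rmult_le_pos; lra|].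
    apply Rlt_le, Rinv_0_lt_compat. lra. }
  assert (ET : (K * Rpower 2 c + T * q = T)%R) by (unfold T; field; lra).
  exists T. split; [exact HT|].
  assert (main : forall k r J, (1 <= r) -> NoDup J ->
    (forall j, In j J -> P j /\ (r < d j <= 2 ^ k * r)) ->
    (rsum (fun j => / d j) J <= T * Rpower r (c - 1))%R).
  { induction k as [|k IH]; intros r J Hr HJ Hd.
    - destruct J as [|j J].
      + simpl. apply Rmult_le_pos; [exact HT|apply Rlt_le, exp_pos].
      + exfalso. destruct (Hd j (or_introl eq_refl)) as [_ h]. simpl in h. lra.
    - set (b := fun j => if Rle_dec (d j) (2 * r) then true else false).
      rewrite (rsum_filter _ b). rewrite <- ET, Rmult_plus_distr_r.
      apply Rplus_le_compat.
      + assert (N1 : (INR (length (filter b J)) <= K * Rpower (2 * r) c)).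
        { apply Hcount; [lra|apply NoDup_filter, HJ|]. intros j Hj. apply filter_In in Hj.
          destruct Hj as [Hj Hb]. split; [apply Hd, Hj|]. unfold b in Hb.
          destruct (Rle_dec (d j) (2 * r)); [assumption|discriminate]. }
        apply Rle_trans with (/ r * INR (length (filter b J)))%R.
        * apply rsum_le_const. intros j Hj. apply filter_In in Hj. destruct Hj as [Hj _].
          destruct (Hd j Hj) as [_ h]. apply Rinv_le_contravar; lra.
        * apply Rle_trans with (/ r * (K * Rpower (2 * r) c))%R.
          -- apply Rmult_le_compat_l; [apply Rlt_le, Rinv_0_lt_compat; lra|exact N1].
          -- rewrite <- Rpower_mult_distr by lra.
             replace (Rpower r (c - 1)) with (Rpower r c * / r)%R.
             { right. ring. }
             unfold Rminus. rewrite Rpower_plus, Rpower_Ropp, Rpower_1 by lra. reflexivity.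
      + replace (T * q * Rpower r (c - 1))%R with (T * Rpower (2 * r) (c - 1))%R.
        2: { rewrite <- Rpower_mult_distr by lra. unfold q. ring. }
        apply IH; [lra|apply NoDup_filter, HJ|]. intros j Hj. apply filter_In in Hj.
        destruct Hj as [Hj Hb]. unfold b in Hb.
        destruct (Rle_dec (d j) (2 * r)) as [|Hgt]; [discriminate|].
        destruct (Hd j Hj) as [HP h]. split; [exact HP|]. simpl in h. split; [lra|].
        replace (2 ^ k * (2 * r))%R with (2 * 2 ^ k * r)%R by ring. apply h. }
  intros r J Hr HJ Hd.
  assert (Hk : exists k, forall j, In j J -> (d j <= 2 ^ k * r)).
  { clear HJ Hd. induction J as [|i J [k Hk]]; [exists 0%nat; intros j []|].
    destruct (exists_pow2_ge (d i)) as [m Hm]. exists (k + m)%nat.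
    assert (p1 : (1 <= 2 ^ k)) by (apply pow_R1_Rle; lra).
    assert (p2 : (1 <= 2 ^ m)) by (apply pow_R1_Rle; lra).
    rewrite pow_add. intros j [->|Hj].
    - apply Rle_trans with (2 ^ m)%R; [exact Hm|].
      assert (2 ^ m <= 2 ^ k * 2 ^ m) by nra. nra.
    - apply Rle_trans with (2 ^ k * r)%R; [apply Hk, Hj|].
      apply Rmult_le_compat_r; [lra|]. nra. }
  destruct Hk as [k Hk]. apply (main k); [exact Hr|exact HJ|].
  intros j Hj. destruct (Hd j Hj) as [HP h]. split; [exact HP|]. split; [exact h|apply Hk, Hj].
Qed.

(** Otherwise there would be arbitrarily long lists of indices. *)
Lemma bounded_count_finite (Q : nat -> Prop) (X : R) :
  (forall J, NoDup J -> (forall j, In j J -> Q j) -> (INR (length J) <= X)) ->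
  exists N : nat, forall j, Q j -> (j < N)%nat.
Proof.
  intros H. apply NNPP. intros N.
  assert (Hex : forall n, exists j, (n <= j)%nat /\ Q j).
  { intros n. apply NNPP. intros K. apply N. exists n. intros j Hj.
    destruct (Nat.le_gt_cases n j) as [Hnj|Hnj]; [|exact Hnj]. exfalso. apply K. exists j. auto. }
  assert (Hl : forall m, exists J, NoDup J /\ (forall j, In j J -> Q j) /\ length J = m).
  { induction m as [|m (J & H1 & H2 & H3)]; [exists nil; repeat split; [constructor|intros j []]|].
    destruct (Hex (S (list_max J))) as [j [Hj HQ]].
    exists (j :: J). split; [|split; [|simpl; congruence]].
    - constructor; [|exact H1]. intros K.
      assert (HB : List.Forall (fun k => (k <= list_max J)%nat) J) by (apply list_max_le; lia).
      rewrite Forall_forall in HB. specialize (HB j K). lia.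
    - intros i [<-|Hi]; auto. }
  destruct (INR_unbounded X) as [m Hm]. destruct (Hl m) as (J & H1 & H2 & H3).
  specialize (H J H1 H2). rewrite H3 in H. lra.
Qed.

Lemma sum_n_csum (a : nat -> C) (n : nat) :
  @sum_n C_NormedModule a n = csum a (seq 0 (S n)).
Proof.
  assert (A : forall l j, csum a (l ++ j :: nil) = csum a l + a j).
  { induction l as [|i l IH]; intros j; simpl; [ring|]. rewrite IH. ring. }
  induction n as [|n IH].
  - rewrite sum_O. simpl. ring.
  - rewrite sum_Sn, IH, (seq_S (S n)), A. reflexivity.
Qed.

Lemma is_series_C_iff (a : nat -> C) (l : C) :
  (forall eps : R, (0 < eps) -> exists N : nat, forall n, (N <= n)%nat ->
     (Cmod (csum a (seq 0 (S n)) - l) <= eps)) ->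
  @is_series C_AbsRing C_NormedModule a l.
Proof.
  intros H P [eps HP]. destruct (H (eps / 2)%R) as [N HN].
  { assert (h := cond_pos eps). lra. }
  exists N. intros n Hn. apply HP. apply C_NormedModule_mixin_compat1.
  change (Cmod (@sum_n C_NormedModule a n - l) < eps).
  rewrite sum_n_csum. specialize (HN n Hn). assert (h := cond_pos eps). lra.
Qed.

Lemma Rpower_small (c eps : R) : (c < 1) -> (0 < eps) ->
  exists r : R, (1 <= r) /\ (Rpower r (c - 1) <= eps).
Proof.
  intros Hc He. set (t := Rmax 0 (ln eps / (c - 1))).
  assert (t1 := Rmax_l 0 (ln eps / (c - 1))). assert (t2 := Rmax_r 0 (ln eps / (c - 1))). fold t in t1, t2.
  exists (exp t). split.
  - rewrite <- exp_0. apply exp_le, t1.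
  - unfold Rpower. rewrite ln_exp. rewrite <- (exp_ln eps) by exact He. apply exp_le.
    replace (ln eps) with ((c - 1) * (ln eps / (c - 1)))%R by (field; lra).
    apply Rmult_le_compat_neg_l; lra.
Qed.

(** For growth of order below one the logarithmic derivative at a point has a
    partial fraction expansion without polynomial part.  Dividing out the zeros
    within distance [r], the remaining factor is zero-free near [w] and has a
    logarithmic derivative of size [r ^ (c - 1)] at [w]; the same bound holds
    for the poles at distance more than [r], in whatever order they are
    listed. *)
Theorem log_derivative_series (h : C -> C) (w : C) (zs : nat -> option C) (c A : R) :
  entire1 h -> h w <> 0 -> (0 < c < 1) ->
  (forall z, (1 <= Cmod (z - w)) -> (Cmod (h z) <= A * weight c (z - w)%C)) ->
  lists_zeros h zs ->
  @is_series C_AbsRing C_NormedModule (pole zs w) (C_derive h w / h w).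
Proof.
  intros Hh Hw Hc HA Hzs.
  assert (Hm := proj1 (Cmod_gt_0 _) Hw).
  assert (HA0 : (0 <= A)).
  { assert (K := HA (w + 1)). replace (w + 1 - w) with (RtoC 1) in K by ring.
    rewrite Cmod_1 in K. specialize (K (Rle_refl _)).
    assert (h1 := Cmod_ge_0 (h (w + 1))). assert (h2 := weight_ge_1 c 1). nra. }
  set (B := (A / Cmod (h w) + 1)%R).
  assert (HB1 : (1 <= B)).
  { unfold B. assert (0 <= A / Cmod (h w)); [|lra].
    apply Rmult_le_pos; [exact HA0|apply Rlt_le, Rinv_0_lt_compat, Hm]. }
  assert (HlnB : (0 <= ln B)).
  { destruct HB1 as [HB1|HB1]; [rewrite <- ln_1; apply Rlt_le, ln_increasing; lra|rewrite <- HB1, ln_1; lra]. }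
  set (K := (ln B + 5)%R).
  assert (growth : forall r z, (1 <= r) -> (1 <= Cmod (z - w) <= 4 * r) ->
    (Cmod (h z) <= exp (K * Rpower r c) * Cmod (h w))).
  { intros r z Hr Hz. eapply Rle_trans; [apply HA, Hz|].
    apply Rle_trans with (B * Cmod (h w) * weight c (z - w))%R.
    - apply Rmult_le_compat_r; [apply Rlt_le, exp_pos|].
      unfold B. replace ((A / Cmod (h w) + 1) * Cmod (h w))%R with (A + Cmod (h w))%R by (field; lra). lra.
    - replace (exp (K * Rpower r c) * Cmod (h w))%R with (Cmod (h w) * exp (K * Rpower r c))%R by ring.
      replace (B * Cmod (h w) * weight c (z - w))%R with (Cmod (h w) * (B * weight c (z - w)))%R by ring.
      apply Rmult_le_compat_l; [lra|].
      rewrite <- (exp_ln B) by lra. unfold weight. rewrite <- exp_plus. apply exp_le.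
      assert (P1 : (1 <= Rpower r c)).
      { rewrite <- (Rpower_O r) by lra. apply Rle_Rpower; lra. }
      assert (P2 : (Rpower (1 + Cmod (z - w)) c <= 5 * Rpower r c)).
      { apply Rle_trans with (Rpower (5 * r) c).
        - apply Rle_Rpower_l; [lra|]. assert (h0 := Cmod_ge_0 (z - w)). lra.
        - rewrite <- Rpower_mult_distr by lra. apply Rmult_le_compat_r; [lra|].
          rewrite <- (Rpower_1 5) at 2 by lra. apply Rle_Rpower; lra. }
      unfold K. nra. }
  pose (d := fun j => match zs j with Some v => Cmod (w - v) | None => 0%R end).
  assert (count : forall r J, (1 <= r) -> NoDup J ->
    (forall j, In j J -> zs j <> None /\ (d j <= r)) -> (INR (length J) <= K * Rpower r c)).
  { intros r J Hr HJ Hd.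
    destruct (lists_zeros_remove_list w J h zs Hh Hzs Hw HJ (fun j Hj => proj1 (Hd j Hj)))
      as (u & Hu & Euw & _ & Hub & _).
    set (n := length J) in *. set (X := (K * Rpower r c)%R) in *.
    assert (M : (Cmod (u w) <= (/ 3) ^ n * (exp X * Cmod (h w)))).
    { apply (max_principle u w w (4 * r)); [exact Hu| |rewrite Cmod_self; lra].
      intros y Hy. eapply Rle_trans; [apply (Hub y (/ 3)%R); [lra|]|].
      - intros j v Hj Ev. destruct (Hd j Hj) as [_ Hdj]. unfold d in Hdj. rewrite Ev in Hdj.
        assert (T := Cmod_dist_triangle y v w).
        rewrite (Cmod_minus_sym v w) in T. lra.
      - apply Rmult_le_compat_l; [apply pow_le; lra|]. apply growth; lra. }
    rewrite Euw in M.
    assert (M2 : (3 ^ n <= exp X)).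
    { assert (p3 : (0 < 3 ^ n)) by (apply pow_lt; lra).
      rewrite pow_inv in M.
      apply Rmult_le_reg_r with (Cmod (h w)); [exact Hm|].
      apply Rmult_le_reg_l with (/ 3 ^ n)%R; [apply Rinv_0_lt_compat, p3|].
      rewrite <- Rmult_assoc, Rinv_l, Rmult_1_l by lra. exact M. }
    assert (M3 : (exp (INR n) <= exp X)).
    { eapply Rle_trans; [|exact M2].
      replace (exp (INR n)) with (exp 1 ^ n)%R.
      - apply pow_incr. split; [apply Rlt_le, exp_pos|apply exp_le_3].
      - rewrite <- Rpower_pow by apply exp_pos. unfold Rpower. rewrite ln_exp, Rmult_1_r. reflexivity. }
    destruct (Rle_or_lt (INR n) X) as [L|L]; [exact L|]. apply exp_increasing in L. lra. }
  destruct (counting_tail d (fun j => zs j <> None) K c) as (T & HT & tail); [lra|unfold K; lra|exact count|].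
  apply is_series_C_iff. intros eps He.
  assert (HC : (0 < T + 4 * K + 1)) by (unfold K; lra).
  destruct (Rpower_small c (eps / (T + 4 * K + 1))) as (r & Hr & Hsmall); [lra|apply Rdiv_lt_0_compat; lra|].
  pose (near := fun j => match zs j with
    Some v => if Rle_dec (Cmod (w - v)) r then true else false | None => false end).
  pose (far := fun j => match zs j with
    Some v => if Rle_dec (Cmod (w - v)) r then false else true | None => false end).
  assert (Hnear : forall j, near j = true -> zs j <> None /\ (d j <= r)).
  { intros j. unfold near, d. destruct (zs j) as [v|]; [|discriminate].
    destruct (Rle_dec (Cmod (w - v)) r); [|discriminate]. split; [discriminate|assumption]. }
  assert (Hfar : forall j, far j = true -> zs j <> None /\ (r < d j)).
  { intros j. unfold far, d. destruct (zs j) as [v|]; [|discriminate].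
    destruct (Rle_dec (Cmod (w - v)) r); [discriminate|]. split; [discriminate|lra]. }
  destruct (bounded_count_finite (fun j => near j = true) (K * Rpower r c)) as [N HN].
  { intros J HJ HQ. apply count; [exact Hr|exact HJ|]. intros j Hj. apply Hnear, HQ, Hj. }
  exists N. intros n Hn. set (l := seq 0 (S n)). set (J := filter near l).
  assert (HJ : NoDup J) by (apply NoDup_filter, seq_NoDup).
  assert (HJin : forall j, In j J <-> near j = true).
  { intros j. unfold J. rewrite filter_In. split; [tauto|]. intros Hj. split; [|exact Hj].
    apply in_seq. specialize (HN j Hj). lia. }
  assert (split_sum : csum (pole zs w) l = csum (pole zs w) J + csum (pole zs w) (filter far l)).
  { assert (cases : forall j, (near j = true /\ far j = false) \/
      (near j = false /\ far j = true) \/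
      (near j = false /\ far j = false /\ pole zs w j = 0)).
    { intros j. unfold near, far, pole. destruct (zs j) as [v|]; [|auto].
      destruct (Rle_dec (Cmod (w - v)) r); auto. }
    unfold J. generalize l. induction l0 as [|j l0 IH]; simpl; [ring|]. rewrite IH.
    destruct (cases j) as [[-> ->]|[[-> ->]|(-> & -> & ->)]]; simpl; ring. }
  destruct (lists_zeros_remove_list w J h zs Hh Hzs Hw HJ
    (fun j Hj => proj1 (Hnear j (proj1 (HJin j) Hj)))) as (u & Hu & Euw & Hzu & Hub & Hud).
  assert (Hr0 : (0 < Rpower r (c - 1))) by apply exp_pos.
  assert (Erc : (Rpower r c / r = Rpower r (c - 1))%R).
  { unfold Rminus. rewrite Rpower_plus, Rpower_Ropp, Rpower_1 by lra. reflexivity. }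
  assert (L1 : (Cmod (C_derive u w / u w) <= 4 * K * Rpower r (c - 1))).
  { replace (4 * K * Rpower r (c - 1))%R with (2 * (K * Rpower r c) / (r / 2))%R
      by (rewrite <- Erc; field; lra).
    apply (log_derivative_bound u w r); [lra|intros z _; apply Hu| |].
    - intros z Hz. apply (lists_zeros_neq _ _ z Hzu). intros j.
      destruct (in_dec Nat.eq_dec j J) as [Hj|Hj]; [discriminate|]. intros Ej. apply Hj, HJin.
      unfold near. rewrite Ej. rewrite Cmod_minus_sym in Hz.
      destruct (Rle_dec (Cmod (w - z)) r); [reflexivity|lra].
    - intros z Hz. rewrite Euw. apply (max_principle u w z (2 * r)); [exact Hu| |lra].
      intros y Hy. eapply Rle_trans; [apply (Hub y 1%R); [lra|]|].
      + intros j v Hj Ev. destruct (Hnear j (proj1 (HJin j) Hj)) as [_ Hdj]. unfold d in Hdj. rewrite Ev in Hdj.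
        assert (T1 := Cmod_dist_triangle y v w).
        rewrite (Cmod_minus_sym v w) in T1. lra.
      + rewrite pow1, Rmult_1_l. apply growth; lra. }
  assert (L2 : (Cmod (csum (pole zs w) (filter far l)) <= T * Rpower r (c - 1))).
  { assert (Hf : forall j, In j (filter far l) -> zs j <> None /\ (r < d j))
      by (intros j Hj; apply Hfar; apply filter_In in Hj; apply Hj).
    eapply Rle_trans; [|apply (tail r (filter far l) Hr (NoDup_filter _ (seq_NoDup _ _)) Hf)].
    revert Hf. generalize (filter far l). clear - Hr. intros l Hf.
    induction l as [|j l IH]; simpl; [rewrite Cmod_0; lra|].
    eapply Rle_trans; [apply Cmod_triangle|]. apply Rplus_le_compat.
    - destruct (Hf j (or_introl eq_refl)) as [h1 h2]. unfold d in *. unfold pole.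
      destruct (zs j) as [v|]; [|congruence].
      assert (Hv : w - v <> 0) by (apply Cmod_gt_0; lra).
      rewrite Cmod_div, Cmod_1 by exact Hv. lra.
    - apply IH. intros i Hi. apply Hf. right. exact Hi. }
  fold l. rewrite split_sum, Hud.
  replace (csum (pole zs w) J + csum (pole zs w) (filter far l) - (csum (pole zs w) J + C_derive u w / u w))
    with (csum (pole zs w) (filter far l) - C_derive u w / u w) by ring.
  eapply Rle_trans; [apply Cmod_triangle_minus|].
  replace eps with ((T + 4 * K + 1) * (eps / (T + 4 * K + 1)))%R by (field; lra).
  apply Rle_trans with ((T + 4 * K + 1) * Rpower r (c - 1))%R; [lra|].
  apply Rmult_le_compat_l; lra.
Qed.

(** * Motion of the zeros *)

Lemma open_disc (D : C -> Prop) (t : C) : @open C_UniformSpace D -> D t ->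
  exists r : R, (0 < r) /\ forall s, (Cmod (s - t) < r) -> D s.
Proof.
  intros HD Ht. destruct (HD t Ht) as [[r Hr] H]. exists r. split; [exact Hr|].
  intros s Hs. apply H. apply C_NormedModule_mixin_compat1. exact Hs.
Qed.

Lemma locally'_disc (P : C -> Prop) (t : C) (r : R) : (0 < r) ->
  (forall s, s <> t -> (Cmod (s - t) < r) -> P s) -> @locally' C_UniformSpace t P.
Proof.
  intros Hr H. assert (Hr2 : (0 < r / 2)) by lra.
  exists (mkposreal _ Hr2). intros s [h1 h2] Hne. apply H; [exact Hne|].
  replace r with (2 * (r / 2))%R by field. destruct s as [x y], t as [u v].
  apply Cmod_coord; assumption.
Qed.

(** Along a curve on which [G] and its [z]-derivative vanish, differentiating
    [G (s, c s) = 0] gives that the derivative of order [n + 2] vanishes as soon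
    as those of order [n] and [n + 1] do; thus [G] is flat at a point. *)
Lemma heat_double_zero_curve (G : C -> C -> C) (c : C -> C) (t : C) (r : R) :
  heat_class G -> (0 < r) ->
  (forall s, (Cmod (s - t) < r) -> holo_at c s) ->
  (forall s, (Cmod (s - t) < r) -> G s (c s) = 0) ->
  (forall s, (Cmod (s - t) < r) -> C_derive (G s) (c s) = 0) ->
  forall s z, G s z = 0.
Proof.
  intros HG Hr Hc H0 H1.
  assert (flat : forall n s, (Cmod (s - t) < r) ->
    derive_iter n (G s) (c s) = 0 /\ derive_iter (S n) (G s) (c s) = 0).
  { induction n as [|n IH]; intros s Hs; [split; [apply H0|apply H1]; exact Hs|].
    split; [apply IH, Hs|].
    assert (D := heat_chain_rule (fun s => derive_iter n (G s)) c s _ (heat_class_iter G n HG)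
      (holo_at_cderiv c s (Hc s Hs))).
    assert (D0 : cderiv (fun s => derive_iter n (G s) (c s)) s 0).
    { apply (cderiv_ext_near (fun _ => 0) _ s 0 (r - Cmod (s - t))); [lra| |apply cderiv_const].
      intros y Hy. symmetry. apply IH. assert (T := Cmod_dist_triangle y s t). lra. }
    assert (E := cderiv_unique _ _ _ _ D D0).
    change (derive_iter (S (S n)) (G s) (c s)) with (C_derive (C_derive (derive_iter n (G s))) (c s)).
    destruct (IH s Hs) as [_ E1].
    change (derive_iter (S n) (G s) (c s)) with (C_derive (derive_iter n (G s)) (c s)) in E1.
    cbv beta in E. rewrite E1 in E. rewrite <- E. ring. }
  apply (heat_flat_point G t (c t) HG). intros k. apply flat. rewrite Cmod_self. exact Hr.
Qed.

Lemma derive_factor (f k : C -> C) (w : C) : entire1 k -> (forall z, f z = (z - w) * k z) ->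
  C_derive f w = k w /\ C_derive (C_derive f) w = 2 * C_derive k w.
Proof.
  intros Hk Ef.
  assert (D1 := cderiv_sub_const w).
  assert (E1 : forall z, C_derive f z = k z + (z - w) * C_derive k z).
  { intros z. apply cderiv_C_derive.
    apply (cderiv_ext (fun y => (y - w) * k y)); [intros; symmetry; apply Ef|].
    refine (cderiv_val _ _ _ _ _ (cderiv_mult _ _ z _ _ (D1 z) (holo_at_cderiv k z (Hk z)))). ring. }
  split; [rewrite E1; ring|].
  apply cderiv_C_derive.
  apply (cderiv_ext (fun z => k z + (z - w) * C_derive k z)); [intros; symmetry; apply E1|].
  assert (Dk := holo_at_cderiv _ w (entire1_derive k Hk w)).
  refine (cderiv_val _ _ _ _ _ (cderiv_plus _ _ w _ _ (holo_at_cderiv k w (Hk w))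
    (cderiv_mult _ _ w _ _ (D1 w) Dk))). ring.
Qed.

(** If two indices carried the value [w], its multiplicity would be at least two
    and the derivative would vanish. *)
Lemma simple_zero_listed_once (f : C -> C) (zs : nat -> option C) (w : C) (k : nat) :
  lists_zeros f zs -> zs k = Some w -> C_derive f w <> 0 ->
  forall j, j <> k -> zs j <> Some w.
Proof.
  intros Hf Hk Hd j Hjk Hj. destruct (Hf w) as (l & Hn & Hl & (h & Hh & _ & E)).
  apply Hl in Hk. apply Hl in Hj.
  destruct l as [|a [|b l]].
  - destruct Hk.
  - destruct Hk as [Hk|[]]. destruct Hj as [Hj|[]]. congruence.
  - apply Hd. set (m := length l) in *.
    destruct (derive_factor f (fun z => (z - w) ^ S m * h z) w) as [E1 _].
    + apply entire1_mult; [apply entire1_pow|exact Hh].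
    + intros z. rewrite E. simpl. fold m. ring.
    + rewrite E1, Cpow_self_minus. ring.
Qed.

Lemma other_zero_term_pole (zs : nat -> option C) (k : nat) (w : C) (j : nat) :
  other_zero_term zs k w j = pole (fun i => if Nat.eq_dec i k then None else zs i) w j.
Proof. unfold other_zero_term, pole. destruct (Nat.eq_dec j k); reflexivity. Qed.

Theorem mainTheorem7
  (F : C -> C -> C)
  (F_entire : entire2 F)
  (F_nonzero : exists t z : C, F t z <> 0)
  (F_heat : heat_equation F)
  (t0 : C)
  (F_order : Rbar_lt (entire_order (F t0)) 1%R)
  (D : C -> Prop)
  (D_domain : complex_domain D)
  (zk : C -> C)
  (zk_holomorphic : holomorphic_on D zk)
  (zk_zero : forall t : C, D t -> F t (zk t) = 0) :
  exists E : C -> Prop,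
    discrete_subset E D /\
    forall t : C, D t -> ~ E t ->
    forall (zs : nat -> option C) (k : nat),
      lists_zeros (F t) zs ->
      zs k = Some (zk t) ->
      (* every denominator is nonzero *)
      (forall j : nat, j <> k -> zs j <> Some (zk t)) /\
      exists S : C,
        is_series (K := C_AbsRing) (V := C_NormedModule)
          (other_zero_term zs k (zk t)) S /\
        is_derive (K := C_AbsRing) (V := C_NormedModule) zk t (- 2 * S).
Proof.
  assert (HF := entire2_heat_class F F_entire F_heat).
  destruct D_domain as (_ & D_open & _).
  assert (Fz_holo : forall t, D t -> holo_at (fun s => C_derive (F s) (zk s)) t).
  { intros t Ht. eexists. apply (heat_chain_rule (fun s => C_derive (F s))).
    - apply heat_class_dz, HF.
    - apply holo_at_cderiv, zk_holomorphic, Ht. }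
  exists (fun t => D t /\ C_derive (F t) (zk t) = 0). split.
  - split; [intros t [Ht _]; exact Ht|]. intros t Ht.
    destruct (open_disc D t D_open Ht) as (r & Hr & HD).
    set (phi := fun s => C_derive (F s) (zk s)) in *.
    assert (Hphi : holo_disc phi t (r / 2)) by (intros s Hs; apply Fz_holo, HD; lra).
    destruct (classic (exists n, derive_iter n phi t <> 0)) as [Hex|Hnone].
    + destruct (zeros_isolated phi t (r / 2)) as (d & Hd & Hiso); [lra|exact Hphi|exact Hex|].
      apply (locally'_disc _ t d Hd). intros s Hne Hs [_ K]. exact (Hiso s Hne Hs K).
    + exfalso. destruct F_nonzero as (t1 & z1 & Hne). apply Hne.
      apply (heat_double_zero_curve F zk t (r / 26) HF); [lra| | |].
      * intros s Hs. apply zk_holomorphic, HD. lra.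
      * intros s Hs. apply zk_zero, HD. lra.
      * intros s Hs. apply (holo_zero_derivatives phi t s (r / 26)); [lra| | |lra].
        -- replace (13 * (r / 26))%R with (r / 2)%R by field. exact Hphi.
        -- intros n. apply NNPP. intros K. apply Hnone. exists n. exact K.
  - intros t Ht HE zs k Hzs Hk.
    assert (Hsimple : C_derive (F t) (zk t) <> 0) by (intros K; apply HE; auto).
    split; [exact (simple_zero_listed_once _ _ _ _ Hzs Hk Hsimple)|].
    set (w := zk t) in *.
    destruct (lists_zeros_remove _ _ _ _ Hzs Hk) as (h & Hh & Eh & Hzh).
    destruct (derive_factor _ _ _ Hh Eh) as [E1 E2].
    assert (Hhw : h w <> 0) by (rewrite <- E1; exact Hsimple).
    exists (C_derive h w / h w). split.
    + apply (is_series_ext (pole (fun i => if Nat.eq_dec i k then None else zs i) w));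
        [intros j; symmetry; apply other_zero_term_pole|].
      destruct (order_growth (F t0) (heat_entire_z F HF t0) F_order) as (c & A & Hc & HA & Hgrow).
      assert (Hgt := heat_growth F (weight c) A t0 HF HA).
      assert (Hgt' : forall z, (Cmod (F t z) <= A * exp (36 * Cmod (t - t0)) * weight c z)).
      { intros z. apply Hgt; [| |exact Hgrow].
        - intros y. assert (h1 := weight_ge_1 c y). lra.
        - intros x y Hxy. eapply Rle_trans; [apply (weight_shift c x y); lra|].
          apply Rmult_le_compat_r; [assert (h1 := weight_ge_1 c y); lra|].
          eapply Rle_trans; [apply exp_le, Hxy|apply exp_le_3]. }
      set (A' := (A * exp (36 * Cmod (t - t0)))%R) in *.
      assert (HA' : (0 <= A')) by (apply Rmult_le_pos; [exact HA|apply Rlt_le, exp_pos]).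
      apply (log_derivative_series h w _ c (A' * exp (Cmod w))); [exact Hh|exact Hhw|exact Hc| |exact Hzh].
      intros z Hz. apply Rle_trans with (Cmod (F t z)).
      * rewrite Eh, Cmod_mult. assert (h1 := Cmod_ge_0 (h z)). nra.
      * eapply Rle_trans; [apply Hgt'|]. rewrite Rmult_assoc.
        apply Rmult_le_compat_l; [exact HA'|].
        eapply Rle_trans; [apply (weight_shift c z (z - w)); lra|].
        replace (z - (z - w)) with w by ring. lra.
    + assert (Dz := holo_at_cderiv zk t (zk_holomorphic t Ht)).
      refine (cderiv_val zk t _ _ _ Dz).
      assert (D1 := heat_chain_rule F zk t _ HF Dz). fold w in D1. rewrite E1, E2 in D1.
      destruct (open_disc D t D_open Ht) as (r & Hr & HD).
      assert (D0 : cderiv (fun s => F s (zk s)) t 0).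
      { apply (cderiv_ext_near (fun _ => 0) _ t 0 r Hr); [|apply cderiv_const].
        intros y Hy. symmetry. apply zk_zero, HD, Hy. }
      assert (E := cderiv_unique _ _ _ _ D1 D0).
      apply (Cmult_cancel (h w)); [exact Hhw|].
      replace (h w * C_derive zk t) with (2 * C_derive h w + C_derive zk t * h w - 2 * C_derive h w) by ring.
      rewrite E. field. exact Hhw.
Qed.
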